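(* Let $A$ be an r.e. theory whose Turing degree is less than $\mathbf{0}'$ and for which $\mathsf{G1}$ holds. Then one can effectively find an r.e. theory $B$ such that $\mathsf{G1}$ holds for $B$ and $A\lhd B$.
   Context: Theories are first-order with finite signature, identified with their theorem sets; the Turing degree of a theory is that of its theorem set. $\mathsf{G1}$ holds for an r.e. theory $T$ if every consistent r.e. theory interpreting $T$ is incomplete (equivalently $T$ is essentially undecidable). $A\lhd B$ means $A$ is interpretable in $B$ but $B$ is not interpretable in $A$. *)

(* Defs.v *)
From Stdlib Require List Arith.Cantor.
From mathcomp Require Import all_boot.

Set Implicit Arguments.
Unset Strict Implicit.
Unset Printing Implicit Defensive.

(** * Computability relative to an oracle *)

Definition npair (x y : nat) : nat := Cantor.to_nat (x, y).
Definition nfst (n : nat) : nat := (Cantor.of_nat n).1.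
Definition nsnd (n : nat) : nat := (Cantor.of_nat n).2.

Definition seq_code (s : seq nat) : nat :=
  foldr (fun x n => (npair x n).+1) 0 s.

(* Programs for the partial recursive functions with an oracle. All functions
   are unary; several arguments are passed as one number through [npair]. *)
Inductive code : Type :=
| Zero
| Succ
| Fst
| Snd
| Oracle
| Pair of code & code
| Comp of code & code
| Prec of code & code
| Mu of code.

Fixpoint code_num (c : code) : nat :=
  match c with
  | Zero => npair 0 0
  | Succ => npair 1 0
  | Fst => npair 2 0
  | Snd => npair 3 0
  | Oracle => npair 4 0
  | Pair c d => npair 5 (npair (code_num c) (code_num d))
  | Comp c d => npair 6 (npair (code_num c) (code_num d))
  | Prec c d => npair 7 (npair (code_num c) (code_num d))
  | Mu c => npair 8 (code_num c)
  end.

(* [eval X c x y]: with the characteristic function of [X] as oracle, program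
   [c] halts on input [x] with output [y]. *)
Fixpoint eval (X : nat -> Prop) (c : code) (x y : nat) : Prop :=
  match c with
  | Zero => y = 0
  | Succ => y = x.+1
  | Fst => y = nfst x
  | Snd => y = nsnd x
  | Oracle => (X x /\ y = 1) \/ (~ X x /\ y = 0)
  | Pair c d => exists u v, eval X c x u /\ eval X d x v /\ y = npair u v
  | Comp c d => exists u, eval X d x u /\ eval X c u y
  | Prec c d =>
      (* h(a, 0) = c(a) and h(a, n+1) = d(a, (n, h(a, n))), with x = (a, n) *)
      let a := nfst x in
      (fix h (n y : nat) : Prop :=
         match n with
         | 0 => eval X c a y
         | n.+1 => exists i, h n i /\ eval X d (npair a (npair n i)) y
         end) (nsnd x) y
  | Mu c =>
      eval X c (npair x y) 0 /\
      forall m, m < y -> exists k, eval X c (npair x m) k.+1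
  end.

Definition empty_oracle : nat -> Prop := fun _ => False.

Definition computes (c : code) (x y : nat) : Prop := eval empty_oracle c x y.

(* The [e]-th r.e. set: the domain of the program numbered [e]. It is empty
   when [e] is not the number of a program. *)
Definition W (e x : nat) : Prop :=
  exists c, code_num c = e /\ exists y, computes c x y.

Definition turing_le (X Y : nat -> Prop) : Prop :=
  exists c, forall n, (X n -> eval Y c n 1) /\ (~ X n -> eval Y c n 0).

Definition turing_lt (X Y : nat -> Prop) : Prop :=
  turing_le X Y /\ ~ turing_le Y X.

Definition jump (X : nat -> Prop) (e : nat) : Prop :=
  exists c, code_num c = e /\ exists y, eval X c e y.

Definition zero_jump : nat -> Prop := jump empty_oracle.

(** * First-order logic with equality *)

(* The [i]-th function (relation) symbol has as arity the [i]-th entry of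
   [funs] ([rels]); constants are the function symbols of arity 0. *)
Record signature : Type := Signature { funs : seq nat; rels : seq nat }.

Definition sig_code (L : signature) : nat :=
  npair (seq_code (funs L)) (seq_code (rels L)).

(* De Bruijn indices: [All] binds the variable 0 of its body. *)
Inductive term : Type :=
| Var of nat
| Func of nat & seq term.

Inductive form : Type :=
| Bot
| Eq of term & term
| Rel of nat & seq term
| Imp of form & form
| All of form.

Definition Neg (p : form) : form := Imp p Bot.
Definition Top : form := Neg Bot.
Definition And (p q : form) : form := Neg (Imp p (Neg q)).
Definition Ex (p : form) : form := Neg (All (Neg p)).

Fixpoint term_code (t : term) : nat :=
  match t with
  | Var x => npair 0 x
  | Func f ts => npair 1 (npair f (seq_code (map term_code ts)))
  end.

Fixpoint form_code (p : form) : nat :=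
  match p with
  | Bot => npair 0 0
  | Eq t s => npair 1 (npair (term_code t) (term_code s))
  | Rel r ts => npair 2 (npair r (seq_code (map term_code ts)))
  | Imp p q => npair 3 (npair (form_code p) (form_code q))
  | All p => npair 4 (form_code p)
  end.

Fixpoint term_in (L : signature) (t : term) : bool :=
  match t with
  | Var _ => true
  | Func f ts => (onth (funs L) f == Some (size ts)) && all (term_in L) ts
  end.

Fixpoint form_in (L : signature) (p : form) : bool :=
  match p with
  | Bot => true
  | Eq t s => term_in L t && term_in L s
  | Rel r ts => (onth (rels L) r == Some (size ts)) && all (term_in L) ts
  | Imp p q => form_in L p && form_in L q
  | All p => form_in L p
  end.

(* All free variables are smaller than [n]. *)
Fixpoint term_below (n : nat) (t : term) : bool :=
  match t with
  | Var x => x < n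
  | Func _ ts => all (term_below n) ts
  end.

Fixpoint form_below (n : nat) (p : form) : bool :=
  match p with
  | Bot => true
  | Eq t s => term_below n t && term_below n s
  | Rel _ ts => all (term_below n) ts
  | Imp p q => form_below n p && form_below n q
  | All p => form_below n.+1 p
  end.

Definition sentence (L : signature) (p : form) : bool :=
  form_in L p && form_below 0 p.

Fixpoint tsubst (s : nat -> term) (t : term) : term :=
  match t with
  | Var x => s x
  | Func f ts => Func f (map (tsubst s) ts)
  end.

Definition scons (t : term) (s : nat -> term) (x : nat) : term :=
  if x is x'.+1 then s x' else t.

Definition shift (x : nat) : term := Var x.+1.

Definition up (s : nat -> term) : nat -> term :=
  scons (Var 0) (fun x => tsubst shift (s x)).

Fixpoint fsubst (s : nat -> term) (p : form) : form :=
  match p with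
  | Bot => Bot
  | Eq t u => Eq (tsubst s t) (tsubst s u)
  | Rel r ts => Rel r (map (tsubst s) ts)
  | Imp p q => Imp (fsubst s p) (fsubst s q)
  | All p => All (fsubst (up s) p)
  end.

(* The body [p] of a quantifier instantiated at [t]. *)
Definition inst (p : form) (t : term) : form := fsubst (scons t Var) p.

(* Classical natural deduction. The [_in] side conditions keep every formula of
   a derivation inside the language [L]. *)
Inductive prv (L : signature) : seq form -> form -> Prop :=
| Hyp G p : List.In p G -> prv L G p
| ImpI G p q : form_in L p -> prv L (p :: G) q -> prv L G (Imp p q)
| ImpE G p q : prv L G (Imp p q) -> prv L G p -> prv L G q
| RAA G p : form_in L p -> prv L (Neg p :: G) Bot -> prv L G p
| AllI G p : prv L (map (fsubst shift) G) p -> prv L G (All p)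
| AllE G p t : term_in L t -> prv L G (All p) -> prv L G (inst p t)
| EqI G t : term_in L t -> prv L G (Eq t t)
| EqE G p t s :
    form_in L p -> prv L G (Eq t s) -> prv L G (inst p t) -> prv L G (inst p s).

(** * Theories and interpretations *)

Record theory : Type := Theory {
  sig : signature;
  thm : form -> Prop;
  thm_sentence : forall p, thm p -> sentence sig p;
  thm_closed : forall G p,
    (forall q, List.In q G -> thm q) ->
    sentence sig p -> prv sig G p -> thm p
}.

Definition consistent (T : theory) : Prop := ~ thm T Bot.

Definition incomplete (T : theory) : Prop :=
  exists p, sentence (sig T) p /\ ~ thm T p /\ ~ thm T (Neg p).

Definition thm_codes (T : theory) (n : nat) : Prop :=
  exists p, thm T p /\ form_code p = n.

Definition re_index (e : nat) (T : theory) : Prop :=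
  forall n, W e n <-> thm_codes T n.

Definition re (T : theory) : Prop := exists e, re_index e T.

(* A finite datum from which an r.e. theory can be given to, or returned by, an
   algorithm: its signature together with an r.e. index of its theorems. *)
Definition presents (n : nat) (T : theory) : Prop :=
  exists e, re_index e T /\ n = npair (sig_code (sig T)) e.

(* A relative translation, one-dimensional and without parameters. The free
   variables are 0 in [tr_dom], 0 and 1 in [tr_eq], 0, ..., k-1 in [tr_rel r]
   and 0, ..., k in [tr_fun f], where k is the arity of the symbol and the
   variable k of [tr_fun f] stands for the value of [f]. *)
Record translation : Type := Translation {
  tr_dom : form;
  tr_eq : form;
  tr_rel : nat -> form;
  tr_fun : nat -> form
}.

Definition translation_ok (L M : signature) (I : translation) : Prop :=
  [/\ form_in M (tr_dom I) && form_below 1 (tr_dom I),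
      form_in M (tr_eq I) && form_below 2 (tr_eq I),
      forall r k, onth (rels L) r = Some k ->
        form_in M (tr_rel I r) && form_below k (tr_rel I r)
    & forall f k, onth (funs L) f = Some k ->
        form_in M (tr_fun I f) && form_below k.+1 (tr_fun I f)].

(* [p] with its free variables 0, 1, ... renamed to the entries of [vs]. *)
Definition at_vars (vs : seq nat) (p : form) : form :=
  fsubst (fun i => Var (nth 0 vs i)) p.

Definition conjs (ps : seq form) : form := foldr And Top ps.

(* [k] existential quantifiers relativized to the domain of [I]. *)
Definition exs (I : translation) (k : nat) (p : form) : form :=
  iter k (fun q => Ex (And (tr_dom I) q)) p.

(* [tr_val I rho t y]: the variable [y] is a value of the term [t], where the
   variable [x] of [t] is read as the variable [rho x]. For t = f(t_0, ...) it
   says that there are v_0, ... in the domain, v_i being a value of t_i, for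
   which [tr_fun I f] holds of v_0, ... and [y]. *)
Fixpoint tr_val (I : translation) (rho : nat -> nat) (t : term) (y : nat) :
    form :=
  match t with
  | Var x => at_vars [:: rho x; y] (tr_eq I)
  | Func f ts =>
      let k := size ts in
      let vals := map (tr_val I (fun x => rho x + k)) ts in
      exs I k (And (conjs [seq p.1 p.2 | p <- zip vals (iota 0 k)])
                   (at_vars (rcons (iota 0 k) (y + k)) (tr_fun I f)))
  end.

Fixpoint tr_form (I : translation) (p : form) : form :=
  match p with
  | Bot => Bot
  | Eq t s =>
      exs I 2 (And (And (tr_val I (addn 2) t 0) (tr_val I (addn 2) s 1))
                   (at_vars [:: 0; 1] (tr_eq I)))
  | Rel r ts =>
      let k := size ts in
      let vals := map (tr_val I (addn k)) ts in
      exs I k (And (conjs [seq p.1 p.2 | p <- zip vals (iota 0 k)])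
                   (at_vars (iota 0 k) (tr_rel I r)))
  | Imp p q => Imp (tr_form I p) (tr_form I q)
  | All p => All (Imp (tr_dom I) (tr_form I p))
  end.

(* As [thm T] is deductively closed, the last clause also covers the usual
   requirements that the domain is nonempty, that [tr_eq I] is a congruence on
   it, and that each [tr_fun I f] defines a total function up to [tr_eq I]. *)
Definition interpretable (T S : theory) : Prop :=
  exists I, translation_ok (sig T) (sig S) I /\
    forall p, thm T p -> thm S (tr_form I p).

Definition strictly_interpretable (T S : theory) : Prop :=
  interpretable T S /\ ~ interpretable S T.

Definition G1 (T : theory) : Prop :=
  forall S : theory, re S -> consistent S -> interpretable T S -> incomplete S.

(* Main.v *)
(** The idea: [B] is [A] with new symbols for zero, successor and a unary
    predicate [P], and with axioms [P(n)] for [n] in [X] and [~ P(n)] for [n]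
    in [Y], where [X] and [Y] are disjoint r.e. sets such that every r.e. set
    separating them computes the halting problem: for [z = (e, k)], if [k]
    enters the halting problem, then [z] is put into [X] or [Y] according to
    whether [z] is still outside [W e] or not. If [A] interpreted [B], then the
    [n] for which [A] proves the translation of [P(n)] would be such a
    separator, computable from [A]. That [B] inherits G1 and interprets [A] is
    clear, as [B] extends [A]. For its consistency, take a model of [A]: it is
    infinite, because the theory of a finite structure is decidable, which G1
    forbids; so it can be expanded to a model of [B].

    Recursive enumerability is obtained by writing the evaluation of programs,
    derivability, and truth in a finite structure as Horn clause programs over
    the natural numbers; the least model of such a program is r.e. *)

From Stdlib Require Import Classical ClassicalEpsilon FunctionalExtensionality.
From Stdlib Require Import PropExtensionality ProofIrrelevance.
From Stdlib Require List Arith.Cantor.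
From mathcomp Require Import all_boot zify.
Require Import Defs.

Set Implicit Arguments.
Unset Strict Implicit.
Unset Printing Implicit Defensive.

(** * Total computable functions and r.e. sets *)

(** Inseparability alone would not suffice: by the low basis theorem, any two disjoint r.e. sets
    have a separator of low degree. What helps is that the separator read off from an interpretation
    in an r.e. theory is itself r.e., hence some [W e]. The pair of sets guesses this index: each
    [z] carries a candidate [e], and only the [z] with the right [e] matter. For these, if [k]
    halts, then [z] is in the separator, since otherwise [z] never enters [W e] and is put into [X].
    Conversely, membership of [z] guarantees that [z] enters [W e], so one can wait and see whether
    [k] came before it; had [z] come first and [k] halted, [z] would be in [Y]. The index [e] serves
    the reduction only. [B] is built from the signature and an r.e. index of [A], so one program,
    chosen before [A], returns it. Even the identity translation unnests terms, so that [B] contains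
    [A] does not give the interpretation outright: the equivalence of a formula with its translation
    is checked in structures and carried over by completeness. The same model construction gives the
    model of [A] to be expanded. The new axioms speak of numerals only, hence an injection of the
    natural numbers into that model is enough. *)

Lemma nfst_pair x y : nfst (npair x y) = x.
Proof. by rewrite /nfst /npair Cantor.cancel_of_to. Qed.

Lemma nsnd_pair x y : nsnd (npair x y) = y.
Proof. by rewrite /nsnd /npair Cantor.cancel_of_to. Qed.

Lemma npair_eta n : npair (nfst n) (nsnd n) = n.
Proof. by rewrite /npair /nfst /nsnd -surjective_pairing Cantor.cancel_to_of. Qed.

Lemma npair_ge x y : x + y <= npair x y.
Proof. rewrite /npair; have := Cantor.to_nat_non_decreasing x y; lia. Qed.

Lemma npair_inj x y x' y' : npair x y = npair x' y' -> x = x' /\ y = y'.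
Proof.
move=> e; have e1 := nfst_pair x y; have e2 := nsnd_pair x y.
by split; [rewrite -e1 e nfst_pair | rewrite -e2 e nsnd_pair].
Qed.

Definition npE := (nfst_pair, nsnd_pair).

Global Opaque npair nfst nsnd.

(** One program has to serve for all oracles, so that it can be used both in an index of an r.e. set
    and inside a reduction to a nontrivial oracle. *)
Definition tcomp (f : nat -> nat) : Prop :=
  exists c, forall X x y, eval X c x y <-> y = f x.

Lemma tc_ext f g : f =1 g -> tcomp f -> tcomp g.
Proof. by move=> e [c Hc]; exists c => X x y; rewrite -e; apply: Hc. Qed.

Lemma tc_comp f g : tcomp f -> tcomp g -> tcomp (fun x => f (g x)).
Proof.
move=> [c Hc] [d Hd]; exists (Comp c d) => X x y /=; split.
  by move=> [u [/Hd -> /Hc ->]].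
by move=> ->; exists (g x); split; [apply/Hd | apply/Hc].
Qed.

Lemma tc_pair f g : tcomp f -> tcomp g -> tcomp (fun x => npair (f x) (g x)).
Proof.
move=> [c Hc] [d Hd]; exists (Pair c d) => X x y /=; split.
  by move=> [u [v [/Hc -> [/Hd -> ->]]]].
by move=> ->; exists (f x), (g x); split; [apply/Hc | split => //; apply/Hd].
Qed.

Lemma tc_id : tcomp (fun x => x).
Proof.
exists (Pair Fst Snd) => X x y /=; split.
  by move=> [u [v [-> [-> ->]]]]; rewrite npair_eta.
by move=> ->; exists (nfst x), (nsnd x); rewrite npair_eta.
Qed.

Lemma tc_fst f : tcomp f -> tcomp (fun x => nfst (f x)).
Proof. by apply: tc_comp; exists Fst => X x y. Qed.

Lemma tc_snd f : tcomp f -> tcomp (fun x => nsnd (f x)).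
Proof. by apply: tc_comp; exists Snd => X x y. Qed.

Lemma tc_succ f : tcomp f -> tcomp (fun x => (f x).+1).
Proof. by apply: tc_comp; exists Succ => X x y. Qed.

Definition const_code (k : nat) : code := iter k (Comp Succ) Zero.

Lemma const_codeE X k x y : eval X (const_code k) x y <-> y = k.
Proof.
elim: k y => [|k IH] y //=; split=> [[u [/IH -> ->]] //|->].
by exists k; split=> //; apply/IH.
Qed.

Lemma tc_const k : tcomp (fun=> k).
Proof. by exists (const_code k) => X x y; apply: const_codeE. Qed.

(** [Prec] is run on the pair of the input and the number of rounds, so the input stays available as
    a parameter of every step. *)
Lemma tc_iteri (s : nat -> nat -> nat -> nat) (b n : nat -> nat) :
    tcomp (fun z => s (nfst z) (nfst (nsnd z)) (nsnd (nsnd z))) ->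
    tcomp b -> tcomp n ->
  tcomp (fun x => iteri (n x) (s x) (b x)).
Proof.
move=> [d Hd] [c Hc] hn.
have hP : tcomp (fun z => iteri (nsnd z) (s (nfst z)) (b (nfst z))).
  exists (Prec c d) => X x /=.
  elim: (nsnd x) => [|m IH] y; first exact: Hc.
  split=> [[i [/IH -> /Hd]]|->]; first by rewrite !npE.
  by eexists; split; [apply/IH; reflexivity | apply/Hd; rewrite !npE].
apply: (tc_ext _ (tc_comp hP (tc_pair tc_id hn))) => x.
by rewrite !npE.
Qed.

Lemma tc_iter (s : nat -> nat -> nat) (b n : nat -> nat) :
    tcomp (fun z => s (nfst z) (nsnd z)) -> tcomp b -> tcomp n ->
  tcomp (fun x => iter (n x) (s x) (b x)).
Proof.
move=> hs hb hn.
have h : tcomp (fun z => s (nfst z) (nsnd (nsnd z))).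
  have h := tc_pair (tc_fst tc_id) (tc_snd (tc_snd tc_id)).
  by apply: (tc_ext _ (tc_comp hs h)) => z; rewrite !npE.
apply: (tc_ext _ (tc_iteri (s := fun x _ y => s x y) h hb hn)) => x.
by elim: (n x) => //= m ->.
Qed.

Lemma tc_pred f : tcomp f -> tcomp (fun x => (f x).-1).
Proof.
move=> hf.
have h : tcomp (fun z => nfst (nsnd z)) by apply: tc_fst; apply: tc_snd; apply: tc_id.
apply: (tc_ext _ (tc_iteri (s := fun _ i _ => i) h (tc_const 0) hf)) => x.
by case: (f x).
Qed.

Lemma tc_sub f g : tcomp f -> tcomp g -> tcomp (fun x => f x - g x).
Proof.
move=> hf hg; have h := tc_pred (tc_snd tc_id).
apply: (tc_ext _ (tc_iter (s := fun _ i => i.-1) h hf hg)) => x.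
by elim: (g x) => /= [|m ->]; lia.
Qed.

Lemma tc_add f g : tcomp f -> tcomp g -> tcomp (fun x => f x + g x).
Proof.
move=> hf hg; have h := tc_succ (tc_snd tc_id).
apply: (tc_ext _ (tc_iter (s := fun _ i => i.+1) h hf hg)) => x.
by elim: (g x) => /= [|m ->]; lia.
Qed.

(** The truth value is used as a number of iterations: no round leaves the value of [g], one round
    overwrites it by that of [f]. *)
Lemma tc_if (t : nat -> bool) f g :
  tcomp (fun x => t x) -> tcomp f -> tcomp g -> tcomp (fun x => if t x then f x else g x).
Proof.
move=> ht hf hg.
have h : tcomp (fun z => f (nfst z)) by apply: (tc_comp hf); apply: tc_fst; apply: tc_id.
by apply: (tc_ext _ (tc_iter (s := fun x _ => f x) h hg ht)) => x; case: (t x).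
Qed.

Lemma tc_neg (t : nat -> bool) : tcomp (fun x => t x) -> tcomp (fun x => ~~ t x).
Proof.
by move=> ht; apply: (tc_ext _ (tc_sub (tc_const 1) ht)) => x; case: (t x).
Qed.

Lemma tc_and (t u : nat -> bool) :
  tcomp (fun x => t x) -> tcomp (fun x => u x) -> tcomp (fun x => t x && u x).
Proof.
by move=> ht hu; apply: (tc_ext _ (tc_if ht hu (tc_const 0))) => x; case: (t x).
Qed.

Lemma tc_or (t u : nat -> bool) :
  tcomp (fun x => t x) -> tcomp (fun x => u x) -> tcomp (fun x => t x || u x).
Proof.
by move=> ht hu; apply: (tc_ext _ (tc_if ht (tc_const 1) hu)) => x; case: (t x).
Qed.

Lemma tc_leq f g : tcomp f -> tcomp g -> tcomp (fun x => f x <= g x).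
Proof.
move=> hf hg; apply: (tc_ext _ (tc_sub (tc_const 1) (tc_sub hf hg))) => x; lia.
Qed.

Lemma tc_eqn f g : tcomp f -> tcomp g -> tcomp (fun x => f x == g x).
Proof.
move=> hf hg; apply: (tc_ext _ (tc_and (tc_leq hf hg) (tc_leq hg hf))) => x.
by rewrite eqn_leq.
Qed.

Ltac tc := lazymatch goal with
 | |- tcomp (fun x => x) => exact: tc_id
 | |- tcomp (fun _ => ?c) => exact: (tc_const c)
 | |- tcomp (fun x => npair (@?f x) (@?g x)) => refine (@tc_pair f g _ _); tc
 | |- tcomp (fun x => nfst (@?f x)) => refine (@tc_fst f _); tc
 | |- tcomp (fun x => nsnd (@?f x)) => refine (@tc_snd f _); tc
 | |- tcomp (fun x => (@?f x).+1) => refine (@tc_succ f _); tc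
 | |- tcomp (fun x => (@?f x).-1) => refine (@tc_pred f _); tc
 | |- tcomp (fun x => (@?f x) + (@?g x)) => refine (@tc_add f g _ _); tc
 | |- tcomp (fun x => nat_of_bool ((@?f x) <= (@?g x))) => refine (@tc_leq f g _ _); tc
 | |- tcomp (fun x => nat_of_bool ((@?f x) == (@?g x))) => refine (@tc_eqn f g _ _); tc
 | |- tcomp (fun x => nat_of_bool (~~ (@?f x))) => refine (@tc_neg f _); tc
 | |- tcomp (fun x => nat_of_bool ((@?f x) && (@?g x))) => refine (@tc_and f g _ _); tc
 | |- tcomp (fun x => nat_of_bool ((@?f x) || (@?g x))) => refine (@tc_or f g _ _); tc
 | H : tcomp (fun z => nat_of_bool (?f z)) |- tcomp (fun x => nat_of_bool (?f (@?g x))) =>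
     refine (@tc_comp (fun z => nat_of_bool (f z)) g H _); tc
 | H : tcomp ?f |- tcomp (fun x => ?f (@?g x)) => refine (@tc_comp f g H _); tc
 | |- tcomp nfst => exact: (tc_fst tc_id)
 | |- tcomp nsnd => exact: (tc_snd tc_id)
 | _ => try assumption
 end.

(* Every number codes exactly one list; [lhd] and [ltl] are junk on the code [0] of the empty one. *)
Definition lhd (l : nat) : nat := nfst l.-1.
Definition ltl (l : nat) : nat := nsnd l.-1.
Definition lnth (l i : nat) : nat := lhd (iter i ltl l).

Lemma lhd_cons x l : lhd (npair x l).+1 = x.
Proof. by rewrite /lhd /= npE. Qed.

Lemma ltl_cons x l : ltl (npair x l).+1 = l.
Proof. by rewrite /ltl /= npE. Qed.

(** The content is the case [i <= size s]; the trivial alternative only turns it into an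
    unconditional rewriting rule. *)
Lemma iter_ltl s i : iter i ltl (seq_code s) = if i <= size s then seq_code (drop i s) else iter i ltl (seq_code s).
Proof.
case: leqP => // le; elim: i s le => [|i IH] [|x s] // le.
by rewrite iterSr [seq_code (x :: s)]/= ltl_cons IH.
Qed.

Lemma lnth_seq_code s i : i < size s -> lnth (seq_code s) i = nth 0 s i.
Proof.
move=> lt; rewrite /lnth iter_ltl (ltnW lt) (drop_nth 0 lt) /=; exact: lhd_cons.
Qed.

Lemma seq_code_inj : injective seq_code.
Proof.
by elim=> [|x s IH] [|y t] //= [/npair_inj [-> /IH ->]].
Qed.

Lemma seq_code_surj l : exists s, seq_code s = l.
Proof.
elim/ltn_ind: l => [[|l]] IH; first by exists [::].
have := npair_ge (nfst l) (nsnd l); rewrite npair_eta => le.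
have [|s Hs] := IH (nsnd l); first by lia.
by exists (nfst l :: s); rewrite /= Hs npair_eta.
Qed.

(** Obtained by description; the computability of functions defined through it is shown by means of
    [lnth] and iterated [ltl]. *)
Definition seq_decode (l : nat) : seq nat := proj1_sig (constructive_indefinite_description _ (seq_code_surj l)).

Lemma seq_decodeK l : seq_code (seq_decode l) = l.
Proof. by rewrite /seq_decode; case: constructive_indefinite_description. Qed.

Lemma seq_codeK : cancel seq_code seq_decode.
Proof. by move=> s; apply: seq_code_inj; rewrite seq_decodeK. Qed.

Lemma tc_ltl_iter f g : tcomp f -> tcomp g -> tcomp (fun x => iter (g x) ltl (f x)).
Proof.
by move=> hf hg; apply: (tc_iter (s := fun _ y => ltl y)) => //; rewrite /ltl; tc.
Qed.

Lemma tc_lnth f g : tcomp f -> tcomp g -> tcomp (fun x => lnth (f x) (g x)).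
Proof.
move=> hf hg; rewrite /lnth /lhd; apply: tc_fst; apply: tc_pred; exact: tc_ltl_iter.
Qed.

Lemma tc_ball (t : nat -> bool) (n : nat -> nat) :
    tcomp (fun z => t z) -> tcomp n ->
  tcomp (fun x => all (fun i => t (npair x i)) (iota 0 (n x))).
Proof.
move=> ht hn.
pose s x i y := if t (npair x i) then y else 0.
have hs : tcomp (fun z => s (nfst z) (nfst (nsnd z)) (nsnd (nsnd z))).
  by apply: (@tc_if (fun z => t (npair (nfst z) (nfst (nsnd z))))); tc.
apply: (tc_ext _ (tc_iteri hs (tc_const 1) hn)) => x.
elim: (n x) => // m IH; rewrite [iteri _ _ _]/= IH -addn1 iotaD all_cat /= andbT /s add0n.
by case: (t _); rewrite ?andbT ?andbF.
Qed.

(** * Semidecidable predicates and their closure properties *)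

Definition S1 (P : nat -> Prop) : Prop :=
  exists t : nat -> bool,
    tcomp (fun x => t x) /\ forall n, P n <-> exists w, t (npair n w).

Lemma S1_ext P Q : (forall n, P n <-> Q n) -> S1 P -> S1 Q.
Proof. by move=> e [t [ht H]]; exists t; split=> // n; rewrite -e. Qed.

Lemma S1_dec (t : nat -> bool) : tcomp (fun x => t x) -> S1 (fun x => t x).
Proof.
move=> ht; exists (fun z => t (nfst z)); split; first by tc.
by move=> n; split=> [h|[w]]; [exists 0|]; rewrite npE.
Qed.

Lemma S1_comp P f : S1 P -> tcomp f -> S1 (fun x => P (f x)).
Proof.
move=> [t [ht H]] hf; exists (fun z => t (npair (f (nfst z)) (nsnd z))).
split; first by tc.
by move=> n; rewrite H; split=> [] [w h]; exists w; move: h; rewrite !npE.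
Qed.

Lemma S1_and P Q : S1 P -> S1 Q -> S1 (fun x => P x /\ Q x).
Proof.
move=> [t [ht H]] [u [hu K]].
exists (fun z => t (npair (nfst z) (nfst (nsnd z))) && u (npair (nfst z) (nsnd (nsnd z)))).
split; first by tc.
move=> n; rewrite H K; split.
  by move=> [[v hv] [w hw]]; exists (npair v w); rewrite !npE hv.
by move=> [w]; rewrite !npE => /andP [h1 h2]; split; eexists; eassumption.
Qed.

Lemma S1_or P Q : S1 P -> S1 Q -> S1 (fun x => P x \/ Q x).
Proof.
move=> [t [ht H]] [u [hu K]].
exists (fun z => t z || u z).
split; first by tc.
move=> n; rewrite H K; split.
  by move=> [[v hv]|[v hv]]; exists v; rewrite hv ?orbT.
by move=> [w] /orP [h|h]; [left|right]; exists w.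
Qed.

Lemma S1_ex (P : nat -> nat -> Prop) :
  S1 (fun z => P (nfst z) (nsnd z)) -> S1 (fun x => exists y, P x y).
Proof.
move=> [t [ht H]].
exists (fun z => t (npair (npair (nfst z) (nfst (nsnd z))) (nsnd (nsnd z)))).
split; first by tc.
move=> n; split.
  move=> [y hy]; have [] := H (npair n y); rewrite !npE => /(_ hy) [w hw] _.
  by exists (npair y w); rewrite !npE.
move=> [w]; rewrite !npE => h; exists (nfst (nsnd (npair n w))).
have [_] := H (npair n (nfst w)); rewrite !npE; apply; by eexists; exact: h.
Qed.

(** The witnesses for all [i < n x] are collected in one list, whose code is the single witness
    required. *)
Lemma S1_ball (P : nat -> nat -> Prop) (n : nat -> nat) :
    S1 (fun z => P (nfst z) (nsnd z)) -> tcomp n ->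
  S1 (fun x => forall i, i < n x -> P x i).
Proof.
move=> [t [ht H]] hn.
pose u z := t (npair (npair (nfst (nfst z)) (nsnd z)) (lnth (nsnd (nfst z)) (nsnd z))).
have hu : tcomp (fun z => u z).
  rewrite /u; have hl : tcomp (fun z => lnth (nsnd (nfst z)) (nsnd z)) by apply: tc_lnth; tc.
  apply: (@tc_comp (fun z => t z)) => //; apply: tc_pair => //; tc.
exists (fun z => all (fun i => u (npair z i)) (iota 0 (n (nfst z)))).
split; first by apply: tc_ball => //; tc.
move=> x; split.
  move=> h.
  have [s [hs Hs]] : exists s, size s = n x /\ forall i, i < n x -> t (npair (npair x i) (nth 0 s i)).
    elim: (n x) h => [|m IH] h; first by exists [::].
    have [i hi|s [hs Hs]] := IH; first by apply: h; lia.
    have [] := H (npair x m); rewrite !npE => /(_ (h m (leqnn _))) [w hw] _.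
    exists (rcons s w); rewrite size_rcons hs; split=> // i hi.
    by rewrite nth_rcons hs; case: ltngtP => [/Hs|?|->] //; lia.
  exists (seq_code s); rewrite npE; apply/allP => i; rewrite mem_iota add0n /= => hi.
  by rewrite /u !npE lnth_seq_code ?hs //; apply: Hs.
move=> [w /allP h] i hi; have [_] := H (npair x i); rewrite !npE; apply.
have := h i; rewrite npE mem_iota add0n /= => /(_ hi); rewrite /u !npE => hh.
by eexists; exact: hh.
Qed.

Lemma S1_False : S1 (fun=> False).
Proof. by apply: (S1_ext _ (S1_dec (t := fun=> false) (tc_const 0))). Qed.

Lemma S1_True : S1 (fun=> True).
Proof. by apply: (S1_ext _ (S1_dec (t := fun=> true) (tc_const 1))). Qed.

Lemma S1_eq f g : tcomp f -> tcomp g -> S1 (fun x => f x = g x).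
Proof.
move=> hf hg; apply: (S1_ext _ (S1_dec (tc_eqn hf hg))) => n.
by split=> /eqP.
Qed.

Lemma S1_lt f g : tcomp f -> tcomp g -> S1 (fun x => f x < g x).
Proof. by move=> hf hg; apply: S1_dec; apply: tc_leq => //; tc. Qed.

(** A classical existence statement: a program with the right finite table exists, although nothing
    says which entries of [s] satisfy [P]. *)
Lemma S1_finite (P : nat -> Prop) (s : seq nat) : (forall x, P x -> x \in s) -> S1 P.
Proof.
elim: s P => [|a s IH] P h.
  by apply: (S1_ext _ S1_False) => n; split=> // /h.
have hs : S1 (fun x => P x /\ x <> a).
  by apply: IH => x [/h]; rewrite inE => /orP [/eqP|].
have [Pa|nPa] := classic (P a).
  apply: (S1_ext _ (S1_or hs (S1_eq tc_id (tc_const a)))) => n; split.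
    by move=> [[]|->].
  by move=> Pn; have [->|] := classic (n = a); [right|left].
apply: (S1_ext _ hs) => n; split=> [[]|] // Pn; split=> // e; by rewrite e in Pn.
Qed.

Lemma size_seq_code s : size s <= seq_code s.
Proof. by elim: s => //= y s IH; have := npair_ge y (seq_code s); lia. Qed.

(** The junk value [ltl 0] is [0], because a pair is at least the sum of its components; so tails
    taken past the end stay empty. *)
Lemma iter_ltl_ge s i : size s <= i -> iter i ltl (seq_code s) = 0.
Proof.
move=> ge; have -> : i = (i - size s) + size s by lia.
rewrite iterD iter_ltl leqnn drop_size /=.
have e0 : ltl 0 = 0.
  by rewrite /ltl /=; have := npair_ge (nfst 0) (nsnd 0); rewrite npair_eta; lia.
by elim: (i - size s) => //= m ->.
Qed.

(** The nonempty tails are counted. A list is no longer than its code, so the code itself is a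
    sufficient number of rounds. *)
Lemma tc_size l : tcomp l -> tcomp (fun x => size (seq_decode (l x))).
Proof.
move=> hl; pose s x i y := y + ~~ (iter i ltl x <= 0).
have hs : tcomp (fun z => s (nfst z) (nfst (nsnd z)) (nsnd (nsnd z))).
  have hi : tcomp (fun z => iter (nfst (nsnd z)) ltl (nfst z)) by apply: tc_ltl_iter; tc.
  by apply: tc_add; [|apply: tc_neg; apply: tc_leq]; tc.
have h : tcomp (fun x => iteri x (s x) 0) by apply: (tc_iteri hs); tc.
apply: (tc_ext _ (tc_comp h hl)) => x; rewrite -{1 2}(seq_decodeK (l x)).
move: (seq_decode (l x)) => {h hl x} {}l.
suff H k : iteri k (s (seq_code l)) 0 = minn k (size l).
  by rewrite H; have := size_seq_code l; lia.
elim: k => [|k IH]; first by rewrite min0n.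
rewrite [iteri _ _ _]/= IH /s; have [lt|ge] := ltnP k (size l).
  rewrite iter_ltl (ltnW lt) (drop_nth 0 lt) /=; lia.
rewrite iter_ltl_ge //; lia.
Qed.

(** The list is rebuilt on top of [[:: y]], starting from its last entry. *)
Lemma tc_rcons l y : tcomp l -> tcomp (fun x => seq_code (rcons (seq_decode (l x)) y)).
Proof.
move=> hl; pose s x i z := (npair (lnth x (size (seq_decode x) - i.+1)) z).+1.
have hs : tcomp (fun z => s (nfst z) (nfst (nsnd z)) (nsnd (nsnd z))).
  apply: tc_succ; apply: tc_pair; last by tc.
  apply: tc_lnth; first by tc.
  by apply: tc_sub; [apply: tc_size|]; tc.
have h : tcomp (fun x => iteri (size (seq_decode x)) (s x) (npair y 0).+1).
  by apply: (tc_iteri hs); [tc | apply: tc_size; tc].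
apply: (tc_ext _ (tc_comp h hl)) => x; rewrite -{2}(seq_decodeK (l x)).
move: (seq_decode (l x)) => {h hl x} {}l.
suff H k : k <= size l -> iteri k (s (seq_code l)) (npair y 0).+1 = seq_code (rcons (drop (size l - k) l) y).
  by rewrite H // subnn drop0.
elim: k => [|k IH] le; first by rewrite subn0 drop_size.
rewrite [iteri _ _ _]/= IH; last exact: ltnW.
rewrite /s seq_codeK lnth_seq_code; last by lia.
rewrite [in RHS](drop_nth 0); last by lia.
by have -> : (size l - k.+1).+1 = size l - k by lia.
Qed.

Lemma S1_all_in (P : nat -> nat -> Prop) (l : nat -> nat) :
    S1 (fun z => P (nfst z) (nsnd z)) -> tcomp l ->
  S1 (fun x => forall y, y \in seq_decode (l x) -> P x y).
Proof.
move=> hP hl.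
(* Positions are bounded by the code instead of the length; those past the end are recognized by an
   empty tail. *)
have h : S1 (fun x => forall i, i < l x -> iter i ltl (l x) = 0 \/ P x (lnth (l x) i)).
  apply: S1_ball (hl); apply: S1_or.
    by apply: S1_eq; [apply: tc_ltl_iter; tc | tc].
  have h : tcomp (fun z => npair (nfst z) (lnth (l (nfst z)) (nsnd z))).
    by apply: tc_pair; [tc | apply: tc_lnth; tc].
  by apply: (S1_ext _ (S1_comp hP h)) => n; rewrite !npE.
apply: (S1_ext _ h) => x.
move: (l x) => {h hP hl l} l; rewrite -{1 2 3}(seq_decodeK l).
move: (seq_decode l) => s.
have le := size_seq_code s.
split=> h.
  move=> y /(nthP 0) [i hi <-]; have := h i (leq_trans hi le).
  by rewrite lnth_seq_code // iter_ltl (ltnW hi) (drop_nth 0 hi) => -[].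
move=> i hi; have [lt|ge] := ltnP i (size s).
  by right; rewrite lnth_seq_code //; apply: h; apply: mem_nth.
by left; apply: iter_ltl_ge.
Qed.

(** Unbounded search for the witness. The test is negated because [Mu] looks for a zero. *)
Lemma S1_domain P :
  S1 P -> exists c, forall X n, P n <-> exists y, eval X c n y.
Proof.
move=> [t [/tc_neg [c Hc] H]]; exists (Mu c) => X n; rewrite H; split.
  move=> ex; have [y hy hmin] := ex_minnP ex; exists y => /=; split.
    by apply/Hc; rewrite hy.
  move=> m lt; exists 0; apply/Hc; case e : (t _) => //.
  by have := hmin _ e; lia.
by move=> [y [/Hc]] /=; case e : (t _) => // _ _; exists y.
Qed.

(** The search runs over pairs of a value and a witness, and [Fst] returns the value. Existence and
    uniqueness of the value are asked only at the input [x] in question, so [R] may fail to be total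
    or single-valued elsewhere. *)
Lemma S1_function (R : nat -> nat -> Prop) :
    S1 (fun z => R (nfst z) (nsnd z)) ->
  exists c, forall X x y, (forall y', R x y' <-> y' = y) -> eval X c x y.
Proof.
move=> [t [ht H]].
have [c Hc] : tcomp (fun z => ~~ t (npair (npair (nfst z) (nfst (nsnd z))) (nsnd (nsnd z)))).
  by tc.
exists (Comp Fst (Mu c)) => X x y hR /=.
have ex : exists w, t (npair (npair x (nfst w)) (nsnd w)).
  have [] := H (npair x y); rewrite !npE hR => /(_ erefl) [w hw] _.
  by exists (npair y w); rewrite !npE.
have [u hu hmin] := ex_minnP ex; exists u; split; first split.
- by apply/Hc; rewrite !npE hu.
- move=> m lt; exists 0; apply/Hc; rewrite !npE; case e : (t _) => //.
  by have := hmin _ e; lia.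
- apply/esym/hR; have [_] := H (npair x (nfst u)); rewrite !npE; apply.
  by eexists; exact: hu.
Qed.

(** * Horn clause programs *)

Inductive pat : Type :=
| PV of nat
| PN of nat
| PS of pat
| PP of pat & pat.

Fixpoint pval (r : seq nat) (p : pat) : nat :=
  match p with
  | PV i => nth 0 r i
  | PN n => n
  | PS p => (pval r p).+1
  | PP p q => npair (pval r p) (pval r q)
  end.

Definition clause : Type := (pat * seq pat)%type.

(** The facts in [base] are external to the program; they will carry the tables of a finite
    structure. *)
Inductive gen (base : nat -> Prop) (cls : seq clause) (n : nat) : Prop :=
| gen_base : base n -> gen base cls n
| gen_rule c r : List.In c cls ->
    (forall p, List.In p c.2 -> gen base cls (pval r p)) ->
    n = pval r c.1 -> gen base cls n.

Section HornR.

Variables (base : nat -> Prop) (cls : seq clause).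

Let stepok (mem : nat -> Prop) x :=
  base x \/ exists r, exists2 c, List.In c cls &
    x = pval r c.1 /\ forall p, List.In p c.2 -> mem (pval r p).

Let stepok_mono (m m' : nat -> Prop) x : (forall y, m y -> m' y) -> stepok m x -> stepok m' x.
Proof.
move=> h [b|[r [c hc [e hp]]]]; [by left | right].
by exists r, c => //; split=> // p /hp /h.
Qed.

(** A derivation written with its conclusion in front: every entry is justified by entries after
    it. *)
Let Fixpoint valid (s : seq nat) : Prop :=
  if s is x :: s' then stepok (fun y => y \in s') x /\ valid s' else True.

Let valid_cat s t : valid s -> valid t -> valid (s ++ t).
Proof.
elim: s => //= x s IH [h /IH hv] /hv ?; split=> //.
by apply: stepok_mono h => y; rewrite mem_cat => ->.
Qed.

Let gen_valid n : gen base cls n <-> exists2 s, valid s & n \in s.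
Proof.
split.
  elim=> {n} [n b|n c r hc _ IH ->].
    by exists [:: n]; [split=> //; left | rewrite inE].
  have [s vs hs] : exists2 s, valid s & forall p, List.In p c.2 -> pval r p \in s.
    elim: {hc} c.2 IH => [|p l IHl] IH; first by exists [::].
    have [|s vs hs] := IHl; first by move=> q hq; apply: IH; right.
    have [|t vt ht] := IH p; first by left.
    exists (t ++ s); first exact: valid_cat.
    by move=> q /= [<-|/hs h]; rewrite mem_cat ?ht ?h ?orbT.
  exists (pval r c.1 :: s); last by rewrite inE eqxx.
  by split=> //; right; exists r, c.
move=> [s]; elim: s n => // x s IH n [h vs]; rewrite inE => /orP [/eqP ->|/IH]; last by apply.
case: h => [b|[r [c hc [e hp]]]]; first exact: gen_base.
by apply: gen_rule hc _ e => p /hp /IH; apply.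
Qed.

Let seq_valid (f : nat -> nat) m :
  (forall i, i < m -> stepok (fun y => exists j, (i < j /\ j < m) /\ f j = y) (f i)) ->
  valid (mkseq f m).
Proof.
move=> h.
suff H k : k <= m -> valid (map f (iota (m - k) k)).
  by have := H m (leqnn _); rewrite subnn.
elim: k => //= k IH le; split.
  apply: stepok_mono (h _ _); last by lia.
  move=> y [j [[lt lt'] <-]]; apply: map_f; rewrite mem_iota; lia.
have -> : (m - k.+1).+1 = m - k by lia.
by apply: IH; lia.
Qed.

Let valid_nth s : valid s -> forall i, i < size s ->
  stepok (fun y => exists j, (i < j /\ j < size s) /\ nth 0 s j = y) (nth 0 s i).
Proof.
elim: s => //= x s IH [h vs] [|i] hi /=.
  apply: stepok_mono h => y /(nthP 0) [j hj <-].
  by exists j.+1; split=> //; split; lia.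
apply: stepok_mono (IH vs i hi) => y [j [[? ?] <-]].
by exists j.+1; split=> //; split; lia.
Qed.

(** The arithmetical form of [gen_valid]: a derivation is a number [w], read through [lnth] at its
    first [m] positions, so that only quantifiers over numbers remain. *)
Let gen_seq n : gen base cls n <->
  exists w m i, (i < m /\ lnth w i = n) /\ forall i, i < m ->
    stepok (fun y => exists j, (i < j /\ j < m) /\ lnth w j = y) (lnth w i).
Proof.
rewrite gen_valid; split.
  move=> [s vs hn]; exists (seq_code s), (size s), (index n s).
  rewrite lnth_seq_code ?index_mem // nth_index //; split=> // i hi.
  rewrite lnth_seq_code //; apply: stepok_mono (valid_nth vs hi).
  by move=> y [j [[h1 h2] e]]; exists j; split=> //; rewrite lnth_seq_code.
move=> [w [m [i [[hi <-] h]]]]; exists (mkseq (lnth w) m); first exact: seq_valid.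
by apply/(nthP 0); exists i; rewrite ?size_mkseq // nth_mkseq.
Qed.

Let lval (w : nat) (p : pat) : nat :=
  (fix lv p := match p with
  | PV i => lnth w i | PN n => n | PS p => (lv p).+1 | PP p q => npair (lv p) (lv q)
  end) p.

Let tc_lval f p : tcomp f -> tcomp (fun x => lval (f x) p).
Proof.
move=> hf; elim: p => [i|n|p IH|p IHp q IHq] /=.
- by apply: tc_lnth => //; tc.
- exact: tc_const.
- exact: tc_succ.
- exact: tc_pair.
Qed.

Let Fixpoint pbound (p : pat) : nat :=
  match p with PV i => i.+1 | PN _ => 0 | PS p => pbound p | PP p q => maxn (pbound p) (pbound q) end.

Let lval_seq (r : nat -> nat) m p : pbound p <= m ->
  lval (seq_code (mkseq r m)) p = pval (mkseq r m) p.
Proof.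
elim: p => [i|n|p IH|p IHp q IHq] //=.
- by move=> h; rewrite lnth_seq_code // size_mkseq.
- by move/IH ->.
- by rewrite geq_max => /andP [/IHp -> /IHq ->].
Qed.

Let pval_mkseq r m p : pbound p <= m -> pval (mkseq (nth 0 r) m) p = pval r p.
Proof.
elim: p => [i|n|p IH|p IHp q IHq] //=.
- by move=> h; rewrite nth_mkseq.
- by move/IH ->.
- by rewrite geq_max => /andP [/IHp -> /IHq ->].
Qed.

Let lval_mkseq w m p : pbound p <= m -> pval (mkseq (lnth w) m) p = lval w p.
Proof.
elim: p => [i|n|p IH|p IHp q IHq] //=.
- by move=> h; rewrite nth_mkseq.
- by move/IH ->.
- by rewrite geq_max => /andP [/IHp -> /IHq ->].
Qed.

(** A clause has finitely many variables, so assignments given as lists and as numbers need to agree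
    only on an initial segment. *)
Let env_bound (c : clause) :
  exists m, pbound c.1 <= m /\ forall p, List.In p c.2 -> pbound p <= m.
Proof.
have [m hm] : exists m, forall p, List.In p c.2 -> pbound p <= m.
  elim: c.2 => [|p l [m IH]]; first by exists 0.
  exists (maxn (pbound p) m) => q /= [<-|/IH]; lia.
exists (maxn m (pbound c.1)); split; first by lia.
by move=> p /hm; lia.
Qed.

Let stepok_lval (mem : nat -> Prop) x : stepok mem x <->
  base x \/ exists r, exists2 c, List.In c cls &
    x = lval r c.1 /\ forall p, List.In p c.2 -> mem (lval r p).
Proof.
split=> -[b|[r [c hc [-> hp]]]]; try (by left); right;
  have [m [h1 h2]] := env_bound c.
  exists (seq_code (mkseq (nth 0 r) m)), c => //; split.
    by rewrite lval_seq // pval_mkseq.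
  by move=> p hpc; rewrite lval_seq ?pval_mkseq; auto.
exists (mkseq (lnth r) m), c => //; split; first by rewrite lval_mkseq.
by move=> p hpc; rewrite lval_mkseq; auto.
Qed.

Lemma S1_gen : S1 base -> S1 (gen base cls).
Proof.
move=> hb.
suff h : S1 (fun n => exists w m i, (i < m /\ lnth w i = n) /\ forall i, i < m ->
    stepok (fun y => exists j, (i < j /\ j < m) /\ lnth w j = y) (lnth w i)).
  by apply: (S1_ext _ h) => n; rewrite gen_seq.
do 3 apply: S1_ex; apply: S1_and.
  by apply: S1_and; [apply: S1_lt; tc | apply: S1_eq; [apply: tc_lnth|]; tc].
apply: S1_ball; last by tc.
(* Here [z] codes the nested pair [((((n, w), m), i0), i)] left by the quantifiers, and [Q z] is
   entry [i] of the derivation [w]. *)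
pose Q z := (lnth (nsnd (nfst (nfst (nfst z)))) (nsnd z)).
pose mem z y := exists j, (nsnd z < j /\ j < nsnd (nfst (nfst z))) /\ lnth (nsnd (nfst (nfst (nfst z)))) j = y.
have tQ : tcomp Q by apply: tc_lnth; tc.
suff h : S1 (fun z => base (Q z) \/ exists r, exists2 c, List.In c cls &
    Q z = lval r c.1 /\ forall p, List.In p c.2 -> mem z (lval r p)).
  by apply: (S1_ext _ h) => z; rewrite stepok_lval.
apply: S1_or; first exact: S1_comp.
apply: S1_ex.
have hc (c : clause) : S1 (fun z => Q (nfst z) = lval (nsnd z) c.1 /\
    forall p, List.In p c.2 -> mem (nfst z) (lval (nsnd z) p)).
  apply: S1_and.
    by apply: S1_eq; [tc | apply: tc_lval; tc].
  elim: c.2 => [|p l IH].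
    by apply: (S1_ext _ S1_True).
  have hm : S1 (fun z => mem (nfst z) (lval (nsnd z) p)).
    apply: S1_ex; apply: S1_and.
      by apply: S1_and; apply: S1_lt; tc.
    by apply: S1_eq; [apply: tc_lnth | apply: tc_lval]; tc.
  apply: (S1_ext _ (S1_and hm IH)) => n; split=> [[h1 h2] q /= [<-|]|h]; auto.
  by split; [apply: h; left | move=> q hq; apply: h; right].
elim: cls hc => [|c l IH] hc.
  by apply: (S1_ext _ S1_False) => n; split=> // -[].
apply: (S1_ext _ (S1_or (hc c) (IH hc))) => n; split.
  by move=> [h|[c' h1 h2]]; [exists c => //; left | exists c' => //; right].
by move=> [c' [<-|h1] h2]; [left | right; exists c'].
Qed.

End HornR.

(** Rule induction in a form that, for a concrete program, computes to one implication per
    clause. *)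
Lemma gen_ind_clauses base cls (M : nat -> Prop) :
  (forall n, base n -> M n) ->
  foldr (fun c acc => (forall r, foldr (fun p (a : Prop) => M (pval r p) -> a) (M (pval r c.1)) c.2) /\ acc)
    True cls ->
  forall n, gen base cls n -> M n.
Proof.
move=> hb hc n; elim=> {n} [n /hb //|n c r hin _ IH ->].
have {hc hin} : foldr (fun p (a : Prop) => M (pval r p) -> a) (M (pval r c.1)) c.2.
  by elim: cls hc hin => //= c' l IHl [h1 h2] [<-|/IHl]; [apply: h1 | apply].
elim: c.2 IH => //= p l IHl IH h; apply: IHl => [q hq|]; first by apply: IH; right.
by apply: h; apply: IH; left.
Qed.

(** Application of the clause at position [i] under the assignment [r], with its premises
    curried. *)
Lemma gen_clause base cls i r : i < size cls ->
  foldr (fun p (a : Prop) => gen base cls (pval r p) -> a)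
    (gen base cls (pval r (nth (PN 0, [::]) cls i).1)) (nth (PN 0, [::]) cls i).2.
Proof.
move=> hi; have hin : List.In (nth (PN 0, [::]) cls i) cls.
  by elim: cls i hi => //= c l IH [|i] hi; [left | right; apply: IH].
have h := @gen_rule base cls _ _ r hin.
move: (nth _ _ _) h => [c l] /= h {hin}.
have {h} : (forall p, List.In p l -> gen base cls (pval r p)) -> gen base cls (pval r c) by auto.
elim: l => /= [|p l IH] h; first by apply: h.
by move=> hp; apply: IH => hl; apply: h => q [<-|/hl].
Qed.

Ltac npinv := repeat match goal with
  | H : npair _ _ = npair _ _ |- _ => apply npair_inj in H; destruct H
  end.

Ltac split_clauses := lazymatch goal with
  | |- _ /\ _ => split; [|split_clauses]
  | |- True => exact I
  | _ => idtac
  end.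

(** * The universal r.e. set *)

Definition ev_pat c x y := PP (PN 0) (PP c (PP x y)).
Definition mub_pat c x y := PP (PN 1) (PP c (PP x y)).
Definition code_pat c := PP (PN 2) c.

(* Tag 0: the program [c] maps [x] to [y]. Tag 1: it is defined and nonzero at
   all [(x, m)] with [m < y]. Tag 2: [c] is the number of a program. *)
Definition ev_clauses : seq clause :=
  let x := PV 0 in let y := PV 1 in let c := PV 2 in let d := PV 3 in
  let u := PV 4 in let v := PV 5 in
  [:: (ev_pat (PP (PN 0) (PN 0)) x (PN 0), [::]);
      (ev_pat (PP (PN 1) (PN 0)) x (PS x), [::]);
      (ev_pat (PP (PN 2) (PN 0)) (PP x y) x, [::]);
      (ev_pat (PP (PN 3) (PN 0)) (PP x y) y, [::]);
      (ev_pat (PP (PN 4) (PN 0)) x (PN 0), [::]);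
      (ev_pat (PP (PN 5) (PP c d)) x (PP u v), [:: ev_pat c x u; ev_pat d x v]);
      (ev_pat (PP (PN 6) (PP c d)) x y, [:: ev_pat d x u; ev_pat c u y]);
      (ev_pat (PP (PN 7) (PP c d)) (PP x (PN 0)) y, [:: ev_pat c x y]);
      (ev_pat (PP (PN 7) (PP c d)) (PP x (PS u)) y,
        [:: ev_pat (PP (PN 7) (PP c d)) (PP x u) v; ev_pat d (PP x (PP u v)) y]);
      (ev_pat (PP (PN 8) c) x y, [:: mub_pat c x y; ev_pat c (PP x y) (PN 0)]);
      (mub_pat c x (PN 0), [::]);
      (mub_pat c x (PS y), [:: mub_pat c x y; ev_pat c (PP x y) (PS u)]);
      (code_pat (PP (PN 0) (PN 0)), [::]);
      (code_pat (PP (PN 1) (PN 0)), [::]);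
      (code_pat (PP (PN 2) (PN 0)), [::]);
      (code_pat (PP (PN 3) (PN 0)), [::]);
      (code_pat (PP (PN 4) (PN 0)), [::]);
      (code_pat (PP (PN 5) (PP c d)), [:: code_pat c; code_pat d]);
      (code_pat (PP (PN 6) (PP c d)), [:: code_pat c; code_pat d]);
      (code_pat (PP (PN 7) (PP c d)), [:: code_pat c; code_pat d]);
      (code_pat (PP (PN 8) c), [:: code_pat c])].

(** The clauses do not check that the numbers they combine are numbers of programs. Tags 0 and 1
    therefore speak about all programs with the given number and are vacuous when there is none. *)
Definition ev_meaning (n : nat) : Prop :=
  match nfst n with
  | 0 => forall k, code_num k = nfst (nsnd n) ->
           computes k (nfst (nsnd (nsnd n))) (nsnd (nsnd (nsnd n)))
  | 1 => forall k, code_num k = nfst (nsnd n) -> forall m, m < nsnd (nsnd (nsnd n)) ->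
           exists y, computes k (npair (nfst (nsnd (nsnd n))) m) y.+1
  | _ => exists k, code_num k = nsnd n
  end.

Definition ev_gen := gen (fun=> False) ev_clauses.

Lemma ev_sound n : ev_gen n -> ev_meaning n.
Proof.
apply: gen_ind_clauses => //.
rewrite [foldr _ _ _]/= /ev_meaning !npE /computes; split_clauses; move=> r;
  move: (nth 0 r 0) (nth 0 r 1) (nth 0 r 2) (nth 0 r 3) (nth 0 r 4) (nth 0 r 5) => x y c d u v {r};
  rewrite ?npE.
- by case=> //= *; npinv.
- by case=> //= *; npinv.
- by case=> //= *; npinv; rewrite // npE.
- by case=> //= *; npinv; rewrite // npE.
- by case=> //= *; npinv=> //; right; split=> // -[].
- by move=> h1 h2; case=> //= *; npinv => //; exists u, v; auto.
- by move=> h1 h2; case=> //= *; npinv => //; exists u; auto.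
- by move=> h1; case=> //= *; npinv => //; rewrite !npE; auto.
- move=> h1 h2 [|||||k l|k l|k l|k] /= *; npinv => //; rewrite !npE; exists v; split; last by auto.
  by have := h1 (Prec k l); rewrite /= !npE; apply; congruence.
- by move=> h1 h2; case=> //= *; npinv => //; split; auto.
- by [].
- move=> h1 h2 k e m; rewrite ltnS leq_eqVlt => /orP [/eqP ->|]; last exact: h1.
  by exists u; apply: h2.
- by exists Zero.
- by exists Succ.
- by exists Fst.
- by exists Snd.
- by exists Oracle.
- by move=> [k <-] [l <-]; exists (Pair k l).
- by move=> [k <-] [l <-]; exists (Comp k l).
- by move=> [k <-] [l <-]; exists (Prec k l).
- by move=> [k <-]; exists (Mu k).
Qed.

Lemma ev_code k : ev_gen (npair 2 (code_num k)).
Proof.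
have R i r h := @gen_clause (fun=> False) ev_clauses i r h.
elim: k => [|||||c IHc d IHd|c IHc d IHd|c IHc d IHd|c IHc] /=.
- exact: (R 12 [::]).
- exact: (R 13 [::]).
- exact: (R 14 [::]).
- exact: (R 15 [::]).
- exact: (R 16 [::]).
- by apply: (R 17 [:: 0; 0; code_num c; code_num d]).
- by apply: (R 18 [:: 0; 0; code_num c; code_num d]).
- by apply: (R 19 [:: 0; 0; code_num c; code_num d]).
- by apply: (R 20 [:: 0; 0; code_num c]).
Qed.

Lemma ev_complete k x y : computes k x y -> ev_gen (npair 0 (npair (code_num k) (npair x y))).
Proof.
have R i r h := @gen_clause (fun=> False) ev_clauses i r h.
rewrite /computes; elim: k x y => [|||||c IHc d IHd|c IHc d IHd|c IHc d IHd|c IHc] /= x y.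
- by move=> ->; apply: (R 0 [:: x]).
- by move=> ->; apply: (R 1 [:: x]).
- by move=> ->; rewrite -{1}(npair_eta x); apply: (R 2 [:: nfst x; nsnd x]).
- by move=> ->; rewrite -{1}(npair_eta x); apply: (R 3 [:: nfst x; nsnd x]).
- by move=> [[]//|[_ ->]]; apply: (R 4 [:: x]).
- by move=> [u [v [/IHc hu [/IHd hv ->]]]]; apply: (R 5 [:: x; y; code_num c; code_num d; u; v]).
- by move=> [u [/IHd hu /IHc hv]]; apply: (R 6 [:: x; y; code_num c; code_num d; u]).
- move: (nfst x) (nsnd x) (esym (npair_eta x)) => a n ->; elim: n y => [|n IH] y.
    by move/IHc; apply: (R 7 [:: a; y; code_num c; code_num d]).
  by move=> [i [/IH hi /IHd hd]]; apply: (R 8 [:: a; y; code_num c; code_num d; n; i]).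
- move=> [/IHc h0 hm].
  apply: (R 9 [:: x; y; code_num c]) => //=.
  elim: y hm {h0} => [|y IH] hm; first exact: (R 10 [:: x; 0; code_num c]).
  have [k /IHc hk] := hm y (leqnn _).
  apply: (R 11 [:: x; y; code_num c; 0; k]) => //=.
  by apply: IH => m lt; apply: hm; apply: leqW.
Qed.

(** The fact with tag 2 is required in addition because an evaluation fact says nothing about a
    number that belongs to no program. *)
Lemma S1_W : S1 (fun z => W (nfst z) (nsnd z)).
Proof.
have hg : S1 ev_gen by apply: S1_gen; apply: S1_False.
have h : S1 (fun z => ev_gen (npair 2 (nfst z)) /\ (exists y, ev_gen (npair 0 (npair (nfst z) (npair (nsnd z) y))))).
  apply: S1_and; first by apply: (S1_comp hg); tc.
  by apply: S1_ex; apply: (S1_comp hg); tc.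
apply: (S1_ext _ h) => z; split.
  move=> [/ev_sound + [y /ev_sound]]; rewrite /ev_meaning !npE => -[k e] hy.
  by exists k; split=> //; exists y; apply: hy.
move=> [k [<- [y /ev_complete hy]]]; split; [exact: ev_code | by exists y].
Qed.

(** Takes the place of injectivity of [code_num]: evaluation facts mention only the number, so by
    soundness they hold for every program with that number. *)
Lemma W_code_num k n : W (code_num k) n <-> exists y, computes k n y.
Proof.
split=> [[k' [ek [y /ev_complete/ev_sound]]]|h]; last by exists k.
by rewrite ek /ev_meaning !npE => /(_ _ erefl) h; exists y.
Qed.

Lemma S1_is_W P : S1 P -> exists e, forall n, P n <-> W e n.
Proof.
move=> /S1_domain [c Hc]; exists (code_num c) => n.
by rewrite W_code_num; apply: Hc.
Qed.

(** * Provability is r.e. *)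

Lemma term_ind_list (P : term -> Prop) :
  (forall x, P (Var x)) ->
  (forall f ts, (forall t, List.In t ts -> P t) -> P (Func f ts)) ->
  forall t, P t.
Proof.
move=> hv hf; fix IH 1 => -[x|f ts]; first exact: hv.
apply: hf; elim: ts => [|u ts IHts] t /=; first by case.
by move=> [<-|h]; [exact: IH | exact: IHts].
Qed.

Lemma map_inj_in (A B : Type) (f : A -> B) s t :
  (forall x, List.In x s -> forall y, f x = f y -> x = y) -> map f s = map f t -> s = t.
Proof.
elim: s t => [|x s IH] [|y t] //= h [e1 e2]; congr (_ :: _).
  by apply: h => //; left.
by apply: IH => // z hz; apply: h; right.
Qed.

Lemma term_code_inj : injective term_code.
Proof.
elim/term_ind_list => [x|f ts IH] [y|g us] //= e; npinv => //.
  by subst.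
by subst; congr Func; apply: map_inj_in; [exact: IH | exact: seq_code_inj].
Qed.

Lemma map_term_code_inj : injective (map term_code).
Proof. exact: inj_map term_code_inj. Qed.

Lemma form_code_inj : injective form_code.
Proof.
elim=> [|t s|r ts|p IHp q IHq|p IHp] [|t' s'|r' ts'|p' q'|p'] //= e; npinv => //.
- by congr Eq; apply: term_code_inj.
- by subst; congr Rel; apply: map_term_code_inj; apply: seq_code_inj.
- by congr Imp; auto.
- by congr All; auto.
Qed.

Definition sig_decode (l : nat) : signature :=
  Signature (seq_decode (nfst l)) (seq_decode (nsnd l)).

Lemma sig_codeK : cancel sig_code sig_decode.
Proof. by case=> f r; rewrite /sig_decode /sig_code !npE !seq_codeK. Qed.

(* Codes for the substitutions that occur in derivations: [inst] and [shift], under binders. *)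
Inductive dsub : Type := DShift | DScons of term | DUp of dsub.

Fixpoint dsub_den (d : dsub) : nat -> term :=
  match d with
  | DShift => shift
  | DScons t => scons t Var
  | DUp d => up (dsub_den d)
  end.

Fixpoint dsub_code (d : dsub) : nat :=
  match d with
  | DShift => npair 0 0
  | DScons t => npair 1 (term_code t)
  | DUp d => npair 2 (dsub_code d)
  end.

(** All judgements are given three arguments, padded by zeros, so that one format of codes serves
    for every tag. *)
Definition jpat (tag : nat) (a b c : pat) : pat := PP (PN tag) (PP a (PP b c)).

Definition jnth := jpat 0.
Definition jlt x n := jpat 1 x n (PN 0).
Definition jvar := jpat 2.
Definition jts := jpat 3.
Definition jtsl := jpat 4.
Definition jfs := jpat 5.
Definition jfsl := jpat 6.
Definition jti l t := jpat 7 l t (PN 0).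
Definition jtil := jpat 8.
Definition jfi l p := jpat 9 l p (PN 0).
Definition jtb n t := jpat 10 n t (PN 0).
Definition jtbl n t := jpat 11 n t (PN 0).
Definition jfb n p := jpat 12 n p (PN 0).
Definition jmem p g := jpat 13 p g (PN 0).
Definition jprv := jpat 14.

Definition pcons x l := PS (PP x l).
Definition pvar x := PP (PN 0) x.
Definition pfunc f ts := PP (PN 1) (PP f ts).
Definition pbot := PP (PN 0) (PN 0).
Definition peq t s := PP (PN 1) (PP t s).
Definition prel r ts := PP (PN 2) (PP r ts).
Definition pimp p q := PP (PN 3) (PP p q).
Definition pall p := PP (PN 4) p.
Definition dshift := PP (PN 0) (PN 0).
Definition dscons t := PP (PN 1) t.
Definition dup d := PP (PN 2) d.

(* The numbers are the positions by which [gen_clause] refers to the clauses. *)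
Definition logic_clauses : seq clause :=
  let l := PV 0 in let i := PV 1 in let v := PV 2 in let x := PV 3 in
  let s := PV 4 in let t := PV 5 in let u := PV 6 in let f := PV 7 in
  let ts := PV 8 in let us := PV 9 in let p := PV 10 in let q := PV 11 in
  let g := PV 12 in let h := PV 13 in let r := PV 14 in let k := PV 15 in
  let n := PV 16 in let p' := PV 17 in let q' := PV 18 in
  [:: (* 0 *) (jnth (pcons v l) (PN 0) v, [::]);
      (jnth (pcons x l) (PS i) v, [:: jnth l i v]);
      (* 2 *) (jlt (PN 0) (PS n), [::]);
      (jlt (PS x) (PS n), [:: jlt x n]);
      (* 4 *) (jvar dshift x (pvar (PS x)), [::]);
      (jvar (dscons t) (PN 0) t, [::]);
      (jvar (dscons t) (PS x) (pvar x), [::]);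
      (jvar (dup s) (PN 0) (pvar (PN 0)), [::]);
      (jvar (dup s) (PS x) u, [:: jvar s x t; jts dshift t u]);
      (* 9 *) (jts s (pvar x) u, [:: jvar s x u]);
      (jts s (pfunc f ts) (pfunc f us), [:: jtsl s ts us]);
      (* 11 *) (jtsl s (PN 0) (PN 0), [::]);
      (jtsl s (pcons t ts) (pcons u us), [:: jts s t u; jtsl s ts us]);
      (* 13 *) (jfs s pbot pbot, [::]);
      (jfs s (peq t x) (peq u v), [:: jts s t u; jts s x v]);
      (jfs s (prel r ts) (prel r us), [:: jtsl s ts us]);
      (jfs s (pimp p q) (pimp p' q'), [:: jfs s p p'; jfs s q q']);
      (jfs s (pall p) (pall q), [:: jfs (dup s) p q]);
      (* 18 *) (jfsl s (PN 0) (PN 0), [::]);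
      (jfsl s (pcons p g) (pcons q h), [:: jfs s p q; jfsl s g h]);
      (* 20 *) (jti l (pvar x), [::]);
      (jti (PP l r) (pfunc f ts), [:: jnth l f k; jtil (PP l r) ts k]);
      (* 22 *) (jtil l (PN 0) (PN 0), [::]);
      (jtil l (pcons t ts) (PS k), [:: jti l t; jtil l ts k]);
      (* 24 *) (jfi l pbot, [::]);
      (jfi l (peq t u), [:: jti l t; jti l u]);
      (jfi (PP l r) (prel f ts), [:: jnth r f k; jtil (PP l r) ts k]);
      (jfi l (pimp p q), [:: jfi l p; jfi l q]);
      (jfi l (pall p), [:: jfi l p]);
      (* 29 *) (jtb n (pvar x), [:: jlt x n]);
      (jtb n (pfunc f ts), [:: jtbl n ts]);
      (* 31 *) (jtbl n (PN 0), [::]);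
      (jtbl n (pcons t ts), [:: jtb n t; jtbl n ts]);
      (* 33 *) (jfb n pbot, [::]);
      (jfb n (peq t u), [:: jtb n t; jtb n u]);
      (jfb n (prel f ts), [:: jtbl n ts]);
      (jfb n (pimp p q), [:: jfb n p; jfb n q]);
      (jfb n (pall p), [:: jfb (PS n) p]);
      (* 38 *) (jmem p (pcons p g), [::]);
      (jmem p (pcons q g), [:: jmem p g]);
      (* 40 *) (jprv l g p, [:: jmem p g]);
      (jprv l g (pimp p q), [:: jfi l p; jprv l (pcons p g) q]);
      (jprv l g q, [:: jprv l g (pimp p q); jprv l g p]);
      (jprv l g p, [:: jfi l p; jprv l (pcons (pimp p pbot) g) pbot]);
      (jprv l g (pall p), [:: jfsl dshift g h; jprv l h p]);
      (jprv l g q, [:: jti l t; jprv l g (pall p); jfs (dscons t) p q]);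
      (jprv l g (peq t t), [:: jti l t]);
      (jprv l g q', [:: jfi l p; jprv l g (peq t u); jfs (dscons t) p q;
                        jprv l g q; jfs (dscons u) p q'])].

Definition logic_gen := gen (fun=> False) logic_clauses.

(** Inputs are quantified universally over their decodings, which is vacuous on junk. The
    existential readings are those in which a derivation certifies that a number is a code: tags 7
    to 9, and the formula in tags 13 and 14. *)
Definition logic_meaning (n : nat) : Prop :=
  let a := nfst (nsnd n) in let b := nfst (nsnd (nsnd n)) in let c := nsnd (nsnd (nsnd n)) in
  match nfst n with
  | 0 => forall s, seq_code s = a -> onth s b = Some c
  | 1 => a < b
  | 2 => forall d, dsub_code d = a -> c = term_code (dsub_den d b)
  | 3 => forall d t, dsub_code d = a -> term_code t = b -> c = term_code (tsubst (dsub_den d) t)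
  | 4 => forall d ts, dsub_code d = a -> seq_code (map term_code ts) = b ->
           c = seq_code (map term_code (map (tsubst (dsub_den d)) ts))
  | 5 => forall d p, dsub_code d = a -> form_code p = b -> c = form_code (fsubst (dsub_den d) p)
  | 6 => forall d ps, dsub_code d = a -> seq_code (map form_code ps) = b ->
           c = seq_code (map form_code (map (fsubst (dsub_den d)) ps))
  | 7 => exists2 t, term_code t = b & term_in (sig_decode a) t
  | 8 => exists2 ts, seq_code (map term_code ts) = b & size ts = c /\ all (term_in (sig_decode a)) ts
  | 9 => exists2 p, form_code p = b & form_in (sig_decode a) p
  | 10 => forall t, term_code t = b -> term_below a t
  | 11 => forall ts, seq_code (map term_code ts) = b -> all (term_below a) ts
  | 12 => forall p, form_code p = b -> form_below a p
  | 13 => forall ps, seq_code (map form_code ps) = b -> exists2 p, form_code p = a & List.In p ps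
  | _ => forall ps, seq_code (map form_code ps) = b -> exists2 p, form_code p = c & prv (sig_decode a) ps p
  end.

Lemma logic_sound n : logic_gen n -> logic_meaning n.
Proof.
apply: gen_ind_clauses => //.
rewrite [foldr _ _ _]/= /logic_meaning; split_clauses => r; rewrite !npE;
 move: (nth 0 r 0) (nth 0 r 1) (nth 0 r 2) (nth 0 r 3) (nth 0 r 4) (nth 0 r 5) (nth 0 r 6)
  (nth 0 r 7) (nth 0 r 8) (nth 0 r 9) (nth 0 r 10) (nth 0 r 11) (nth 0 r 12) (nth 0 r 13)
  (nth 0 r 14) (nth 0 r 15) (nth 0 r 16) (nth 0 r 17) (nth 0 r 18)
 => l i v x s t u f ts us p q g h r' k n' p' q' {r}; rewrite ?npE.

- by move=> [|y w] //= [/npair_inj [-> _]].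
- by move=> h1 [|y w] //= [/npair_inj [_ /h1]].
- by [].
- by [].
- by move=> [|?|?] /= e; npinv.
- by move=> [|?|?] /= e; npinv.
- by move=> [|?|?] /= e; npinv.
- by move=> [|?|?] /= e; npinv.
- by move=> h1 h2 [|?|d] /= e; npinv=> //; apply: (h2 DShift) => //; rewrite (h1 d).
- by move=> h1 d [y|f' ts'] /= ed e; npinv=> //; subst; rewrite (h1 d).
- by move=> h1 d [y|f' ts'] /= ed e; npinv=> //; subst; rewrite (h1 d ts').
- by move=> d [].
- by move=> h1 h2 d [|t' ts'] //= ed [/npair_inj [e1 e2]]; rewrite (h1 d t') // (h2 d ts').
- by move=> d [|??|??|??|?] //= ed e; npinv.
- move=> h1 h2 d [|t1 t2|??|??|?] //= ed e; npinv=> //.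
  by rewrite (h1 d t1) // (h2 d t2).
- move=> h1 d [|??|r1 ts'|??|?] //= ed e; npinv=> //.
  by rewrite (h1 d ts') //; congruence.
- move=> h1 h2 d [|??|??|t1 t2|?] //= ed e; npinv=> //.
  by rewrite (h1 d t1) // (h2 d t2).
- move=> h1 d [|??|??|??|t1] //= ed e; npinv=> //.
  by rewrite (h1 (DUp d) t1) //= ed.
- by move=> d [].
- by move=> h1 h2 d [|t' ts'] //= ed [/npair_inj [e1 e2]]; rewrite (h1 d t') // (h2 d ts').
- by exists (Var x).
- move=> h1 [ts' e1 [e2 h2]]; exists (Func f ts'); rewrite /= ?e1 // e2 h2 andbT.
  by rewrite npE (h1 (seq_decode l)) ?seq_decodeK.
- by exists [::].
- by move=> [t' <- ht] [ts' <- [<- hts]]; exists (t' :: ts'); rewrite //= ht.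
- by exists Bot.
- by move=> [t' <- ht] [u' <- hu]; exists (Eq t' u'); rewrite //= ht.
- move=> h1 [ts' e1 [e2 h2]]; exists (Rel f ts'); rewrite /= ?e1 // e2 h2 andbT.
  by rewrite npE (h1 (seq_decode r')) ?seq_decodeK.
- by move=> [t' <- ht] [u' <- hu]; exists (Imp t' u'); rewrite //= ht.
- by move=> [t' <- ht]; exists (All t').
- by move=> h1 [y|f' ts'] //= e; npinv=> //; subst.
- by move=> h1 [y|f' ts'] //= e; npinv=> //; auto.
- by move=> [].
- by move=> h1 h2 [|t' ts'] //= [/npair_inj [e1 e2]]; rewrite h1 // h2.
- by move=> [|??|??|??|?] //= e; npinv.
- by move=> h1 h2 [|??|??|??|?] //= e; npinv=> //; rewrite h1 // h2.
- by move=> h1 [|??|??|??|?] //= e; npinv=> //; rewrite h1.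
- by move=> h1 h2 [|??|??|??|?] //= e; npinv=> //; rewrite h1 // h2.
- by move=> h1 [|??|??|??|?] //= e; npinv=> //; rewrite h1.
- by move=> [|p1 ps] //= [/npair_inj [e1 e2]]; exists p1 => //; left.
- by move=> h1 [|p1 ps] //= [/npair_inj [e1 /h1 [p2 e3 e4]]]; exists p2 => //; right.
- by move=> h1 ps /h1 [p1 e h2]; exists p1 => //; apply: Hyp.
- move=> [p1 e1 hp] h2 ps e2; have [|q1 e3 hq] := h2 (p1 :: ps); first by rewrite /= e1 e2.
  by exists (Imp p1 q1); [rewrite /= e1 e3 | apply: ImpI].
- move=> h1 h2 ps e; have [[|??|??|p1 q1|?] //= e1 hp1] := h1 ps e; npinv => //.
  have [p2 e2 hp2] := h2 ps e; exists q1 => //.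
  by apply: ImpE hp1 _; have -> : p1 = p2 by apply: form_code_inj; congruence.
- move=> [p1 e1 hp] h2 ps e2; have [|q1 e3 hq] := h2 (Neg p1 :: ps); first by rewrite /= e1 e2.
  exists p1 => //; apply: RAA => //.
  by have <- : q1 = Bot by apply: form_code_inj.
- move=> h1 h2 ps e; have [p1 e1 hp1] := h2 (map (fsubst shift) ps) (esym (h1 DShift ps erefl e)).
  by exists (All p1); [rewrite /= e1 | apply: AllI].
- move=> [t1 e1 ht1] h1 h2 ps e; have [[|??|??|??|p1] //= e2 hp1] := h1 ps e; npinv => //.
  exists (inst p1 t1); last exact: AllE.
  by rewrite (h2 (DScons t1) p1) //= e1.
- by move=> [t1 <- ht1] ps e; exists (Eq t1 t1) => //; apply: EqI.
- move=> [p1 e1 hp1] h1 h2 h3 h4 ps e.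
  have [[|t1 u1|??|??|?] //= e2 he] := h1 ps e; npinv => //.
  have [q1 e3 hq1] := h3 ps e.
  exists (inst p1 u1); first by rewrite (h4 (DScons u1) p1) //=; congruence.
  apply: EqE he _ => //.
  have <- // : q1 = inst p1 t1.
  by apply: form_code_inj; rewrite e3 (h2 (DScons t1) p1) //=; congruence.
Qed.

Definition jud (tag a b c : nat) : Prop := logic_gen (npair tag (npair a (npair b c))).

Lemma jud_nth l i v : onth l i = Some v -> jud 0 (seq_code l) i v.
Proof.
have R i' r h := @gen_clause (fun=> False) logic_clauses i' r h.
elim: l i => [|x l IH] [|i] //=.
  by case=> ->; apply: (R 0 [:: seq_code l; 0; v]).
by move/IH; apply: (R 1 [:: seq_code l; i; v; x]).
Qed.

Lemma jud_lt x n : x < n -> jud 1 x n 0.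
Proof.
have R i r h := @gen_clause (fun=> False) logic_clauses i r h.
(* An assignment lists the values of the clause variables by index, with [0] for those that do not
   occur; the variable called [n] in the clauses has index 16. *)
elim: x n => [|x IH] [|n] // h; first by apply: (R 2 (nseq 16 0 ++ [:: n])).
by apply: (R 3 [:: 0; 0; 0; x; 0;0;0;0;0;0;0;0;0;0;0;0;n]) => //=; apply: IH.
Qed.

(** Comes before the general substitution because evaluating [DUp] at a variable already shifts a
    term. *)
Lemma jud_tshift t : jud 3 (npair 0 0) (term_code t) (term_code (tsubst shift t)).
Proof.
have R i r h := @gen_clause (fun=> False) logic_clauses i r h.
elim/term_ind_list: t => [x|f ts IH] /=.
  apply: (R 9 [:: 0; 0; 0; x; npair 0 0; 0; npair 0 x.+1]) => //=.
  exact: (R 4 [:: 0; 0; 0; x]).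
suff h : jud 4 (npair 0 0) (seq_code (map term_code ts)) (seq_code (map term_code (map (tsubst shift) ts))).
  by apply: (R 10 [:: 0; 0; 0; 0; npair 0 0; 0; 0; f; _; _]) => //=.
elim: ts IH => [|t ts IHts] IH /=; first exact: (R 11 [:: 0; 0; 0; 0; npair 0 0]).
apply: (R 12 [:: 0; 0; 0; 0; npair 0 0; term_code t; _; 0; _; _]) => //=.
  by apply: IH; left.
by apply: IHts => u hu; apply: IH; right.
Qed.

Lemma jud_var d x : jud 2 (dsub_code d) x (term_code (dsub_den d x)).
Proof.
have R i r h := @gen_clause (fun=> False) logic_clauses i r h.
elim: d x => [|t|d IH] x /=.
- exact: (R 4 [:: 0; 0; 0; x]).
- case: x => [|x]; first exact: (R 5 [:: 0; 0; 0; 0; 0; term_code t]).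
  exact: (R 6 [:: 0; 0; 0; x; 0; term_code t]).
- case: x => [|x]; first exact: (R 7 [:: 0; 0; 0; 0; dsub_code d]).
  apply: (R 8 [:: 0; 0; 0; x; dsub_code d; term_code (dsub_den d x); _]) => //=.
    exact: IH.
  exact: jud_tshift.
Qed.

Lemma jud_ts d t : jud 3 (dsub_code d) (term_code t) (term_code (tsubst (dsub_den d) t)).
Proof.
have R i r h := @gen_clause (fun=> False) logic_clauses i r h.
elim/term_ind_list: t => [x|f ts IH] /=.
  apply: (R 9 [:: 0; 0; 0; x; dsub_code d; 0; _]) => //=; exact: jud_var.
suff h : jud 4 (dsub_code d) (seq_code (map term_code ts)) (seq_code (map term_code (map (tsubst (dsub_den d)) ts))).
  by apply: (R 10 [:: 0; 0; 0; 0; dsub_code d; 0; 0; f; _; _]) => //=.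
elim: ts IH => [|t ts IHts] IH /=; first exact: (R 11 [:: 0; 0; 0; 0; dsub_code d]).
apply: (R 12 [:: 0; 0; 0; 0; dsub_code d; term_code t; _; 0; _; _]) => //=.
  by apply: IH; left.
by apply: IHts => u hu; apply: IH; right.
Qed.

Lemma jud_fs d p : jud 5 (dsub_code d) (form_code p) (form_code (fsubst (dsub_den d) p)).
Proof.
have R i r h := @gen_clause (fun=> False) logic_clauses i r h.
elim: p d => [|t u|r ts|p IHp q IHq|p IHp] d /=.
- exact: (R 13 [:: 0; 0; 0; 0; dsub_code d]).
- by apply: (R 14 [:: 0; 0; _; term_code u; dsub_code d; term_code t; _]) => //=; apply: jud_ts.
- suff h : jud 4 (dsub_code d) (seq_code (map term_code ts)) (seq_code (map term_code (map (tsubst (dsub_den d)) ts))).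
    by apply: (R 15 [:: 0; 0; 0; 0; dsub_code d; 0; 0; 0; _; _; 0; 0; 0; 0; r]) => //=.
  elim: ts => [|t ts IHts] /=; first exact: (R 11 [:: 0; 0; 0; 0; dsub_code d]).
  apply: (R 12 [:: 0; 0; 0; 0; dsub_code d; term_code t; _; 0; _; _]) => //=; exact: jud_ts.
- by apply: (R 16 [:: 0; 0; 0; 0; dsub_code d; 0; 0; 0; 0; 0; form_code p; form_code q; 0; 0; 0; 0; 0; _; _]) => //=; [apply: IHp | apply: IHq].
- by apply: (R 17 [:: 0; 0; 0; 0; dsub_code d; 0; 0; 0; 0; 0; form_code p; _]) => //=; apply: (IHp (DUp d)).
Qed.

Lemma jud_fsl d ps : jud 6 (dsub_code d) (seq_code (map form_code ps))
  (seq_code (map form_code (map (fsubst (dsub_den d)) ps))).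
Proof.
have R i r h := @gen_clause (fun=> False) logic_clauses i r h.
elim: ps => [|p ps IH] /=.
  exact: (R 18 [:: 0; 0; 0; 0; dsub_code d]).
apply: (R 19 [:: 0; 0; 0; 0; dsub_code d; 0; 0; 0; 0; 0; form_code p; _; _; _]) => //=; exact: jud_fs.
Qed.

Lemma jud_ti L t : term_in L t -> jud 7 (sig_code L) (term_code t) 0.
Proof.
have R i r h := @gen_clause (fun=> False) logic_clauses i r h.
elim/term_ind_list: t => [x|f ts IH] /=.
  by move=> _; apply: (R 20 [:: sig_code L; 0; 0; x]).
move=> /andP [/eqP hf hts].
suff h : jud 8 (sig_code L) (seq_code (map term_code ts)) (size ts).
  apply: (R 21 [:: seq_code (funs L); 0; 0; 0; 0; 0; 0; f; _; 0; 0; 0; 0; 0; _; size ts]) => //=.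
  exact: jud_nth hf.
elim: ts IH hts {hf} => [|t ts IHts] IH /=; first by move=> _; exact: (R 22 [:: sig_code L]).
move=> /andP [ht hts].
apply: (R 23 [:: sig_code L; 0; 0; 0; 0; term_code t; 0; 0; _; 0; 0; 0; 0; 0; 0; _]) => //=.
  by apply: IH => //; left.
by apply: IHts => // u hu; apply: IH; right.
Qed.

Lemma jud_til L ts : all (term_in L) ts -> jud 8 (sig_code L) (seq_code (map term_code ts)) (size ts).
Proof.
have R i r h := @gen_clause (fun=> False) logic_clauses i r h.
elim: ts => [|t ts IH] /=; first by move=> _; exact: (R 22 [:: sig_code L]).
move=> /andP [ht hts].
apply: (R 23 [:: sig_code L; 0; 0; 0; 0; term_code t; 0; 0; _; 0; 0; 0; 0; 0; 0; _]) => //=.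
  exact: jud_ti.
exact: IH.
Qed.

Lemma jud_fi L p : form_in L p -> jud 9 (sig_code L) (form_code p) 0.
Proof.
have R i r h := @gen_clause (fun=> False) logic_clauses i r h.
elim: p => [|t u|f ts|p IHp q IHq|p IHp] /=.
- by move=> _; apply: (R 24 [:: sig_code L]).
- move=> /andP [ht hu]; apply: (R 25 [:: sig_code L; 0; 0; 0; 0; term_code t; term_code u]) => //=; exact: jud_ti.
- move=> /andP [/eqP hf /jud_til hts].
  apply: (R 26 [:: _; 0; 0; 0; 0; 0; 0; f; _; 0; 0; 0; 0; 0; seq_code (rels L); size ts]) => //=.
  exact: jud_nth hf.
- move=> /andP [/IHp hp /IHq hq]; by apply: (R 27 [:: sig_code L; 0; 0; 0; 0; 0; 0; 0; 0; 0; form_code p; form_code q]).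
- by move=> /IHp hp; apply: (R 28 [:: sig_code L; 0; 0; 0; 0; 0; 0; 0; 0; 0; form_code p]).
Qed.

Lemma jud_tb n t : term_below n t -> jud 10 n (term_code t) 0.
Proof.
have R i r h := @gen_clause (fun=> False) logic_clauses i r h.
elim/term_ind_list: t => [x|f ts IH] /=.
  by move=> h; apply: (R 29 [:: 0;0;0;x;0;0;0;0;0;0;0;0;0;0;0;0;n]) => //=; apply: jud_lt.
move=> hts; apply: (R 30 [:: 0;0;0;0;0;0;0;f;_;0;0;0;0;0;0;0;n]) => //=.
elim: ts IH hts => [|t ts IHts] IH /=; first by move=> _; exact: (R 31 [:: 0;0;0;0;0;0;0;0;0;0;0;0;0;0;0;0;n]).
move=> /andP [ht hts]; apply: (R 32 [:: 0;0;0;0;0;term_code t;0;0;_;0;0;0;0;0;0;0;n]) => //=.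
  by apply: IH => //; left.
by apply: IHts => // u hu; apply: IH; right.
Qed.

Lemma jud_fb n p : form_below n p -> jud 12 n (form_code p) 0.
Proof.
have R i r h := @gen_clause (fun=> False) logic_clauses i r h.
elim: p n => [|t u|f ts|p IHp q IHq|p IHp] n /=.
- by move=> _; apply: (R 33 [:: 0;0;0;0;0;0;0;0;0;0;0;0;0;0;0;0;n]).
- by move=> /andP [ht hu]; apply: (R 34 [:: 0;0;0;0;0;term_code t;term_code u;0;0;0;0;0;0;0;0;0;n]) => //=; exact: jud_tb.
- move=> hts; apply: (R 35 [:: 0;0;0;0;0;0;0;f;_;0;0;0;0;0;0;0;n]) => //=.
  elim: ts hts => [|t ts IHts] /=; first by move=> _; exact: (R 31 [:: 0;0;0;0;0;0;0;0;0;0;0;0;0;0;0;0;n]).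
  move=> /andP [ht hts]; apply: (R 32 [:: 0;0;0;0;0;term_code t;0;0;_;0;0;0;0;0;0;0;n]) => //=.
    exact: jud_tb.
  exact: IHts.
- by move=> /andP [/IHp hp /IHq hq]; apply: (R 36 [:: 0;0;0;0;0;0;0;0;0;0;form_code p;form_code q;0;0;0;0;n]).
- by move=> /IHp hp; apply: (R 37 [:: 0;0;0;0;0;0;0;0;0;0;form_code p;0;0;0;0;0;n]).
Qed.

Lemma jud_mem p ps : List.In p ps -> jud 13 (form_code p) (seq_code (map form_code ps)) 0.
Proof.
have R i r h := @gen_clause (fun=> False) logic_clauses i r h.
elim: ps => [|q ps IH] //= [->|/IH h].
  exact: (R 38 [:: 0;0;0;0;0;0;0;0;0;0;form_code p;0;_]).
by apply: (R 39 [:: 0;0;0;0;0;0;0;0;0;0;form_code p;form_code q;_]) => //=.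
Qed.

Lemma jud_prv L ps p : prv L ps p -> jud 14 (sig_code L) (seq_code (map form_code ps)) (form_code p).
Proof.
have R i r h := @gen_clause (fun=> False) logic_clauses i r h.
elim=> {ps p}.
- by move=> G p /jud_mem h; apply: (R 40 [:: sig_code L;0;0;0;0;0;0;0;0;0;form_code p;0;_]).
- move=> G p q /jud_fi h1 _ h2.
  by apply: (R 41 [:: sig_code L;0;0;0;0;0;0;0;0;0;form_code p;form_code q;_]).
- move=> G p q _ h1 _ h2.
  by apply: (R 42 [:: sig_code L;0;0;0;0;0;0;0;0;0;form_code p;form_code q;_]).
- move=> G p /jud_fi h1 _ h2.
  by apply: (R 43 [:: sig_code L;0;0;0;0;0;0;0;0;0;form_code p;0;_]).
- move=> G p _ h.
  apply: (R 44 [:: sig_code L;0;0;0;0;0;0;0;0;0;form_code p;0;_;_]) => //=; last exact: h.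
  exact: (jud_fsl DShift).
- move=> G p t /jud_ti h1 _ h2.
  apply: (R 45 [:: sig_code L;0;0;0;0;term_code t;0;0;0;0;form_code p;_;_]) => //=.
  exact: (jud_fs (DScons t)).
- move=> G t /jud_ti h1.
  by apply: (R 46 [:: sig_code L;0;0;0;0;term_code t;0;0;0;0;0;0;_]).
- move=> G p t s /jud_fi h1 _ h2 _ h3.
  apply: (R 47 [:: sig_code L;0;0;0;0;term_code t;term_code s;0;0;0;form_code p;form_code (inst p t);_;0;0;0;0;0;_]) => //=.
    exact: (jud_fs (DScons t)).
  exact: (jud_fs (DScons s)).
Qed.

Lemma S1_logic : S1 logic_gen.
Proof. exact: (S1_gen _ S1_False). Qed.

Definition sentence_code (l p : nat) : Prop :=
  exists2 q, form_code q = p & sentence (sig_decode l) q.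

Lemma sig_decodeK l : sig_code (sig_decode l) = l.
Proof. by rewrite /sig_code !seq_decodeK npair_eta. Qed.

Lemma S1_sentence l p : tcomp l -> tcomp p -> S1 (fun x => sentence_code (l x) (p x)).
Proof.
move=> hl hp.
have h : S1 (fun x => jud 9 (l x) (p x) 0 /\ jud 12 0 (p x) 0).
  by apply: S1_and; apply: (S1_comp S1_logic); tc.
apply: (S1_ext _ h) => x; split.
  move=> [/logic_sound + /logic_sound]; rewrite /logic_meaning !npE => -[q e h1] h2.
  by exists q => //; rewrite /sentence h1 h2.
move=> [q <- /andP [h1 h2]]; split; last exact: jud_fb.
by rewrite -[l x]sig_decodeK; apply: jud_fi.
Qed.

Lemma jud_prvP L ps n :
  jud 14 (sig_code L) (seq_code (map form_code ps)) n <-> exists2 p, form_code p = n & prv L ps p.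
Proof.
split; last by move=> [p <- /jud_prv].
by move/logic_sound; rewrite /logic_meaning !npE sig_codeK => /(_ ps erefl).
Qed.

(** * Substitution *)

Lemma In_map (A B : Type) (f : A -> B) s y : List.In y (map f s) <-> exists2 x, y = f x & List.In x s.
Proof.
elim: s => [|x s IH] /=; first by split=> // -[].
rewrite IH; split.
  by move=> [<-|[z -> h]]; [exists x => //; left | exists z => //; right].
by move=> [z -> [->|h]]; [left | right; exists z].
Qed.

Lemma In_cat (A : Type) (s t : seq A) x : List.In x (s ++ t) <-> List.In x s \/ List.In x t.
Proof. by elim: s => [|y s IH] /=; [split=> [|[]] //; right | rewrite IH or_assoc]. Qed.

Lemma eq_map_in (A B : Type) (f g : A -> B) s :
  (forall x, List.In x s -> f x = g x) -> map f s = map g s.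
Proof.
elim: s => //= x s IH h; congr (_ :: _); first by apply: h; left.
by apply: IH => y hy; apply: h; right.
Qed.

Lemma allIn (A : Type) (a : pred A) s : all a s <-> (forall x, List.In x s -> a x).
Proof.
elim: s => [|x s IH] //=; split.
  by move=> /andP [hx /IH hs] y [<-|/hs].
by move=> h; apply/andP; split; [apply: h; left | apply/IH => y hy; apply: h; right].
Qed.

Lemma npair_lt x y n : npair x y < n -> x < n /\ y < n.
Proof. by have := npair_ge x y; lia. Qed.

Lemma term_below_code t n : term_code t < n -> term_below n t.
Proof.
elim/term_ind_list: t n => [x|f ts IH] n /=; first by move/npair_lt => [].
move=> /npair_lt [_ /npair_lt [_]].
elim: ts IH => //= t ts IHts IH /ltnW /npair_lt [h1 h2].
rewrite IH ?IHts //; last by left.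
by move=> u hu; apply: IH; right.
Qed.

Lemma term_below_mono t n m : n <= m -> term_below n t -> term_below m t.
Proof.
move=> le; elim/term_ind_list: t => [x|f ts IH] /=; first by move=> h; apply: leq_trans le.
by move=> /allIn h; apply/allIn => t ht; apply: IH => //; apply: h.
Qed.

Lemma form_below_mono p n m : n <= m -> form_below n p -> form_below m p.
Proof.
elim: p n m => [|t s|r ts|p IHp q IHq|p IHp] n m le //=.
- by move=> /andP [h1 h2]; rewrite !(term_below_mono le).
- by move=> /allIn h; apply/allIn => t /h; apply: term_below_mono.
- by move=> /andP [h1 h2]; rewrite (IHp n m le h1) (IHq n m le h2).
- by apply: IHp; rewrite ltnS.
Qed.

(** Pairing dominates its components, so a code is at least every variable index occurring under it.
    This gives a bound on the free variables of any formula, and later the fresh variables of the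
    Henkin construction. *)
Lemma form_below_code p n : form_code p < n -> form_below n p.
Proof.
elim: p n => [|t s|r ts|p IHp q IHq|p IHp] n //= /npair_lt [_].
- by move=> /npair_lt [h1 h2]; rewrite !term_below_code.
- move=> /npair_lt [_]; elim: ts => //= t ts IH /ltnW /npair_lt [h1 h2].
  by rewrite term_below_code ?IH.
- by move=> /npair_lt [h1 h2]; rewrite IHp ?IHq.
- by move=> h; apply: IHp; apply: ltnW.
Qed.

Lemma tsubst_below n t s s' :
  term_below n t -> (forall x, x < n -> s x = s' x) -> tsubst s t = tsubst s' t.
Proof.
elim/term_ind_list: t => [x|f ts IH] /= h e; first exact: e.
by congr Func; apply: eq_map_in => t ht; apply: IH => //; move/allIn: h; apply.
Qed.

Lemma up_below n s s' : (forall x, x < n -> s x = s' x) -> forall x, x < n.+1 -> up s x = up s' x.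
Proof. by move=> h [|x] //= lt; rewrite /up /= h. Qed.

Lemma fsubst_below n p s s' :
  form_below n p -> (forall x, x < n -> s x = s' x) -> fsubst s p = fsubst s' p.
Proof.
elim: p n s s' => [|t u|r ts|p IHp q IHq|p IHp] n s s' //=.
- by move=> /andP [h1 h2] e; rewrite (tsubst_below h1 e) (tsubst_below h2 e).
- by move=> /allIn h e; congr Rel; apply: eq_map_in => t /h ht; apply: tsubst_below ht e.
- by move=> /andP [h1 h2] e; rewrite (IHp n s s') ?(IHq n s s').
- by move=> h e; rewrite (IHp n.+1 _ (up s')) //; apply: up_below.
Qed.

Lemma fsubst_ext p s s' : s =1 s' -> fsubst s p = fsubst s' p.
Proof. by move=> e; apply: (@fsubst_below (form_code p).+1); rewrite ?form_below_code. Qed.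

Lemma map_id_in (A : Type) (f : A -> A) s : (forall x, List.In x s -> f x = x) -> map f s = s.
Proof. by move=> h; rewrite (eq_map_in (g := id)) ?map_id. Qed.

Lemma tsubst_Var t : tsubst Var t = t.
Proof. by elim/term_ind_list: t => //= f ts IH; congr Func; apply: map_id_in. Qed.

Lemma up_Var : up Var =1 Var.
Proof. by case. Qed.

Lemma fsubst_Var p : fsubst Var p = p.
Proof.
elim: p => [|t u|r ts|p IHp q IHq|p IHp] //=; rewrite ?tsubst_Var ?IHp ?IHq //.
  by congr Rel; apply: map_id_in => t _; apply: tsubst_Var.
by rewrite (fsubst_ext _ up_Var) IHp.
Qed.

Lemma tsubst_comp s r t : tsubst s (tsubst r t) = tsubst (fun x => tsubst s (r x)) t.
Proof.
by elim/term_ind_list: t => //= f ts IH; rewrite -map_comp; congr Func; apply: eq_map_in.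
Qed.

Lemma up_comp s r : (fun x => tsubst (up s) (up r x)) =1 up (fun x => tsubst s (r x)).
Proof. by case=> [|x] //=; rewrite /up /= !tsubst_comp. Qed.

Lemma fsubst_comp s r p : fsubst s (fsubst r p) = fsubst (fun x => tsubst s (r x)) p.
Proof.
elim: p s r => [|t u|f ts|p IHp q IHq|p IHp] s r //=.
- by rewrite !tsubst_comp.
- by rewrite -map_comp; congr Rel; apply: eq_map_in => t _; apply: tsubst_comp.
- by rewrite IHp IHq.
- by rewrite IHp (fsubst_ext _ (up_comp s r)).
Qed.

Lemma tsubst_scons_shift t u : tsubst (scons t Var) (tsubst shift u) = u.
Proof. by rewrite tsubst_comp /= tsubst_Var. Qed.

Lemma fsubst_inst s p t : fsubst s (inst p t) = inst (fsubst (up s) p) (tsubst s t).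
Proof.
rewrite /inst !fsubst_comp; apply: fsubst_ext => -[|x] //=.
by rewrite /up /= tsubst_scons_shift.
Qed.

Lemma fsubst_up_shift s p : fsubst (up s) (fsubst shift p) = fsubst shift (fsubst s p).
Proof. by rewrite !fsubst_comp. Qed.

Lemma term_in_subst L s t : (forall x, term_in L (s x)) -> term_in L t -> term_in L (tsubst s t).
Proof.
move=> hs; elim/term_ind_list: t => [x|f ts IH] //= /andP [h1 /allIn h2].
rewrite size_map h1; apply/allIn => u /In_map [t -> ht]; apply: IH => //; exact: h2.
Qed.

Lemma term_in_up L s : (forall x, term_in L (s x)) -> forall x, term_in L (up s x).
Proof. by move=> hs [|x] //; apply: term_in_subst. Qed.

Lemma term_in_scons L t : term_in L t -> forall x, term_in L (scons t Var x).
Proof. by move=> ht [|x]. Qed.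

Lemma form_in_subst L s p : (forall x, term_in L (s x)) -> form_in L p -> form_in L (fsubst s p).
Proof.
elim: p s => [|t u|f ts|p IHp q IHq|p IHp] s hs //=.
- by move=> /andP [h1 h2]; rewrite !term_in_subst.
- move=> /andP [h1 /allIn h2]; rewrite size_map h1.
  by apply/allIn => u /In_map [t -> /h2]; apply: term_in_subst.
- by move=> /andP [h1 h2]; rewrite IHp // IHq.
- by apply: IHp; apply: term_in_up.
Qed.

Lemma form_in_inst L p t : form_in L p -> term_in L t -> form_in L (inst p t).
Proof. by move=> hp ht; apply: form_in_subst => //; apply: term_in_scons. Qed.

Lemma term_below_subst n m s t :
  term_below n t -> (forall x, x < n -> term_below m (s x)) -> term_below m (tsubst s t).
Proof.
elim/term_ind_list: t => [x|f ts IH] /=; first by move=> h; apply.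
by move=> /allIn h hs; apply/allIn => u /In_map [t -> ht]; apply: IH => //; apply: h.
Qed.

Lemma form_below_subst n m s p :
  form_below n p -> (forall x, x < n -> term_below m (s x)) -> form_below m (fsubst s p).
Proof.
elim: p n m s => [|t u|r ts|p IHp q IHq|p IHp] n m s //=.
- by move=> /andP [h1 h2] hs; rewrite !(term_below_subst _ hs).
- by move=> /allIn h hs; apply/allIn => u /In_map [t -> /h ht]; apply: term_below_subst ht hs.
- by move=> /andP [h1 h2] hs; rewrite (IHp n m s h1 hs) (IHq n m s h2 hs).
- move=> h hs; apply: (IHp n.+1) => // -[|x] //= lt; rewrite /up /=.
  by apply: term_below_subst (hs x _) _.
Qed.

(** * Admissible rules *)

Lemma prv_weak L G G' p : prv L G p -> (forall q, List.In q G -> List.In q G') -> prv L G' p.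
Proof.
move=> h; elim: h G' => {G p}.
- by move=> G p h G' s; apply: Hyp; apply: s.
- move=> G p q hp _ IH G' s; apply: ImpI => //; apply: IH => r /= [->|/s]; by [left|right].
- by move=> G p q _ IH1 _ IH2 G' s; apply: ImpE (IH1 _ s) (IH2 _ s).
- move=> G p hp _ IH G' s; apply: RAA => //; apply: IH => r /= [->|/s]; by [left|right].
- move=> G p _ IH G' s; apply: AllI; apply: IH => r /In_map [q -> /s hq].
  by apply/In_map; exists q.
- by move=> G p t ht _ IH G' s; apply: AllE => //; apply: IH.
- by move=> *; apply: EqI.
- by move=> G p t u hp _ IH1 _ IH2 G' s; apply: EqE hp (IH1 _ s) (IH2 _ s).
Qed.

Lemma prv_subst L G p s :
  (forall x, term_in L (s x)) -> prv L G p -> prv L (map (fsubst s) G) (fsubst s p).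
Proof.
move=> hs h; elim: h s hs => {G p}.
- by move=> G p h s hs; apply: Hyp; apply/In_map; exists p.
- by move=> G p q hp _ IH s hs; apply: ImpI; [apply: form_in_subst | apply: IH].
- by move=> G p q _ IH1 _ IH2 s hs; apply: ImpE (IH1 _ hs) (IH2 _ hs).
- by move=> G p hp _ IH s hs; apply: RAA; [apply: form_in_subst | apply: IH].
- move=> G p _ IH s hs; apply: AllI; have := IH _ (term_in_up hs).
  by rewrite -!map_comp; congr prv; apply: eq_map => q /=; rewrite fsubst_up_shift.
- move=> G p t ht _ IH s hs; rewrite fsubst_inst; apply: AllE; first exact: term_in_subst.
  exact: IH hs.
- by move=> G t ht s hs; apply: EqI; apply: term_in_subst.
- move=> G p t u hp _ IH1 _ IH2 s hs; rewrite fsubst_inst.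
  apply: EqE (IH1 _ hs) _; first by apply: form_in_subst => //; apply: term_in_up.
  by rewrite -fsubst_inst; apply: IH2.
Qed.

(** Each hypothesis is discharged by [ImpI], whose side condition explains the assumption that [G]
    lies in the language. *)
Lemma prv_cut L G G' p :
    (forall q, List.In q G -> form_in L q) -> (forall q, List.In q G -> prv L G' q) ->
  prv L G p -> prv L G' p.
Proof.
elim: G G' p => [|r G IH] G' p hG hd hp; first by apply: prv_weak hp _.
apply: ImpE (hd r _); last by left.
apply: IH; [by move=> q hq; apply: hG; right | by move=> q hq; apply: hd; right |].
by apply: ImpI => //; apply: hG; left.
Qed.

Lemma prv_exfalso L G p : form_in L p -> prv L G Bot -> prv L G p.
Proof. by move=> hp h; apply: RAA => //; apply: prv_weak h _ => q; right. Qed.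

(** * Semantics *)

(** Symbols are interpreted on lists of any length; arities are controlled by [form_in] alone. *)
Record structure : Type := Structure {
  dom :> Type;
  mfun : nat -> seq dom -> dom;
  mrel : nat -> seq dom -> Prop
}.

Fixpoint teval (M : structure) (rho : nat -> M) (t : term) : M :=
  match t with
  | Var x => rho x
  | Func f ts => mfun f (map (teval rho) ts)
  end.

Definition econs (M : Type) (d : M) (rho : nat -> M) (x : nat) : M :=
  if x is x'.+1 then rho x' else d.

Fixpoint sat (M : structure) (rho : nat -> M) (p : form) : Prop :=
  match p with
  | Bot => False
  | Eq t s => teval rho t = teval rho s
  | Rel r ts => mrel r (map (teval rho) ts)
  | Imp p q => sat rho p -> sat rho q
  | All p => forall d, sat (econs d rho) p
  end.

Section Semantics.

Variable M : structure.
Implicit Types (rho : nat -> M) (t : term) (p q : form).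

Lemma teval_below n rho rho' t :
  term_below n t -> (forall x, x < n -> rho x = rho' x) -> teval rho t = teval rho' t.
Proof.
elim/term_ind_list: t => [x|f ts IH] /= h e; first exact: e.
by congr mfun; apply: eq_map_in => t ht; apply: IH => //; move/allIn: h; apply.
Qed.

Lemma econs_below n rho rho' d :
  (forall x, x < n -> rho x = rho' x) -> forall x, x < n.+1 -> econs d rho x = econs d rho' x.
Proof. by move=> h [|x] //= /h. Qed.

Lemma sat_below n rho rho' p :
  form_below n p -> (forall x, x < n -> rho x = rho' x) -> sat rho p <-> sat rho' p.
Proof.
elim: p n rho rho' => [|t s|r ts|p IHp q IHq|p IHp] n rho rho' //=.
- by move=> /andP [h1 h2] e; rewrite (teval_below h1 e) (teval_below h2 e).
- move=> /allIn h e; suff -> : map (teval rho) ts = map (teval rho') ts by [].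
  by apply: eq_map_in => t /h ht; apply: teval_below ht e.
- by move=> /andP [h1 h2] e; rewrite (IHp n rho rho') // (IHq n rho rho').
- move=> h e; split=> H d; [apply/(IHp n.+1)|apply/(IHp n.+1)]; try exact: (H d);
  by [|move=> x lt; rewrite (econs_below d e)].
Qed.

Lemma sat_ext rho rho' p : rho =1 rho' -> sat rho p <-> sat rho' p.
Proof. by move=> e; apply: (@sat_below (form_code p).+1); rewrite ?form_below_code. Qed.

Lemma sat_sentence L rho rho' p : sentence L p -> sat rho p <-> sat rho' p.
Proof. by move=> /andP [_ h]; apply: sat_below h _. Qed.

Lemma teval_subst rho s t : teval rho (tsubst s t) = teval (fun x => teval rho (s x)) t.
Proof.
by elim/term_ind_list: t => //= f ts IH; rewrite -map_comp; congr mfun; apply: eq_map_in.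
Qed.

Lemma sat_subst rho s p : sat rho (fsubst s p) <-> sat (fun x => teval rho (s x)) p.
Proof.
elim: p rho s => [|t u|r ts|p IHp q IHq|p IHp] rho s //=.
- by rewrite !teval_subst.
- suff -> : map (teval rho) (map (tsubst s) ts) = map (teval (fun x => teval rho (s x))) ts by [].
  by rewrite -map_comp; apply: eq_map_in => t _; apply: teval_subst.
- by rewrite IHp IHq.
- have e d : (fun x => teval (econs d rho) (up s x)) =1 econs d (fun x => teval rho (s x)).
    by case=> [|x] //=; rewrite /up /= teval_subst.
  by split=> h d; [apply/(sat_ext _ (e d))/IHp | apply/IHp/(sat_ext _ (e d))].
Qed.

Lemma sat_inst rho p t : sat rho (inst p t) <-> sat (econs (teval rho t) rho) p.
Proof. by rewrite /inst sat_subst; apply: sat_ext => -[|x]. Qed.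

Theorem soundness L G p :
  prv L G p -> forall rho, (forall q, List.In q G -> sat rho q) -> sat rho p.
Proof.
elim=> {G p} /=.
- by move=> G p h rho; apply.
- by move=> G p q _ _ IH rho h hp; apply: IH => r [<-|/h].
- by move=> G p q _ IH1 _ IH2 rho h; apply: IH1 => //; apply: IH2.
- move=> G p _ _ IH rho h; apply: NNPP => np; apply: (IH rho) => r [<-|/h] //=.
- move=> G p _ IH rho h d; apply: IH => r /In_map [q -> /h hq].
  by apply/sat_subst; apply: hq.
- by move=> G p t _ _ IH rho h; apply/sat_inst; apply: IH.
- by [].
- move=> G p t s _ _ IH1 _ IH2 rho h; apply/sat_inst.
  by rewrite -IH1 //; apply/sat_inst; apply: IH2.
Qed.

End Semantics.

(** * Completeness *)

(** [T] may be infinite and may contain open formulas; their free variables act as constants, since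
    [AllI] shifts the hypotheses. *)
Definition ded (L : signature) (T : form -> Prop) (p : form) : Prop :=
  exists2 G, forall q, List.In q G -> T q & prv L G p.

Definition adjoin (T : form -> Prop) (p q : form) : Prop := T q \/ q = p.

Section Deduction.

Variable L : signature.
Implicit Types (T : form -> Prop) (p q : form).

Lemma ded_hyp T p : T p -> ded L T p.
Proof. by move=> h; exists [:: p] => [q [<-|]|] //; apply: Hyp; left. Qed.

Lemma ded_mono T T' p : (forall q, T q -> T' q) -> ded L T p -> ded L T' p.
Proof. by move=> h [G hG hp]; exists G => // q /hG /h. Qed.

Lemma prv_ded T p : prv L [::] p -> ded L T p.
Proof. by move=> h; exists [::]. Qed.

Lemma ded_prv T G p :
  (forall q, List.In q G -> form_in L q) -> (forall q, List.In q G -> ded L T q) ->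
  prv L G p -> ded L T p.
Proof.
move=> hin hd hp.
have [H hH h] : exists2 H, forall q, List.In q H -> T q & forall q, List.In q G -> prv L H q.
  elim: G hd {hin hp} => [|q G IH] hd; first by exists [::].
  have [r hr|H hH h] := IH; first by apply: hd; right.
  have [|K hK hq] := hd q; first by left.
  exists (K ++ H).
    by move=> r /In_cat [/hK|/hH].
  move=> r /= [<-|/h hr].
    by apply: prv_weak hq _ => s hs; apply/In_cat; left.
  by apply: prv_weak hr _ => s hs; apply/In_cat; right.
by exists H => //; apply: prv_cut hin h hp.
Qed.

Lemma ded_mp T p q : ded L T (Imp p q) -> ded L T p -> ded L T q.
Proof.
move=> [G hG hp] [H hH hq]; exists (G ++ H).
  by move=> r /In_cat [/hG|/hH].
apply: (ImpE (p := p)); first by apply: prv_weak hp _ => s hs; apply/In_cat; left.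
by apply: prv_weak hq _ => s hs; apply/In_cat; right.
Qed.

Lemma ded_imp T p q : form_in L p -> ded L (adjoin T p) q -> ded L T (Imp p q).
Proof.
move=> hp [G hG hq].
suff [H hH hs] : exists2 H, forall r, List.In r H -> T r &
    forall r, List.In r G -> List.In r (p :: H).
  by exists H => //; apply: ImpI => //; apply: prv_weak hq _.
elim: G hG {hq} => [|r G IH] hG; first by exists [::].
have [s hs|H hH h] := IH; first by apply: hG; right.
have [|Tr|->] := hG r; first by left.
  exists (r :: H) => [s [<-|/hH]|s [<-|/h [<-|hs]]] //=; by [left|right; left|right; right].
by exists H => // s [<-|/h] //; left.
Qed.

Lemma ded_neg T p : form_in L p -> ded L (adjoin T p) Bot -> ded L T (Neg p).
Proof. exact: ded_imp. Qed.

End Deduction.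

Section TermModel.

Variables (L : signature) (T : form -> Prop).
Hypothesis consT : ~ ded L T Bot.
Hypothesis maxT : forall p, form_in L p -> ded L T p \/ ded L T (Neg p).
(** The variable [k] names a counterexample to [All p] if there is one. With variables as Henkin
    witnesses the language needs no new constants. *)
Hypothesis henkT : forall p, form_in L p ->
  exists k, ded L T (Imp (inst p (Var k)) (All p)).

Local Notation D := (ded L T).

Lemma D_imp p q : form_in L p -> form_in L q -> D (Imp p q) <-> (D p -> D q).
Proof.
move=> hp hq; split; first exact: ded_mp.
move=> h; have [/h hDq|hn] := maxT hp.
  apply: ded_imp => //; apply: ded_mono hDq => r; by left.
apply: ded_imp => //.
have hB : ded L (adjoin T p) Bot.
  apply: (ded_mp (p := p)); first by apply: ded_mono hn => r; left.
  by apply: ded_hyp; right.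
by have [G hG hb] := hB; exists G => //; apply: prv_exfalso.
Qed.

Lemma D_all p : form_in L p -> D (All p) <-> forall t, term_in L t -> D (inst p t).
Proof.
move=> hp; split; first by move=> [G hG h] t ht; exists G => //; apply: AllE.
have [k hk] := henkT hp => /(_ (Var k) isT); exact: ded_mp.
Qed.

Lemma D_eq_subst p t s : form_in L p -> D (Eq t s) -> D (inst p t) -> D (inst p s).
Proof.
move=> hp [G hG h1] [H hH h2]; exists (G ++ H).
  by move=> r /In_cat [/hG|/hH].
apply: (EqE (t := t)) => //.
  by apply: prv_weak h1 _ => u hu; apply/In_cat; left.
by apply: prv_weak h2 _ => u hu; apply/In_cat; right.
Qed.

Lemma D_eq_refl t : term_in L t -> D (Eq t t).
Proof. by move=> ht; apply: prv_ded; apply: EqI. Qed.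

Lemma D_eq_sym t s : term_in L t -> term_in L s -> D (Eq t s) -> D (Eq s t).
Proof.
move=> ht hs h.
have := @D_eq_subst (Eq (Var 0) (tsubst shift t)) t s.
rewrite /inst /= !tsubst_scons_shift; apply => //; last exact: D_eq_refl.
by apply: term_in_subst.
Qed.

Lemma D_eq_trans t s u : term_in L t -> term_in L s -> term_in L u ->
  D (Eq t s) -> D (Eq s u) -> D (Eq t u).
Proof.
move=> ht hs hu h1 h2.
have := @D_eq_subst (Eq (tsubst shift t) (Var 0)) s u.
rewrite /inst /= !tsubst_scons_shift; apply => //.
by rewrite andbT; apply: term_in_subst.
Qed.

Lemma map_scons_shift t ts : map (tsubst (scons t Var)) (map (tsubst shift) ts) = ts.
Proof. by rewrite -map_comp; apply: map_id_in => u _ /=; rewrite tsubst_scons_shift. Qed.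

Lemma all_term_in_shift ts : all (term_in L) ts -> all (term_in L) (map (tsubst shift) ts).
Proof. by move=> /allIn h; apply/allIn => t /In_map [u -> /h]; apply: term_in_subst. Qed.

(** Congruence one argument at a time: the prefix [a] has been replaced already, and the condition
    on sizes preserves the arity. *)
Lemma replace_args (C : seq term -> Prop) n :
  (forall a b t s, (size a + size b).+1 = n -> all (term_in L) a -> all (term_in L) b ->
     term_in L t -> term_in L s -> D (Eq t s) -> C (a ++ t :: b) -> C (a ++ s :: b)) ->
  forall A (f g : A -> term) xs, size xs = n ->
    (forall x, List.In x xs -> [/\ term_in L (f x), term_in L (g x) & D (Eq (f x) (g x))]) ->
    C (map f xs) -> C (map g xs).
Proof.
move=> hC A f g xs.
suff H a : all (term_in L) a -> size a + size xs = n ->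
    (forall x, List.In x xs -> [/\ term_in L (f x), term_in L (g x) & D (Eq (f x) (g x))]) ->
    C (a ++ map f xs) -> C (a ++ map g xs).
  by move=> hs hxs; apply: (H [::]).
elim: xs a => //= x xs IH a ha hs h hc.
have [h1 h2 h3] := h x (or_introl erefl).
have hr y : List.In y xs -> term_in L (f y) by move=> hy; case: (h y (or_intror hy)).
rewrite -cat_rcons; apply: IH.
- by rewrite all_rcons h2.
- by rewrite size_rcons; lia.
- by move=> y hy; apply: h; right.
rewrite cat_rcons; apply: hC hc => //; first by rewrite size_map; lia.
by apply/allIn => u /In_map [y -> /hr].
Qed.

Lemma D_rel A (f g : A -> term) r xs : onth (rels L) r = Some (size xs) ->
    (forall x, List.In x xs -> [/\ term_in L (f x), term_in L (g x) & D (Eq (f x) (g x))]) ->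
  D (Rel r (map f xs)) -> D (Rel r (map g xs)).
Proof.
move=> hr; apply: (@replace_args (fun ts => D (Rel r ts)) (size xs)) => // a b t s hs ha hb ht hu h.
(* [Var 0] marks the place of the replacement, and the other arguments are shifted past it. *)
pose p := Rel r (map (tsubst shift) a ++ Var 0 :: map (tsubst shift) b).
have e u : inst p u = Rel r (a ++ u :: b).
  by rewrite /inst /= map_cat /= !map_scons_shift.
rewrite -!e; apply: D_eq_subst h.
by rewrite /= size_cat /= !size_map addnS hs hr eqxx all_cat /= !all_term_in_shift.
Qed.

Lemma D_func A (f g : A -> term) k xs : onth (funs L) k = Some (size xs) ->
    (forall x, List.In x xs -> [/\ term_in L (f x), term_in L (g x) & D (Eq (f x) (g x))]) ->
  D (Eq (Func k (map f xs)) (Func k (map g xs))).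
Proof.
move=> hk hx; have : term_in L (Func k (map f xs)).
  by rewrite /= size_map hk eqxx; apply/allIn => t /In_map [x -> /hx []].
(* Starting from reflexivity, the left-hand side is frozen as [t0], so that the replacement acts on
   the right-hand side only. *)
move=> /[dup] /D_eq_refl; move: {1 3 4}(Func k (map f xs)) => t0 + ht0.
apply: (@replace_args (fun ts => D (Eq t0 (Func k ts))) (size xs)) hx => //.
move=> a b t s hs ha hb ht hu h.
pose p := Eq (tsubst shift t0) (Func k (map (tsubst shift) a ++ Var 0 :: map (tsubst shift) b)).
have e u : inst p u = Eq t0 (Func k (a ++ u :: b)).
  by rewrite /inst /= map_cat /= !map_scons_shift tsubst_scons_shift.
rewrite -!e; apply: D_eq_subst h.
apply/andP; split; first exact: term_in_subst.
by rewrite /= size_cat /= !size_map addnS hs hk eqxx all_cat /= !all_term_in_shift.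
Qed.

(* Terms outside the language are read as the variable 0. *)
Let norm (t : term) : term := if term_in L t then t else Var 0.

Let norm_in t : term_in L (norm t).
Proof. by rewrite /norm; case: ifP. Qed.

Let tclass (t u : term) : Prop := term_in L u /\ D (Eq (norm t) u).

Definition term_dom : Type := {c : term -> Prop | exists t, c = tclass t}.

Let mk (t : term) : term_dom := exist _ (tclass t) (ex_intro _ t erefl).

Let rep (d : term_dom) : term := epsilon (inhabits (Var 0)) (sval d).

Let rep_mk t : term_in L t -> term_in L (rep (mk t)) /\ D (Eq t (rep (mk t))).
Proof.
move=> ht; have {2}-> : t = norm t by rewrite /norm ht.
apply: (@epsilon_spec _ _ (tclass t)); exists (norm t); split => //.
exact: D_eq_refl.
Qed.

Let mk_eq t u : term_in L t -> term_in L u -> mk t = mk u <-> D (Eq t u).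
Proof.
move=> ht hu; split.
  move=> e; have [h1 h2] := rep_mk ht; have [h3 h4] := rep_mk hu.
  by apply: D_eq_trans h2 _ => //; rewrite e; apply: D_eq_sym.
move=> h; have e : tclass t = tclass u.
  apply: functional_extensionality => v; apply: propositional_extensionality.
  rewrite /tclass /norm ht hu; split=> -[hv hd]; split=> //.
    by apply: D_eq_trans hd => //; apply: D_eq_sym.
  exact: D_eq_trans hd.
by rewrite /mk; move: (ex_intro _ t _) (ex_intro _ u _); rewrite e => h1 h2; congr exist; apply: proof_irrelevance.
Qed.

Let mk_surj d : exists2 t, term_in L t & d = mk t.
Proof.
case: d => c [t e]; exists (norm t) => //.
have e' : tclass t = tclass (norm t).
  by apply: functional_extensionality => v; rewrite /tclass {2}/norm norm_in.
by rewrite /mk; move: (ex_intro _ (norm t) _) (ex_intro _ t e); rewrite e e' => h1 h2; congr exist; apply: proof_irrelevance.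
Qed.

Definition term_model : structure :=
  @Structure term_dom (fun f ds => mk (Func f (map rep ds))) (fun r ds => D (Rel r (map rep ds))).

Let teval_mk (s : nat -> term) t : (forall x, term_in L (s x)) -> term_in L t ->
  teval (M := term_model) (fun x => mk (s x)) t = mk (tsubst s t).
Proof.
move=> hs; elim/term_ind_list: t => [x|f ts IH] //= /andP [/eqP hf /allIn hts].
have -> : map rep (map (teval (M := term_model) (fun x => mk (s x))) ts) = map (fun t => rep (mk (tsubst s t))) ts.
  by rewrite -map_comp; apply: eq_map_in => t ht /=; rewrite IH //; apply: hts.
have hst t : List.In t ts -> term_in L (tsubst s t) by move=> /hts; apply: term_in_subst.
apply/mk_eq.
- by rewrite /= size_map hf eqxx; apply/allIn => u /In_map [t -> /hst /rep_mk []].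
- by rewrite /= size_map hf eqxx; apply/allIn => u /In_map [t -> /hst].
apply: D_func => // t /hst ht; have [h1 h2] := rep_mk ht.
by split=> //; apply: D_eq_sym.
Qed.

(** The truth lemma, with a simultaneous substitution in the role of the assignment, so that the
    quantifier case can extend it by a representative of the new element. *)
Lemma term_model_sat (s : nat -> term) p : (forall x, term_in L (s x)) -> form_in L p ->
  sat (M := term_model) (fun x => mk (s x)) p <-> D (fsubst s p).
Proof.
elim: p s => [|t u|r ts|p IHp q IHq|p IHp] s hs //=.
- by move=> /andP [ht hu]; rewrite !teval_mk //; apply: mk_eq; apply: term_in_subst.
- move=> /andP [/eqP hr /allIn hts].
  have hst t : List.In t ts -> term_in L (tsubst s t) by move=> /hts; apply: term_in_subst.
  have -> : map rep (map (teval (M := term_model) (fun x => mk (s x))) ts) = map (fun t => rep (mk (tsubst s t))) ts.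
    by rewrite -map_comp; apply: eq_map_in => t ht /=; rewrite teval_mk //; apply: hts.
  split; apply: D_rel => // t /hst ht; have [h1 h2] := rep_mk ht; split=> //; exact: D_eq_sym.
- move=> /andP [hp hq]; rewrite IHp // IHq // D_imp //; exact: form_in_subst.
- move=> hp; rewrite D_all; last by apply: form_in_subst => //; apply: term_in_up.
  have e t : (fun x => mk (scons t s x)) =1 econs (mk t) (fun x => mk (s x)) by case.
  have e' t : inst (fsubst (up s) p) t = fsubst (scons t s) p.
    rewrite /inst fsubst_comp; apply: fsubst_ext => -[|x] //=.
    by rewrite /up /= tsubst_scons_shift.
  have hsc t : term_in L t -> forall x, term_in L (scons t s x) by move=> ht [|x] /=.
  split=> h.
    by move=> t ht; rewrite e' -IHp //; [apply/(@sat_ext term_model _ _ p (e t)); apply: h | apply: hsc].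
  move=> d; have [t ht ->] := mk_surj d.
  by apply/(@sat_ext term_model _ _ p (e t)); rewrite IHp //; [rewrite -e'; apply: h | apply: hsc].
Qed.

Lemma term_model_exists :
  exists (M : structure) (rho : nat -> M), forall p, form_in L p -> D p -> sat rho p.
Proof.
exists term_model, (fun x => mk (Var x)) => p hp hD.
by apply/term_model_sat; rewrite ?fsubst_Var.
Qed.

End TermModel.

Section Henkin.

Variables (L : signature) (T : form -> Prop).
Hypothesis sentT : forall p, T p -> sentence L p.
Hypothesis consT : ~ ded L T Bot.

(* The code of a formula exceeds its free variables, so it can serve as the
   index of a fresh one; the axioms for larger codes are the later ones. *)
Let hax (p : form) : form := Imp (inst p (Var (form_code p))) (All p).

Let T1 (n : nat) (q : form) : Prop :=
  T q \/ exists p, [/\ form_in L p, form_code p < n & q = hax p].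

Let hax_in p : form_in L p -> form_in L (hax p).
Proof. by move=> hp; rewrite /= hp form_in_inst. Qed.

Let T1_below n q : T1 n q -> form_below n q.
Proof.
move=> [/sentT /andP [_ h]|[p [hp lt ->]]]; first exact: form_below_mono h.
rewrite /=; apply/andP; split; last by apply: form_below_code; apply: ltnW.
apply: (@form_below_subst n); first exact: form_below_code.
by move=> [|x] //= /ltnW.
Qed.

Let fresh_all G p n : form_below n.+1 p -> (forall q, List.In q G -> form_below n q) ->
  prv L G (inst p (Var n)) -> prv L G (All p).
Proof.
move=> hp hG h; apply: AllI.
(* Sends the fresh variable to the one about to be bound and shifts all others; on [G], where [n]
   does not occur, it coincides with [shift]. *)
pose s x := if x == n then Var 0 else shift x.
have hs x : term_in L (s x) by rewrite /s; case: ifP.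
have := prv_subst hs h.
have -> : map (fsubst s) G = map (fsubst shift) G.
  apply: eq_map_in => q /hG hq; apply: fsubst_below hq _ => x lt.
  by rewrite /s; case: eqP lt => // ->; rewrite ltnn.
have -> // : fsubst s (inst p (Var n)) = p.
rewrite /inst fsubst_comp -[RHS]fsubst_Var; apply: fsubst_below hp _ => -[|x] /= lt.
  by rewrite /s eqxx.
by rewrite /s; case: eqP lt => // ->; rewrite ltnn.
Qed.

(** A refutation of the axiom for the formula [p] with code [n] proves [inst p (Var n)]. As the
    variable [n] is fresh for stage [n], generalization yields [All p], which implies the refuted
    axiom. *)
Let T1_cons n : ~ ded L (T1 n) Bot.
Proof.
elim: n => [|n IH] h.
  by apply: consT; apply: ded_mono h => q [//|[p []]].
have [[p [hp ep]]|no] := classic (exists p, form_in L p /\ form_code p = n); last first.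
  apply: IH; apply: ded_mono h => q [Tq|[p [hp lt ->]]]; first by left.
  right; exists p; split=> //; move: lt; rewrite ltnS leq_eqVlt => /orP [/eqP e|//].
  by case: no; exists p.
have {}h : ded L (T1 n) (Neg (hax p)).
  apply: ded_neg; first exact: hax_in.
  apply: ded_mono h => q [Tq|[p' [hp' lt ->]]]; first by left; left.
  move: lt; rewrite ltnS leq_eqVlt => /orP [/eqP e|lt]; last by left; right; exists p'.
  by right; congr hax; apply: form_code_inj; rewrite e.
have hi : form_in L (inst p (Var n)) by apply: form_in_inst.
have [G hG hn] := h.
have hGi q : List.In q G -> form_in L q.
  by move=> /hG [/sentT /andP [] //|[r [hr _ ->]]]; apply: hax_in.
apply: IH; exists G => //.
have ha : prv L G (inst p (Var n)).
  apply: RAA => //; apply: (ImpE (p := hax p)); first by apply: prv_weak hn _ => q; right.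
  rewrite /hax ep; apply: ImpI => //; apply: prv_exfalso => //.
  by apply: (ImpE (p := inst p (Var n))); apply: Hyp; [right; left | left].
have {}ha : prv L G (All p).
  apply: fresh_all ha; first by rewrite -ep; apply: form_below_code.
  by move=> q /hG /T1_below.
apply: (ImpE (p := hax p)) => //; rewrite /hax ep; apply: ImpI => //.
by apply: prv_weak ha _ => q; right.
Qed.

Let T1' (q : form) : Prop := exists n, T1 n q.

Let T1'_cons : ~ ded L T1' Bot.
Proof.
move=> [G hG h].
have [n hn] : exists n, forall q, List.In q G -> T1 n q.
  elim: G hG {h} => [|q G IH] hG; first by exists 0.
  have [r hr|n hn] := IH; first by apply: hG; right.
  have [|m hm] := hG q; first by left.
  exists (maxn n m) => r [<-|/hn]; last first.
    by move=> [Tr|[p [hp lt e]]]; [left | right; exists p; split=> //; lia].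
  case: hm => [Tr|[p [hp lt e]]]; [by left | right; exists p; split=> //; lia].
by apply: (@T1_cons n); exists G.
Qed.

(** Lindenbaum's construction: the formula with code [m] is added at stage [m] if this is
    consistent. *)
Let Fixpoint lind (n : nat) : form -> Prop :=
  if n is m.+1 then
    fun q => lind m q \/
      [/\ form_code q = m, form_in L q & ~ ded L (adjoin (lind m) q) Bot]
  else T1'.

Let lind_mono n m q : n <= m -> lind n q -> lind m q.
Proof. by move=> /subnK <-; elim: (m - n) => //= k IH /IH; left. Qed.

Let lind_cons n : ~ ded L (lind n) Bot.
Proof.
elim: n => [|n IH] //= h.
have [[p [e hp hc]]|no] := classic (exists p, [/\ form_code p = n, form_in L p & ~ ded L (adjoin (lind n) p) Bot]).
  apply: hc; apply: ded_mono h => q [hq|[eq _ _]]; [by left | right].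
  by apply: form_code_inj; rewrite e.
by apply: IH; apply: ded_mono h => q [//|hq]; case: no; exists q.
Qed.

Let T2 (q : form) : Prop := exists n, lind n q.

Let T2_cons : ~ ded L T2 Bot.
Proof.
move=> [G hG h].
have [n hn] : exists n, forall q, List.In q G -> lind n q.
  elim: G hG {h} => [|q G IH] hG; first by exists 0.
  have [r hr|n hn] := IH; first by apply: hG; right.
  have [|m hm] := hG q; first by left.
  exists (maxn n m) => r [<-|/hn hr']; [apply: lind_mono hm | apply: lind_mono hr']; lia.
by apply: (@lind_cons n); exists G.
Qed.

Theorem model_exists :
  exists (M : structure) (rho : nat -> M), forall p, T p -> sat rho p.
Proof.
have [||M [rho H]] := @term_model_exists L T2 T2_cons.
- move=> p hp; have [h|h] := classic (ded L (adjoin (lind (form_code p)) p) Bot).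
    right; apply: ded_neg => //; apply: ded_mono h => q [hq|]; last by right.
    by left; exists (form_code p).
  by left; apply: ded_hyp; exists (form_code p).+1; right.
- move=> p hp; exists (form_code p); apply: ded_hyp; exists 0; exists (form_code p).+1.
  by right; exists p.
exists M, rho => p Tp; apply: H; first by have /andP [] := sentT Tp.
by apply: ded_hyp; exists 0; exists 0; left.
Qed.

End Henkin.

(** Restricted to sentences because the construction of the model uses the free variables as
    witnesses. *)
Theorem completeness L G p :
  (forall q, List.In q G -> sentence L q) -> sentence L p ->
  (forall (M : structure) (rho : nat -> M), (forall q, List.In q G -> sat rho q) -> sat rho p) ->
  prv L G p.
Proof.
move=> hG hp h; apply: NNPP => np.
pose T q := List.In q (Neg p :: G).
have sT q : T q -> sentence L q.
  by move=> [<-|/hG //]; move/andP: hp => [h1 h2]; rewrite /sentence /= h1 h2.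
have [|M [rho hM]] := @model_exists L T sT.
  move=> [H hH hb]; apply: np; apply: RAA; first by have /andP [] := hp.
  exact: prv_weak hb hH.
have hp' : sat rho p by apply: h => q hq; apply: hM; right.
by have /= := hM (Neg p) (or_introl erefl); apply.
Qed.

(** * Translations *)

Lemma sat_And (M : structure) (rho : nat -> M) p q : sat rho (And p q) <-> sat rho p /\ sat rho q.
Proof. by rewrite /=; split=> [h|[? ?]]; [apply: NNPP => n; apply: h => ? ?; apply: n | apply]. Qed.

Lemma sat_Ex (M : structure) (rho : nat -> M) p : sat rho (Ex p) <-> exists d, sat (econs d rho) p.
Proof.
rewrite /=; split=> [h|[d hd] h]; last exact: (h d).
by apply: NNPP => n; apply: h => d hd; apply: n; exists d.
Qed.

Lemma sat_at_vars (M : structure) (rho : nat -> M) vs p :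
  sat rho (at_vars vs p) <-> sat (fun i => rho (nth 0 vs i)) p.
Proof. exact: sat_subst. Qed.

Lemma econs_foldr_lt (T : Type) (rho : nat -> T) (ds : seq T) d0 x :
  x < size ds -> foldr (@econs T) rho ds x = nth d0 ds x.
Proof. by elim: ds x => [|d ds IH] [|x] //=; apply: IH. Qed.

Lemma econs_foldr_ge (T : Type) (rho : nat -> T) (ds : seq T) x :
  foldr (@econs T) rho ds (x + size ds) = rho x.
Proof. by elim: ds => [|d ds IH] /=; rewrite ?addn0 // addnS. Qed.

Lemma map_econs_iota (T : Type) (rho : nat -> T) (ds : seq T) :
  map (foldr (@econs T) rho ds) (iota 0 (size ds)) = ds.
Proof.
case: ds => // d0 ds; apply: (@eq_from_nth _ d0); first by rewrite size_map size_iota.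
move=> i; rewrite size_map size_iota => hi.
by rewrite (nth_map 0) ?size_iota // nth_iota // (econs_foldr_lt _ d0).
Qed.

Lemma sat_exs (M : structure) (rho : nat -> M) I k p :
    (forall rho' : nat -> M, sat rho' (tr_dom I)) ->
  sat rho (exs I k p) <-> exists2 ds, size ds = k & sat (foldr (@econs M) rho ds) p.
Proof.
move=> hI; elim: k rho => [|k IH] rho.
  by split=> [h|[[|d ds]] //]; exists [::].
change (exs I k.+1 p) with (Ex (And (tr_dom I) (exs I k p))); rewrite sat_Ex; split.
  (* The outermost quantifier binds the variable with the highest index, hence its value comes
     last. *)
  move=> [d /sat_And [_ /IH [ds hs h]]]; exists (rcons ds d); first by rewrite size_rcons hs.
  by rewrite foldr_rcons.
move=> [ds]; case/lastP: ds => // ds d; rewrite size_rcons foldr_rcons => -[hs] h.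
by exists d; apply/sat_And; split; [apply: hI | apply/IH; exists ds].
Qed.

Definition arity (ks : seq nat) (i : nat) : nat := odflt 0 (onth ks i).

Definition id_tr (L : signature) : translation :=
  {| tr_dom := Top;
     tr_eq := Eq (Var 0) (Var 1);
     tr_rel r := Rel r (map Var (iota 0 (arity (rels L) r)));
     tr_fun f := let k := arity (funs L) f in Eq (Func f (map Var (iota 0 k))) (Var k) |}.

Lemma tr_form_Eq I t u :
  tr_form I (Eq t u) = exs I 2 (And (And (tr_val I (addn 2) t 0) (tr_val I (addn 2) u 1))
    (at_vars [:: 0; 1] (tr_eq I))).
Proof. by []. Qed.

Section Identity.

Variables (L : signature) (M : structure).
Implicit Types (rho : nat -> M) (t : term).

Lemma sat_exs_id rho k p :
  sat rho (exs (id_tr L) k p) <-> exists2 ds, size ds = k & sat (foldr (@econs M) rho ds) p.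
Proof. by apply: sat_exs => rho' /=. Qed.

Lemma sat_args R (g : term -> nat -> form) (v : term -> M) ts m :
    (forall t y, List.In t ts -> sat R (g t y) <-> R y = v t) ->
  sat R (conjs [seq p.1 p.2 | p <- zip (map g ts) (iota m (size ts))]) <->
  map R (iota m (size ts)) = map v ts.
Proof.
elim: ts m => [|t ts IH] m h; first by split=> // _ /= [].
rewrite [zip _ _]/= [map _ (_ :: _)]/=.
change (conjs (?p :: ?ps)) with (And p (conjs ps)); rewrite sat_And IH; last first.
  by move=> u y hu; apply: h; right.
rewrite h /=; last by left.
by split=> [[-> ->]|[]].
Qed.

Lemma map_nth_rcons_iota (T : Type) (R : nat -> T) k z :
  map (fun i => R (nth 0 (rcons (iota 0 k) z) i)) (iota 0 k) = map R (iota 0 k).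
Proof.
apply/eq_in_map => i; rewrite mem_iota add0n /= => hi.
by rewrite nth_rcons size_iota hi nth_iota.
Qed.

Lemma teval_Vars (R : nat -> M) s : map (teval R) (map Var s) = map R s.
Proof. by rewrite -map_comp. Qed.

Lemma sat_tr_val rho s t y : term_in L t ->
  sat rho (tr_val (id_tr L) s t y) <-> rho y = teval (fun x => rho (s x)) t.
Proof.
elim/term_ind_list: t rho s y => [x|f ts IH] rho s y /=.
  by move=> _; split=> ->.
move=> /andP [/eqP hf /allIn hts]; rewrite sat_exs_id.
(* The quantified elements [ds] are forced to be the values of the arguments, so the unnested
   formula says that [f] applied to these values is the value of [y]. *)
have key ds : size ds = size ts -> forall R, R = foldr (@econs M) rho ds ->
    sat R (And (conjs [seq p.1 p.2 | p <- zip [seq tr_val (id_tr L) (fun x => s x + size ts) i | i <- ts] (iota 0 (size ts))])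
      (at_vars (rcons (iota 0 (size ts)) (y + size ts)) (tr_fun (id_tr L) f))) <->
    ds = map (teval (fun x => rho (s x))) ts /\ mfun f ds = rho y.
  move=> hs R eR; rewrite sat_And sat_at_vars.
  rewrite (sat_args (v := teval (fun x => rho (s x)))); last first.
    move=> t y' ht; rewrite IH //; last exact: hts.
    suff -> : teval (fun x => R (s x + size ts)) t = teval (fun x => rho (s x)) t by [].
    by apply: (@teval_below _ (term_code t).+1); rewrite ?term_below_code // => x _; rewrite eR -hs econs_foldr_ge.
  rewrite [tr_fun _ _]/= /arity hf [odflt _ _]/= [sat _ _]/= teval_Vars map_nth_rcons_iota.
  have -> : map R (iota 0 (size ts)) = ds by rewrite eR -hs map_econs_iota.
  rewrite nth_rcons size_iota ltnn eqxx.
  by have -> : R (y + size ts) = rho y by rewrite eR -hs econs_foldr_ge.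
split.
  by move=> [ds hs /(key ds hs _ erefl) [<- ->]].
move=> e; exists (map (teval (fun x => rho (s x))) ts); first by rewrite size_map.
by apply/(key _ _ _ erefl); rewrite ?size_map.
Qed.

(** The translation only unnests terms and relativizes to the trivial domain, neither of which
    affects truth. *)
Lemma sat_tr_form rho p : form_in L p -> sat rho (tr_form (id_tr L) p) <-> sat rho p.
Proof.
elim: p rho => [|t u|r ts|p IHp q IHq|p IHp] rho.
- by [].
- move=> /andP [ht hu]; rewrite tr_form_Eq sat_exs_id [sat rho (Eq t u)]/=.
  have e ds t' : term_in L t' -> size ds = 2 ->
     teval (fun x => foldr (@econs M) rho ds (2 + x)) t' = teval rho t'.
    move=> ht' hs; apply: (@teval_below _ (term_code t').+1); rewrite ?term_below_code // => x _.
    by rewrite addnC -hs econs_foldr_ge.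
  split.
    move=> [ds hs]; rewrite !sat_And !sat_tr_val // !e // => -[[<- <-]].
    by rewrite sat_at_vars.
  move=> h; exists [:: teval rho t; teval rho u] => //.
  by rewrite !sat_And !sat_tr_val // !e // sat_at_vars.
- move=> /= /andP [/eqP hr /allIn hts]; rewrite sat_exs_id.
  have key ds : size ds = size ts -> forall R, R = foldr (@econs M) rho ds ->
      sat R (And (conjs [seq p.1 p.2 | p <- zip [seq tr_val (id_tr L) (addn (size ts)) i | i <- ts] (iota 0 (size ts))])
        (at_vars (iota 0 (size ts)) (tr_rel (id_tr L) r))) <->
      ds = map (teval rho) ts /\ mrel r ds.
    move=> hs R eR; rewrite sat_And sat_at_vars.
    rewrite (sat_args (v := teval rho)); last first.
      move=> t y' ht; rewrite sat_tr_val //; last exact: hts.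
      suff -> : teval (fun x => R (size ts + x)) t = teval rho t by [].
      by apply: (@teval_below _ (term_code t).+1); rewrite ?term_below_code // => x _; rewrite eR addnC -hs econs_foldr_ge.
    rewrite [tr_rel _ _]/= /arity hr [odflt _ _]/= [sat _ _]/= teval_Vars.
    have -> : map (fun i => R (nth 0 (iota 0 (size ts)) i)) (iota 0 (size ts)) = map R (iota 0 (size ts)).
      by apply/eq_in_map => i; rewrite mem_iota add0n /= => hi; rewrite nth_iota.
    by rewrite eR -hs map_econs_iota.
  split.
    by move=> [ds hs /(key ds hs _ erefl) [<-]].
  move=> e; exists (map (teval rho) ts); first by rewrite size_map.
  by apply/(key _ _ _ erefl); rewrite ?size_map.
- by move=> /= /andP [hp hq]; rewrite IHp // IHq.
- by move=> /= hp; split=> h d; [apply/IHp => //; apply: h | move=> _; apply/IHp].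
Qed.

End Identity.

Section Wellformed.

Variables (L N : signature) (I : translation).
Hypothesis okI : translation_ok L N I.

Lemma form_in_exs k p : form_in N p -> form_in N (exs I k p).
Proof.
by move=> hp; elim: k => [|k IH] //; rewrite /= IH !andbT; case: okI => /andP [].
Qed.

Lemma form_below_exs k n p : form_below (n + k) p -> form_below n (exs I k p).
Proof.
elim: k n => [|k IH] n; first by rewrite addn0.
rewrite addnS -addSn => /IH h; rewrite /= h !andbT.
by case: okI => /andP [_ /form_below_mono hd] _ _ _; apply: hd.
Qed.

Lemma form_in_conjs ps : (forall p, List.In p ps -> form_in N p) -> form_in N (conjs ps).
Proof.
elim: ps => [|p ps IH] //= h; rewrite !andbT; apply/andP; split; first by apply: h; left.
by apply: IH => q hq; apply: h; right.
Qed.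

Lemma form_below_conjs n ps : (forall p, List.In p ps -> form_below n p) -> form_below n (conjs ps).
Proof.
elim: ps => [|p ps IH] //= h; rewrite !andbT; apply/andP; split; first by apply: h; left.
by apply: IH => q hq; apply: h; right.
Qed.

Lemma form_in_at_vars vs p : form_in N p -> form_in N (at_vars vs p).
Proof. exact: form_in_subst. Qed.

Lemma form_below_at_vars n m vs p : (forall i, i < m -> nth 0 vs i < n) ->
  form_below m p -> form_below n (at_vars vs p).
Proof. by move=> h hp; apply: form_below_subst hp _. Qed.

Lemma In_zip_map (g : term -> nat -> form) ts m k p :
  List.In p [seq q.1 q.2 | q <- zip (map g ts) (iota m k)] ->
  exists2 t, List.In t ts & exists2 i, i < m + k & p = g t i.
Proof.
elim: ts m k => [|t ts IH] m [|k] //= [<-|/IH [u hu [i hi ->]]].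
  by exists t; [left | exists m => //; lia].
by exists u; [right | exists i => //; lia].
Qed.

Lemma form_in_tr_val s t y : term_in L t -> form_in N (tr_val I s t y).
Proof.
elim/term_ind_list: t s y => [x|f ts IH] s y /=.
  by move=> _; apply: form_in_at_vars; case: okI => _ /andP [].
move=> /andP [/eqP hf /allIn hts]; apply: form_in_exs; rewrite /= !andbT; apply/andP; split.
  by apply: form_in_conjs => p /In_zip_map [t ht [i _ ->]]; apply: IH => //; apply: hts.
by apply: form_in_at_vars; case: okI => _ _ _ /(_ _ _ hf) /andP [].
Qed.

Lemma form_below_tr_val n m s t y : term_in L t -> term_below m t ->
  (forall x, x < m -> s x < n) -> y < n -> form_below n (tr_val I s t y).
Proof.
elim/term_ind_list: t n s y => [x|f ts IH] n s y /=.
  move=> _ hx hs hy; apply: (@form_below_at_vars n 2); first by move=> [|[|]] //= _; apply: hs.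
  by case: okI => _ /andP [].
move=> /andP [/eqP hf /allIn hts] /allIn hb hs hy; apply: form_below_exs; rewrite /= !andbT; apply/andP; split.
  apply: form_below_conjs => p /In_zip_map [t ht [i hi ->]]; apply: IH => //; try by [apply: hts|apply: hb].
    by move=> x /hs; rewrite ltn_add2r.
  by lia.
case: okI => _ _ _ /(_ _ _ hf) /andP [_ h]; apply: form_below_at_vars h => i hi.
rewrite nth_rcons size_iota; case: (ltnP i (size ts)) => lt; first by rewrite nth_iota; lia.
by case: eqP; lia.
Qed.

Lemma form_in_tr p : form_in L p -> form_in N (tr_form I p).
Proof.
elim: p => [|t u|r ts|p IHp q IHq|p IHp] //; rewrite ?tr_form_Eq [form_in L _]/=.
- move=> /andP [ht hu]; apply: form_in_exs.
  rewrite /= !form_in_tr_val //= andbT.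
  by rewrite form_in_at_vars //; case: okI => _ /andP [].
- move=> /andP [/eqP hf /allIn hts]; apply: form_in_exs; rewrite /= !andbT; apply/andP; split.
    by apply: form_in_conjs => p /In_zip_map [t ht [i _ ->]]; apply: form_in_tr_val; apply: hts.
  by apply: form_in_at_vars; case: okI => _ _ /(_ _ _ hf) /andP [].
- by move=> /andP [/IHp h1 /IHq h2]; rewrite /= h1.
- by move=> /IHp h; rewrite /= h andbT; case: okI => /andP [].
Qed.

Lemma form_below_tr n p : form_in L p -> form_below n p -> form_below n (tr_form I p).
Proof.
elim: p n => [|t u|r ts|p IHp q IHq|p IHp] n //;
  rewrite ?tr_form_Eq [form_in L _]/= [X in _ -> is_true X -> _]/=.
- move=> /andP [ht hu] /andP [hbt hbu]; apply: form_below_exs.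
  have hs x : x < n -> 2 + x < n + 2 by lia.
  rewrite /= !(form_below_tr_val (m := n)) //=; try lia.
  rewrite andbT (@form_below_at_vars _ 2) //; first by move=> [|[|]] //=; lia.
  by case: okI => _ /andP [].
- move=> /andP [/eqP hf /allIn hts] /allIn hb; apply: form_below_exs; rewrite /= !andbT; apply/andP; split.
    apply: form_below_conjs => p /In_zip_map [t ht [i hi ->]].
    by apply: (form_below_tr_val (m := n)); [apply: hts | apply: hb | move=> x; lia | lia].
  case: okI => _ _ /(_ _ _ hf) /andP [_ h] _; apply: form_below_at_vars h => i hi.
  by rewrite nth_iota; lia.
- by move=> /andP [h1 h2] /andP [h3 h4]; rewrite /= IHp // IHq.
- move=> h1 h2; rewrite /= IHp // andbT; case: okI => /andP [_ /form_below_mono hd] _ _ _; exact: hd.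
Qed.

Lemma sentence_tr p : sentence L p -> sentence N (tr_form I p).
Proof. by move=> /andP [h1 h2]; rewrite /sentence form_in_tr // form_below_tr. Qed.

End Wellformed.

Definition sig_incl (L N : signature) : Prop :=
  (forall i k, onth (funs L) i = Some k -> onth (funs N) i = Some k) /\
  (forall i k, onth (rels L) i = Some k -> onth (rels N) i = Some k).

Lemma id_tr_ok L N : sig_incl L N -> translation_ok L N (id_tr L).
Proof.
move=> [hf hr]; have hall (P : pred nat) k : (forall i, i < k -> P i) -> all P (iota 0 k).
  by move=> h; apply/allP => i; rewrite mem_iota add0n => /h.
split=> //.
  move=> r k e; rewrite /= /arity e /= size_map size_iota (hr _ _ e) eqxx /= !all_map.
  by rewrite !hall.
move=> f k e; rewrite /= /arity e /= size_map size_iota (hf _ _ e) eqxx /= !all_map.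
by rewrite !hall //= ?ltnSn // => i /ltnW.
Qed.

Lemma term_in_incl L N t : sig_incl L N -> term_in L t -> term_in N t.
Proof.
move=> [hf _]; elim/term_ind_list: t => [x|f ts IH] //= /andP [/eqP /hf -> /allIn h].
by rewrite eqxx; apply/allIn => t ht; apply: IH => //; apply: h.
Qed.

Lemma form_in_incl L N p : sig_incl L N -> form_in L p -> form_in N p.
Proof.
move=> hi; elim: p => [|t u|r ts|p IHp q IHq|p IHp] //=.
- by move=> /andP [h1 h2]; rewrite !(term_in_incl hi).
- case: (hi) => _ hr /andP [/eqP /hr -> /allIn h]; rewrite eqxx.
  by apply/allIn => t /h; apply: term_in_incl.
- by move=> /andP [/IHp h1 /IHq h2]; rewrite /= h1.
Qed.

Lemma sentence_incl L N p : sig_incl L N -> sentence L p -> sentence N p.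
Proof. by move=> hi /andP [h1 h2]; rewrite /sentence (form_in_incl hi). Qed.

(** The identity translation of a theorem is a different formula, equivalent to it in every
    structure; completeness makes it derivable from that theorem, and [B] is deductively closed. *)
Theorem interpretable_extension (A B : theory) :
  sig_incl (sig A) (sig B) -> (forall p, thm A p -> thm B p) -> interpretable A B.
Proof.
move=> hi h; exists (id_tr (sig A)); split; first exact: id_tr_ok.
move=> p hp; have sp := thm_sentence hp.
have st : sentence (sig B) (tr_form (id_tr (sig A)) p) by apply: sentence_tr sp; apply: id_tr_ok.
apply: (@thm_closed B [:: p]) => //; first by move=> q [<-|] //; apply: h.
apply: completeness => //.
  by move=> q [<-|] //; apply: sentence_incl sp.
move=> M rho hM; apply/sat_tr_form; first by case/andP: sp.
by apply: hM; left.
Qed.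

(** * The theory of a finite structure is r.e. *)

Definition model_thm (L : signature) (M : structure) (rho : nat -> M) (p : form) : Prop :=
  sentence L p /\ sat rho p.

Lemma model_thm_closed L (M : structure) (rho : nat -> M) G p :
  (forall q, List.In q G -> model_thm L rho q) -> sentence L p -> prv L G p -> model_thm L rho p.
Proof. by move=> h sp hp; split=> //; apply: soundness hp _ _ => q /h []. Qed.

Definition model_theory L (M : structure) (rho : nat -> M) : theory :=
  @Theory L (model_thm L rho) (fun p h => proj1 h) (@model_thm_closed L M rho).

Lemma finite_lists N k :
  exists s : seq nat, forall l, size l <= k -> all (fun x => x < N) l -> seq_code l \in s.
Proof.
elim: k => [|k [s hs]]; first by exists [:: 0] => -[|x l].
exists (0 :: [seq (npair x y).+1 | x <- iota 0 N, y <- s]) => -[|x l] //= hl /andP [hx hall].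
rewrite inE; apply/orP; right; apply/allpairsP; exists (x, seq_code l); split=> //=.
  by rewrite mem_iota.
exact: hs.
Qed.

Definition jtv := jpat 1.
Definition jtvl := jpat 2.
Definition jsat e p := jpat 3 e p (PN 0).
Definition juns e p := jpat 4 e p (PN 0).
Definition jalls := jpat 5.
Definition jfun := jpat 6.
Definition jrelt r vs := jpat 7 r vs (PN 0).
Definition jrelf r vs := jpat 8 r vs (PN 0).
Definition jeqt v w := jpat 9 v w (PN 0).
Definition jeqf v w := jpat 10 v w (PN 0).
Definition jdom v := jpat 11 v (PN 0) (PN 0).

(* Truth and falsity in a structure with elements numbered below [N], whose
   tables are the judgements with tags 6 to 11. *)
Definition sat_clauses (N : nat) : seq clause :=
  let e := PV 0 in let x := PV 1 in let v := PV 2 in let w := PV 3 in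
  let t := PV 4 in let u := PV 5 in let ts := PV 6 in let vs := PV 7 in
  let f := PV 8 in let p := PV 9 in let q := PV 10 in
  [:: (jnth (pcons v e) (PN 0) v, [::]);
      (jnth (pcons w e) (PS x) v, [:: jnth e x v]);
      (* 2 *) (jtv e (pvar x) v, [:: jnth e x v]);
      (jtv e (pfunc f ts) v, [:: jtvl e ts vs; jfun f vs v]);
      (* 4 *) (jtvl e (PN 0) (PN 0), [::]);
      (jtvl e (pcons t ts) (pcons v vs), [:: jtv e t v; jtvl e ts vs]);
      (* 6 *) (jsat e (peq t u), [:: jtv e t v; jtv e u w; jeqt v w]);
      (juns e (peq t u), [:: jtv e t v; jtv e u w; jeqf v w]);
      (* 8 *) (jsat e (prel f ts), [:: jtvl e ts vs; jrelt f vs]);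
      (juns e (prel f ts), [:: jtvl e ts vs; jrelf f vs]);
      (* 10 *) (juns e pbot, [::]);
      (jsat e (pimp p q), [:: juns e p]);
      (jsat e (pimp p q), [:: jsat e q]);
      (juns e (pimp p q), [:: jsat e p; juns e q]);
      (* 14 *) (jalls e p (PN 0), [::]);
      (jalls e p (PS x), [:: jalls e p x; jsat (pcons x e) p]);
      (jsat e (pall p), [:: jalls e p (PN N)]);
      (juns e (pall p), [:: jdom x; juns (pcons x e) p])].

Section FiniteModel.

Variables (L : signature) (M : structure) (rho0 : nat -> M) (ds : seq M).
Hypothesis ds_all : forall d, List.In d ds.

Let N := size ds.
(** The list [ds] may repeat elements, so one element may have several numbers; this is why equality
    of numbers is given by tables too. *)
Let dec (i : nat) : M := nth (rho0 0) ds i.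

Let dec_surj d : exists2 i, i < N & dec i = d.
Proof.
rewrite /dec /N; elim: ds (ds_all d) => //= d' s IH [->|/IH [i hi <-]]; first by exists 0.
by exists i.+1.
Qed.

Let below (l : seq nat) : bool := all (fun x => x < N) l.

(** Confined to the symbols of [L] with their arities and to numbers below [N], the tables form a
    finite set, hence a semidecidable one, however [mfun] and [mrel] behave. *)
Let base (n : nat) : Prop :=
  let a := nfst (nsnd n) in let b := nfst (nsnd (nsnd n)) in let c := nsnd (nsnd (nsnd n)) in
  match nfst n with
  | 6 => exists l, [/\ seq_code l = b, onth (funs L) a = Some (size l), below l, c < N
           & mfun a (map dec l) = dec c]
  | 7 => exists l, [/\ seq_code l = b, onth (rels L) a = Some (size l), below l, c = 0
           & mrel a (map dec l)]
  | 8 => exists l, [/\ seq_code l = b, onth (rels L) a = Some (size l), below l, c = 0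
           & ~ mrel a (map dec l)]
  | 9 => [/\ a < N, b < N, c = 0 & dec a = dec b]
  | 10 => [/\ a < N, b < N, c = 0 & dec a <> dec b]
  | 11 => [/\ a < N, b = 0 & c = 0]
  | _ => False
  end.

Let onth_some (s : seq nat) i k : onth s i = Some k -> i < size s /\ k \in s.
Proof.
elim: s i => [|x s IH] [|i] //= h; first by case: h => ->; rewrite inE eqxx.
by have [h1 h2] := IH _ h; split=> //; rewrite inE h2 orbT.
Qed.

Let S1_base : S1 base.
Proof.
(* A bound on all arities of [L], hence on the lengths of the argument lists in the tables. *)
pose K := sumn (funs L) + sumn (rels L).
have hK k : k \in funs L \/ k \in rels L -> k <= K.
  have h s : k \in s -> k <= sumn s.
    by elim: s => //= x s IH; rewrite inE => /orP [/eqP ->|/IH]; lia.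
  by rewrite /K => -[/h|/h]; lia.
have [s hs] := finite_lists N K.
(* The first argument of a fact is either an element number or the position of a symbol. *)
pose A := maxn N (maxn (size (funs L)) (size (rels L))).
pose s3 := [seq npair b c | b <- 0 :: s ++ iota 0 N, c <- 0 :: iota 0 N].
pose s2 := [seq npair a z | a <- 0 :: iota 0 A, z <- s3].
apply: (@S1_finite _ [seq npair tag z | tag <- iota 0 12, z <- s2]) => n hn.
have h3 b c : b \in 0 :: s ++ iota 0 N -> c \in 0 :: iota 0 N -> npair b c \in s3.
  by move=> hb hc; apply/allpairsP; exists (b, c).
have h2 a z : a < A \/ a = 0 -> z \in s3 -> npair a z \in s2.
  move=> ha hz; apply/allpairsP; exists (a, z); split => //=.
  by rewrite inE mem_iota add0n /=; case: ha => [->|->]; rewrite ?orbT.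
rewrite -(npair_eta n); apply/allpairsP; exists (nfst n, nsnd n); split=> //.
  rewrite mem_iota [fst _]/=; move: hn; rewrite /base; case: (nfst n) => //.
  by do 12 (case=> //).
rewrite [snd _]/= -(npair_eta (nsnd n)) -(npair_eta (nsnd (nsnd n))).
have hin l : seq_code l \in s -> seq_code l \in 0 :: s ++ iota 0 N.
  by move=> h; rewrite inE mem_cat h orbT.
have hN b : b < N -> b \in 0 :: s ++ iota 0 N.
  by move=> h; rewrite inE mem_cat mem_iota h !orbT.
have hN' b : b < N -> b \in 0 :: iota 0 N.
  by move=> h; rewrite inE mem_iota h !orbT.
have hA (a : nat) : a < N -> a < A \/ a = 0 by rewrite /A; lia.
move: hn; rewrite /base.
move: (nfst (nsnd n)) (nfst (nsnd (nsnd n))) (nsnd (nsnd (nsnd n))) => a b c.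
case: (nfst n) => //; do 5 (case=> //).
  case.
    move=> [l [<- /onth_some [e1 e2] hl hc _]]; apply: h2; first by rewrite /A; lia.
    by apply: h3; [apply: hin; apply: hs => //; apply: hK; left | apply: hN'].
case.
  move=> [l [<- /onth_some [e1 e2] hl -> _]]; apply: h2; first by rewrite /A; lia.
  by apply: h3; [apply: hin; apply: hs => //; apply: hK; right |].
case.
  move=> [l [<- /onth_some [e1 e2] hl -> _]]; apply: h2; first by rewrite /A; lia.
  by apply: h3; [apply: hin; apply: hs => //; apply: hK; right |].
case; first by move=> [ha hb -> _]; apply: h2; [apply: hA | apply: h3; [apply: hN |]].
case; first by move=> [ha hb -> _]; apply: h2; [apply: hA | apply: h3; [apply: hN |]].
case=> // -[ha -> ->]; apply: h2; [exact: hA | exact: h3].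
Qed.

Let denv (e : seq nat) (x : nat) : M := dec (nth 0 e x).

Let denv_cons j e : denv (j :: e) =1 econs (dec j) (denv e).
Proof. by case. Qed.

Let meaning (n : nat) : Prop :=
  let a := nfst (nsnd n) in let b := nfst (nsnd (nsnd n)) in let c := nsnd (nsnd (nsnd n)) in
  match nfst n with
  | 0 => forall s, seq_code s = a -> nth 0 s b = c
  | 1 => forall e t, seq_code e = a -> term_code t = b -> teval (denv e) t = dec c
  | 2 => forall e ts, seq_code e = a -> seq_code (map term_code ts) = b ->
           map (teval (denv e)) ts = map dec (seq_decode c)
  | 3 => forall e p, seq_code e = a -> form_code p = b -> sat (denv e) p
  | 4 => forall e p, seq_code e = a -> form_code p = b -> ~ sat (denv e) p
  | 5 => forall e p, seq_code e = a -> form_code p = b -> forall j, j < c -> sat (denv (j :: e)) p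
  | _ => base n
  end.

Let sgen := gen base (sat_clauses N).

Let sat_sound n : sgen n -> meaning n.
Proof.
have hdec x l : seq_decode (npair x l).+1 = x :: seq_decode l.
  by apply: seq_code_inj; rewrite /= !seq_decodeK.
apply: gen_ind_clauses => [{}n|].
  by rewrite /meaning /base; case: (nfst n) => //; do 5 (case=> //).
rewrite [foldr _ _ _]/= /meaning; split_clauses => r; rewrite /base !npE;
 move: (nth 0 r 0) (nth 0 r 1) (nth 0 r 2) (nth 0 r 3) (nth 0 r 4) (nth 0 r 5) (nth 0 r 6)
  (nth 0 r 7) (nth 0 r 8) (nth 0 r 9) (nth 0 r 10)
 => e x v w t u ts vs f p q {r}; rewrite ?npE.
- by move=> [|y l] //= [/npair_inj [-> _]].
- by move=> h1 [|y l] //= [/npair_inj [_ /h1]].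
- by move=> h1 e' [y|f' ts'] /= ee et; npinv=> //; subst; rewrite /denv h1.
- move=> h1 [l [el _ _ _ h2]] e' [y|f' ts'] /= ee et; npinv=> //; subst.
  by rewrite (h1 e' ts') // seq_codeK.
- move=> e' [] //= _ _; have -> : seq_decode 0 = [::] by apply: seq_code_inj; rewrite seq_decodeK.
  by [].
- move=> h1 h2 e' [|t' ts'] //= ee [/npair_inj [et ets]].
  by rewrite hdec /= (h1 e' t') // (h2 e' ts').
- move=> h1 h2 [_ _ _ h3] e' [|t1 t2|??|??|?] //= ee et; npinv=> //.
  by rewrite (h1 e' t1) // (h2 e' t2).
- move=> h1 h2 [_ _ _ h3] e' [|t1 t2|??|??|?] //= ee et; npinv=> //.
  by rewrite (h1 e' t1) // (h2 e' t2).
- move=> h1 [l [el _ _ _ h2]] e' [|t1 t2|f' ts'|??|?] //= ee et; npinv=> //; subst.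
  by rewrite (h1 e' ts') // seq_codeK.
- move=> h1 [l [el _ _ _ h2]] e' [|t1 t2|f' ts'|??|?] //= ee et; npinv=> //; subst.
  by rewrite (h1 e' ts') // seq_codeK.
- by move=> e' [|t1 t2|f' ts'|??|?] //= ee et; npinv.
- move=> h1 e' [|t1 t2|f' ts'|p1 q1|?] //= ee et; npinv=> //.
  by move=> h; case: (h1 e' p1).
- move=> h1 e' [|t1 t2|f' ts'|p1 q1|?] //= ee et; npinv=> // _; exact: h1.
- move=> h1 h2 e' [|t1 t2|f' ts'|p1 q1|?] //= ee et; npinv=> // h.
  by apply: (h2 e' q1) => //; apply: h; apply: h1.
- by [].
- move=> h1 h2 e' p' ee ep j; rewrite ltnS leq_eqVlt => /orP [/eqP ->|]; last exact: h1.
  by apply: h2 => //=; rewrite ee.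
- move=> h1 e' [|t1 t2|f' ts'|p1 q1|p1] //= ee et; npinv=> // d.
  by have [j hj <-] := dec_surj d; apply/(sat_ext _ (denv_cons j e')); apply: h1.
- move=> [hx _ _] h1 e' [|t1 t2|f' ts'|p1 q1|p1] //= ee et; npinv=> // h.
  apply: (h1 (x :: e') p1) => //=; first by rewrite ee.
  by apply/(sat_ext _ (denv_cons x e')).
Qed.

Let J (tag a b c : nat) : Prop := sgen (npair tag (npair a (npair b c))).

Let J_base tag a b c : base (npair tag (npair a (npair b c))) -> J tag a b c.
Proof. exact: gen_base. Qed.

Let J_nth e x : x < size e -> J 0 (seq_code e) x (nth 0 e x).
Proof.
have R i r h := @gen_clause base (sat_clauses N) i r h.
elim: e x => [|v e IH] [|x] //= h; first exact: (R 0 [:: seq_code e; 0; v]).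
by apply: (R 1 [:: seq_code e; x; nth 0 e x; v]) => //; apply: IH.
Qed.

Let J_tv e t : below e -> term_in L t -> term_below (size e) t ->
  exists v, [/\ v < N, dec v = teval (denv e) t & J 1 (seq_code e) (term_code t) v].
Proof.
have R i r h := @gen_clause base (sat_clauses N) i r h.
move=> he; elim/term_ind_list: t => [x|f ts IH] /=.
  move=> _ lt; exists (nth 0 e x); split => //; first by have /allP := he; apply; apply: mem_nth.
  by apply: (R 2 [:: seq_code e; x; nth 0 e x]) => //; apply: J_nth.
move=> /andP [/eqP hf /allIn hi] /allIn hb.
have [vs [h1 h2 h3 h4]] : exists vs, [/\ below vs, size vs = size ts,
    map dec vs = map (teval (denv e)) ts &
    J 2 (seq_code e) (seq_code (map term_code ts)) (seq_code vs)].
  elim: ts IH hi hb {hf} => [|t ts IHts] IH hi hb.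
    by exists [::]; split=> //; apply: (R 4 [:: seq_code e]).
  have [|||vs [h1 h2 h3 h4]] := IHts.
  - by move=> u hu; apply: IH; right.
  - by move=> u hu; apply: hi; right.
  - by move=> u hu; apply: hb; right.
  have [||| v [h5 h6 h7]] := IH t.
  - by left.
  - by apply: hi; left.
  - by apply: hb; left.
  exists (v :: vs); split=> //=; [by rewrite h5|by rewrite h2|by rewrite h6 h3|].
  by apply: (R 5 [:: seq_code e; 0; v; 0; term_code t; 0; seq_code (map term_code ts); seq_code vs]).
have [v hv ev] := dec_surj (mfun f (map (teval (denv e)) ts)).
exists v; split=> //.
apply: (R 3 [:: seq_code e; 0; v; 0; 0; 0; _; seq_code vs; f]) => //=.
by apply: J_base; rewrite /base !npE; exists vs; rewrite h2 h3 ev.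
Qed.

Let J_tvl e ts : below e -> all (term_in L) ts -> all (term_below (size e)) ts ->
  exists vs, [/\ below vs, size vs = size ts, map dec vs = map (teval (denv e)) ts &
    J 2 (seq_code e) (seq_code (map term_code ts)) (seq_code vs)].
Proof.
have R i r h := @gen_clause base (sat_clauses N) i r h.
move=> he; elim: ts => [|t ts IH] /=.
  by exists [::]; split=> //; apply: (R 4 [:: seq_code e]).
move=> /andP [hi /IH {}IH] /andP [hb /IH [vs [h1 h2 h3 h4]]].
have [v [h5 h6 h7]] := J_tv he hi hb.
exists (v :: vs); split=> //=; [by rewrite h5|by rewrite h2|by rewrite h6 h3|].
by apply: (R 5 [:: seq_code e; 0; v; 0; term_code t; 0; seq_code (map term_code ts); seq_code vs]).
Qed.

(** Horn clauses have no negation, so truth and falsity are generated separately; the two claims are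
    proved together because implication exchanges their roles. *)
Let J_sat e p : below e -> form_in L p -> form_below (size e) p ->
  (sat (denv e) p -> J 3 (seq_code e) (form_code p) 0) /\
  (~ sat (denv e) p -> J 4 (seq_code e) (form_code p) 0).
Proof.
have R i r h := @gen_clause base (sat_clauses N) i r h.
elim: p e => [|t u|r ts|p IHp q IHq|p IHp] e he /=.
- by split=> // _; apply: (R 10 [:: seq_code e]).
- move=> /andP [it iu] /andP [bt bu].
  have [v [h1 <- h2]] := J_tv he it bt; have [w [h3 <- h4]] := J_tv he iu bu.
  split=> h.
    apply: (R 6 [:: seq_code e; 0; v; w; term_code t; term_code u]) => //.
    by apply: J_base; rewrite /base !npE.
  apply: (R 7 [:: seq_code e; 0; v; w; term_code t; term_code u]) => //.
  by apply: J_base; rewrite /base !npE.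
- move=> /andP [/eqP hr hi] hb; have [vs [h1 h2 <- h4]] := J_tvl he hi hb.
  split=> h.
    apply: (R 8 [:: seq_code e; 0; 0; 0; 0; 0; _; seq_code vs; r]) => //=.
    by apply: J_base; rewrite /base !npE; exists vs; rewrite h2.
  apply: (R 9 [:: seq_code e; 0; 0; 0; 0; 0; _; seq_code vs; r]) => //=.
  by apply: J_base; rewrite /base !npE; exists vs; rewrite h2.
- move=> /andP [ip iq] /andP [bp bq].
  have [p1 p2] := IHp e he ip bp; have [q1 q2] := IHq e he iq bq.
  have [hq|nq] := classic (sat (denv e) q).
    split=> [_|[]] //.
    by apply: (R 12 [:: seq_code e; 0; 0; 0; 0; 0; 0; 0; 0; form_code p; form_code q]) => //; apply: q1.
  have [hp|np] := classic (sat (denv e) p).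
    split=> [/(_ hp)|_] //.
    by apply: (R 13 [:: seq_code e; 0; 0; 0; 0; 0; 0; 0; 0; form_code p; form_code q]) => //; [apply: p1 | apply: q2].
  split=> [_|[]] //.
  by apply: (R 11 [:: seq_code e; 0; 0; 0; 0; 0; 0; 0; 0; form_code p; form_code q]) => //; apply: p2.
- move=> ip bp.
  have IH j : j < N -> (sat (econs (dec j) (denv e)) p -> J 3 (seq_code (j :: e)) (form_code p) 0) /\
      (~ sat (econs (dec j) (denv e)) p -> J 4 (seq_code (j :: e)) (form_code p) 0).
    by move=> hj; rewrite -!(sat_ext p (denv_cons j e)); apply: IHp => //=; rewrite hj.
  split=> h.
    apply: (R 16 [:: seq_code e; 0; 0; 0; 0; 0; 0; 0; 0; form_code p]) => //=.
    suff H k : k <= N -> J 5 (seq_code e) (form_code p) k by apply: H.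
    elim: k => [|k IHk] hk; first exact: (R 14 [:: seq_code e; 0; 0; 0; 0; 0; 0; 0; 0; form_code p]).
    apply: (R 15 [:: seq_code e; k; 0; 0; 0; 0; 0; 0; 0; form_code p]) => //=.
      by apply: IHk; apply: ltnW.
    by apply: (IH k hk).1.
  have [d hd] := not_all_ex_not _ _ h; have [j hj ej] := dec_surj d.
  apply: (R 17 [:: seq_code e; j; 0; 0; 0; 0; 0; 0; 0; form_code p]) => //=.
    by apply: J_base; rewrite /base !npE.
  by apply: (IH j hj).2; rewrite ej.
Qed.

Lemma finite_model_re : re (model_theory L rho0).
Proof.
have hS : S1 (fun n => sentence_code (sig_code L) n /\ J 3 0 n 0).
  apply: S1_and; first by apply: S1_sentence; tc.
  have hg : S1 sgen by apply: S1_gen.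
  by apply: (S1_comp hg); tc.
have [e he] := S1_is_W hS; exists e => n; rewrite -he; split.
  move=> [[p <-]]; rewrite sig_codeK => sp /sat_sound; rewrite /meaning !npE => /(_ [::] p erefl erefl) h.
  by exists p; split=> //; split=> //; apply/(sat_sentence (denv [::]) rho0 sp).
move=> [p [[sp h] <-]]; split; first by exists p; rewrite ?sig_codeK.
have /andP [hi hb] := sp.
by apply: (@J_sat [::] p _ hi hb).1 => //; apply/(sat_sentence (denv [::]) rho0 sp).
Qed.

End FiniteModel.

(* A finite model would have an r.e., consistent and complete theory. *)
Theorem G1_models_infinite (A : theory) (M : structure) (rho : nat -> M) :
  G1 A -> (forall p, thm A p -> sat rho p) -> ~ exists ds : seq M, forall d, List.In d ds.
Proof.
move=> hG hM [ds hds].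
have [||p [sp [n1 n2]]] := hG (model_theory (sig A) rho) (@finite_model_re (sig A) M rho ds hds).
- by move=> [_ /=].
- apply: interpretable_extension; first by split.
  by move=> p hp; split; [exact: thm_sentence hp | exact: hM].
have [h|h] := classic (sat rho p); first by apply: n1.
apply: n2; split=> //.
by move: sp; rewrite /sentence /= => /andP [-> ->].
Qed.

(** * A pair of r.e. sets whose r.e. separators compute the halting problem *)

Lemma W_steps : exists t : nat -> bool,
  tcomp (fun z => t z) /\ forall e x, W e x <-> exists s, t (npair (npair e x) s).
Proof.
have [t [ht H]] := S1_W; exists t; split=> // e x.
by have := H (npair e x); rewrite !npE.
Qed.

(** The stage [s] is just a witness: the test may hold at [s] and fail later. Comparisons of
    enumerations therefore quantify over all earlier stages. *)
Definition wstep (e x s : nat) : bool :=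
  proj1_sig (constructive_indefinite_description _ W_steps) (npair (npair e x) s).

Lemma tc_wstep e x s : tcomp e -> tcomp x -> tcomp s -> tcomp (fun z => wstep (e z) (x z) (s z)).
Proof.
move=> he hx hs; rewrite /wstep.
by case: constructive_indefinite_description => t [ht _] /=; tc.
Qed.

Lemma W_wstep e x : W e x <-> exists s, wstep e x s.
Proof. by rewrite /wstep; case: constructive_indefinite_description => t [_] /=. Qed.

(* For [z = (e, k)]: at stage [s], [k] is in the halting problem, and [z] in [W e]. *)
Definition kin (z s : nat) : bool := wstep (nsnd z) (nsnd z) s.
Definition win (z s : nat) : bool := wstep (nfst z) z s.

(** The bound [s.+1], against [s] in [wfirst], awards ties to [wfirst]. So the two events exclude
    each other, and one of them occurs whenever [z] enters its [W e]. *)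
Definition kfirst (z : nat) : Prop := exists s, kin z s /\ forall i, i < s.+1 -> ~~ win z i.
Definition wfirst (z : nat) : Prop := exists s, win z s /\ forall i, i < s -> ~~ kin z i.
Definition setX (z : nat) : Prop := kfirst z.
Definition setY (z : nat) : Prop := wfirst z /\ W (nsnd z) (nsnd z).

Lemma tc_kin z s : tcomp z -> tcomp s -> tcomp (fun x => kin (z x) (s x)).
Proof. by move=> hz hs; apply: tc_wstep; tc. Qed.

Lemma tc_win z s : tcomp z -> tcomp s -> tcomp (fun x => win (z x) (s x)).
Proof. by move=> hz hs; apply: tc_wstep; tc. Qed.

Lemma S1_kfirst : S1 kfirst.
Proof.
apply: S1_ex; apply: S1_and; first by apply: S1_dec; apply: tc_kin; tc.
apply: S1_ball; last by tc.
by apply: S1_dec; apply: tc_neg; apply: tc_win; tc.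
Qed.

Lemma S1_wfirst : S1 wfirst.
Proof.
apply: S1_ex; apply: S1_and; first by apply: S1_dec; apply: tc_win; tc.
apply: S1_ball; last by tc.
by apply: S1_dec; apply: tc_neg; apply: tc_kin; tc.
Qed.

Lemma S1_setY : S1 setY.
Proof.
apply: S1_and; first exact: S1_wfirst.
have h : tcomp (fun z => npair (nsnd z) (nsnd z)) by tc.
by apply: (S1_ext _ (S1_comp S1_W h)) => n; rewrite !npE.
Qed.

Lemma first_disjoint z : kfirst z -> wfirst z -> False.
Proof.
move=> [s [hs h1]] [s' [hs' h2]]; have [lt|ge] := ltnP s s'.
  by have := h2 s lt; rewrite hs.
by have := h1 s' ge; rewrite hs'.
Qed.

Lemma first_total z : W (nfst z) z -> kfirst z \/ wfirst z.
Proof.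
move=> /W_wstep h; have [s hs hmin] := ex_minnP h.
have [[i hi ki]|no] := classic (exists2 i, i < s & kin z i).
  left; exists i; split=> // j hj; apply/negP => /hmin; lia.
by right; exists s; split=> // i hi; apply/negP => hk; apply: no; exists i.
Qed.

Lemma kfirst_halts z : kfirst z -> W (nsnd z) (nsnd z).
Proof. by move=> [s [hs _]]; apply/W_wstep; exists s. Qed.

(** The index [e] is that of the separator itself. If [k] halts and [z] is not in [C], then [z]
    never enters [W e] and so lies in [setX], a contradiction. Once [z] is in [C], one of [kfirst]
    and [wfirst] holds, and the latter would put [z] into [setY]. *)
Lemma halting_reduction (C : nat -> Prop) e k :
  (forall z, C z <-> W e z) -> (forall z, setX z -> C z) -> (forall z, setY z -> ~ C z) ->
  W k k <-> C (npair e k) /\ kfirst (npair e k).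
Proof.
move=> hW hX hY; split; last by move=> [_ /kfirst_halts]; rewrite npE.
move=> hk; set z := npair e k.
have kz : W (nsnd z) (nsnd z) by rewrite npE.
have hC : C z.
  have [//|nC] := classic (C z); apply: hX.
  move/W_wstep: kz => h; have [s hs hmin] := ex_minnP h; exists s; split=> // i _.
  by apply/negP => hi; apply: nC; apply/hW/W_wstep; exists i; move: hi; rewrite /win npE.
split=> //; have [|//|hw] := @first_total z; first by rewrite {1}/z npE; apply/hW.
by case: (@hY z).
Qed.

(** One query for [z = (e, k)] is enough. A negative answer means that [k] does not halt. A positive
    one means that [z] enters [W e], so the search for which of [kfirst] and [wfirst] holds
    terminates. *)
Lemma separator_turing (Q C : nat -> Prop) (g : nat -> nat) e :
    tcomp g -> (forall z, C z <-> Q (g z)) ->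
    (forall z, C z <-> W e z) -> (forall z, setX z -> C z) -> (forall z, setY z -> ~ C z) ->
  turing_le zero_jump Q.
Proof.
move=> hg hQ hW hX hY.
(* [v] is the pair of [k] and the answer of the oracle. *)
pose R v y := let z := npair e (nfst v) in
  (nsnd v = 0 /\ y = 0) \/
  (nsnd v = 1 /\ ((y = 1 /\ kfirst z) \/ (y = 0 /\ wfirst z))).
have [c hc] : exists c, forall X x y, (forall y', R x y' <-> y' = y) -> eval X c x y.
  apply: S1_function; rewrite /R; apply: S1_or.
    by apply: S1_and; apply: S1_eq; tc.
  apply: S1_and; first by apply: S1_eq; tc.
  have hz : tcomp (fun x => npair e (nfst (nfst x))) by tc.
  by apply: S1_or; apply: S1_and; [apply: S1_eq; tc | apply: (S1_comp S1_kfirst hz)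
    | apply: S1_eq; tc | apply: (S1_comp S1_wfirst hz)].
have [d hd] : tcomp (fun k => g (npair e k)) by tc.
(* [Pair Fst Snd] is the identity program; it hands [k] on beside the answer. *)
exists (Comp c (Pair (Pair Fst Snd) (Comp Oracle d))) => k.
have key o y : (Q (g (npair e k)) /\ o = 1) \/ (~ Q (g (npair e k)) /\ o = 0) ->
    (forall y', R (npair k o) y' <-> y' = y) ->
    eval Q (Comp c (Pair (Pair Fst Snd) (Comp Oracle d))) k y.
  move=> ho hR; exists (npair k o); split; last exact: hc.
  exists k, o; split; last split => //.
    by exists (nfst k), (nsnd k); rewrite npair_eta.
  by exists (g (npair e k)); split; [apply/hd | exact: ho].
have hK := halting_reduction k hW hX hY.
have [hC|nC] := classic (C (npair e k)); last first.
  split=> [/hK [] //|_]; apply: (key 0); first by right; rewrite -hQ.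
  by move=> y'; rewrite /R !npE; split=> [[[]|[]]|->] //; left.
have /first_total : W (nfst (npair e k)) (npair e k) by rewrite npE; apply/hW.
move=> [hk|hw].
  split=> [_|[]]; last by apply/hK.
  apply: (key 1); first by left; rewrite -hQ.
  move=> y'; rewrite /R !npE; split=> [[[]|[_ [[]|[_ /(first_disjoint hk)]]]]|->] //.
  by right; split=> //; left.
split=> [/hK [_ /first_disjoint] /(_ hw) //|_].
apply: (key 1); first by left; rewrite -hQ.
move=> y'; rewrite /R !npE; split=> [[[]|[_ [[_ /first_disjoint /(_ hw)]|[]]]]|->] //.
by right; split=> //; right.
Qed.

(** * The theory [B] *)

(* Two function symbols (zero and successor) and one unary relation are added
   after the symbols of [L]. *)
Definition sigB (L : signature) : signature :=
  Signature (rcons (rcons (funs L) 0) 1) (rcons (rels L) 1).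

Definition num (L : signature) (n : nat) : term :=
  iter n (fun t => Func (size (funs L)).+1 [:: t]) (Func (size (funs L)) [::]).

Definition atomP (L : signature) (n : nat) : form := Rel (size (rels L)) [:: num L n].

Lemma onth_rcons (T : Type) (s : seq T) x i y : onth s i = Some y -> onth (rcons s x) i = Some y.
Proof. by elim: s i => [|z s IH] [|i] //=; apply: IH. Qed.

Lemma onth_rcons_size (T : Type) (s : seq T) x : onth (rcons s x) (size s) = Some x.
Proof. by elim: s. Qed.

Lemma onth_lt (T : Type) (s : seq T) i y : onth s i = Some y -> i < size s.
Proof. by elim: s i => [|z s IH] [|i] //= /IH. Qed.

Lemma sig_incl_B L : sig_incl L (sigB L).
Proof. by split=> i k h /=; do ?apply: onth_rcons. Qed.

Lemma term_in_num L n : term_in (sigB L) (num L n).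
Proof.
have h := onth_rcons_size (rcons (funs L) 0) 1; rewrite size_rcons in h.
elim: n => [|n IH]; first by rewrite /= (onth_rcons _ (onth_rcons_size _ _)).
by apply/and3P; split=> //; apply/eqP.
Qed.

Lemma sentence_atomP L n : sentence (sigB L) (atomP L n).
Proof.
rewrite /sentence /= onth_rcons_size eqxx term_in_num /=.
by rewrite andbT; elim: n => //= n ->.
Qed.

Definition axB (A : theory) (q : form) : Prop :=
  thm A q \/ (exists z, setX z /\ q = atomP (sig A) z) \/
  (exists z, setY z /\ q = Neg (atomP (sig A) z)).

Definition thmB (A : theory) (q : form) : Prop :=
  sentence (sigB (sig A)) q /\ ded (sigB (sig A)) (axB A) q.

Lemma axB_sentence A q : axB A q -> sentence (sigB (sig A)) q.
Proof.
move=> [/thm_sentence h|[[z [_ ->]]|[z [_ ->]]]].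
- exact: sentence_incl (sig_incl_B _) h.
- exact: sentence_atomP.
- by have := sentence_atomP (sig A) z; rewrite /sentence /= => /andP [-> ->].
Qed.

Lemma thmB_closed A G p : (forall q, List.In q G -> thmB A q) ->
  sentence (sigB (sig A)) p -> prv (sigB (sig A)) G p -> thmB A p.
Proof.
move=> h sp hp; split=> //; apply: ded_prv hp => q /h [] //.
by move=> /andP [].
Qed.

Definition theoryB (A : theory) : theory :=
  @Theory (sigB (sig A)) (thmB A) (fun p h => proj1 h) (@thmB_closed A).

Lemma axB_thm A q : axB A q -> thm (theoryB A) q.
Proof. by move=> h; split; [apply: axB_sentence | apply: ded_hyp]. Qed.

(** * Consistency of the new theory, by expanding an infinite model *)

Lemma infinite_injection (T : Type) :
  ~ (exists ds : seq T, forall d, List.In d ds) -> exists m : nat -> T, injective m.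
Proof.
move=> hinf.
(* [f] chooses an element outside each finite list; iterating it yields a sequence without
   repetitions. *)
have [f hf] : exists f : seq T -> T, forall l, ~ List.In (f l) l.
  apply: (choice (fun l x => ~ List.In x l)) => l.
  by apply: not_all_ex_not => h; apply: hinf; exists l.
pose L := fix L n := if n is k.+1 then f (L k) :: L k else [::].
have hL i j : i < j -> List.In (f (L i)) (L j).
  elim: j => // j IH; rewrite ltnS leq_eqVlt => /orP [/eqP ->|/IH]; by [left|right].
exists (fun n => f (L n)) => i j e; case: (ltngtP i j) => // /hL.
  by rewrite e => /hf.
by rewrite -e => /hf.
Qed.

Section Expansion.

Variables (L : signature) (M : structure) (m : nat -> M).
Hypothesis m_inj : injective m.

Let idx (d : M) : nat := epsilon (inhabits 0) (fun i => m i = d).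

Let idxK i : idx (m i) = i.
Proof. by apply: m_inj; apply: (@epsilon_spec _ _ (fun j => m j = m i)); exists i. Qed.

(** The numeral of [n] denotes [m n], and the predicate holds there exactly for [n] in [setX].
    Outside the range of [m] the value of [idx] is arbitrary, but the new axioms concern numerals
    only. *)
Definition expansion : structure :=
  @Structure M
    (fun f ds => if f == size (funs L) then m 0
       else if f == (size (funs L)).+1 then m (idx (head (m 0) ds)).+1 else mfun f ds)
    (fun r ds => if r == size (rels L) then setX (idx (head (m 0) ds)) else mrel r ds).

Let teval_exp (rho : nat -> M) t : term_in L t -> teval (M := expansion) rho t = teval rho t.
Proof.
elim/term_ind_list: t => //= f ts IH /andP [/eqP hf /allIn h]; have lt := onth_lt hf.
rewrite !ltn_eqF //; last exact: leqW.
by congr mfun; apply: eq_map_in => t ht; apply: IH => //; apply: h.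
Qed.

Lemma sat_expansion (rho : nat -> M) p : form_in L p -> sat (M := expansion) rho p <-> sat rho p.
Proof.
elim: p rho => [|t u|r ts|p IHp q IHq|p IHp] rho //=.
- by move=> /andP [ht hu]; rewrite !teval_exp.
- move=> /andP [/eqP hr /allIn h]; have lt := onth_lt hr; rewrite ltn_eqF //.
  suff -> : map (teval (M := expansion) rho) ts = map (teval rho) ts by [].
  by apply: eq_map_in => t /h; apply: teval_exp.
- by move=> /andP [hp hq]; rewrite IHp // IHq.
- by move=> hp; split=> h d; apply/IHp => //; apply: h.
Qed.

Lemma sat_expansion_atomP (rho : nat -> M) n : sat (M := expansion) rho (atomP L n) <-> setX n.
Proof.
have e : teval (M := expansion) rho (num L n) = m n.
  elim: n => [|n IH]; first by rewrite /= eqxx.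
  have -> : num L n.+1 = Func (size (funs L)).+1 [:: num L n] by [].
  by rewrite /= IH gtn_eqF // eqxx idxK.
by rewrite /= eqxx e idxK.
Qed.

End Expansion.

Lemma theoryB_consistent A : consistent A -> G1 A -> consistent (theoryB A).
Proof.
move=> hA hG [_ [G hGax hb]].
have [||M [rho hM]] := @model_exists (sig A) (thm A).
- by move=> p; apply: thm_sentence.
- by move=> [H hH h]; apply: hA; apply: thm_closed h.
have [m hm] := infinite_injection (G1_models_infinite hG hM).
have := soundness hb (M := expansion (sig A) m) (rho := rho); apply => q /hGax.
move=> [h|[[z [hz ->]]|[z [hz ->]]]].
- apply/sat_expansion; first by have /andP [] := thm_sentence h.
  exact: hM.
- by apply/sat_expansion_atomP.
- by move=> /sat_expansion_atomP hx; apply: first_disjoint (hx hm) hz.1.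
Qed.

Lemma theoryB_interprets A : interpretable A (theoryB A).
Proof.
apply: interpretable_extension; first exact: sig_incl_B.
by move=> p hp; apply: axB_thm; left.
Qed.

(** The symbols of [A] keep their positions in the larger signature, so an interpretation of the
    extension is, unchanged, one of [A]. *)
Lemma theoryB_G1 A : G1 A -> G1 (theoryB A).
Proof.
move=> hG S rS cS [J [[h1 h2 h3 h4] hJ]]; apply: hG => //.
have [hf hr] := sig_incl_B (sig A).
exists J; split; first by split=> // i k h; [apply: h3; apply: hr | apply: h4; apply: hf].
by move=> p hp; apply: hJ; apply: axB_thm; left.
Qed.

(** * The original theory does not interpret the new one *)

Section NumeralTranslation.

Variables (L : signature) (J : translation).

(** The translated constant zero: without arguments there is no quantifier, and the conjunction over
    them is [Top]. *)
Definition num_code0 : nat :=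
  form_code (And Top (at_vars [:: 0] (tr_fun J (size (funs L))))).

Definition cneg (p : nat) : nat := npair 3 (npair p (npair 0 0)).
Definition cand (p q : nat) : nat := cneg (npair 3 (npair p (cneg q))).
Definition cex (p : nat) : nat := cneg (npair 4 (cneg p)).

(** The shape of a translated unary application, for the domain [d], the graph [f] and the
    translated argument [v]; [Top] ends the one-element conjunction. *)
Definition app_code (d f v : nat) : nat := cex (cand d (cand (cand v (form_code Top)) f)).

Lemma form_code_app d f v :
  form_code (Ex (And d (And (And v Top) f))) = app_code (form_code d) (form_code f) (form_code v).
Proof. by []. Qed.

(** Numerals are closed, so the renaming [s] is immaterial, and every level asks for the value of
    its argument at the variable [0]. Hence the code arises by plain iteration. *)
Lemma tr_val_num n s :
  form_code (tr_val J s (num L n) 0) =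
  iter n (app_code (form_code (tr_dom J)) (form_code (at_vars [:: 0; 1] (tr_fun J (size (funs L)).+1))))
    num_code0.
Proof. by elim: n s => [|n IH] s //; rewrite iterS -(IH (fun x => s x + 1)). Qed.

Lemma tc_tr_atomP : tcomp (fun n => form_code (tr_form J (atomP L n))).
Proof.
pose d := form_code (tr_dom J).
pose f := form_code (at_vars [:: 0; 1] (tr_fun J (size (funs L)).+1)).
have hstep x : tcomp (fun v => app_code d x v) by rewrite /app_code /cex /cand /cneg; tc.
have hv : tcomp (fun n => iter n (app_code d f) num_code0).
  by apply: (tc_iter (s := fun _ => app_code d f)); [exact: (tc_comp (hstep f) (tc_snd tc_id)) | tc | tc].
(* A unary atom is translated in the same shape as a unary application, with the formula for the
   relation in place of the graph. *)
apply: (tc_ext _ (tc_comp (hstep (form_code (at_vars [:: 0] (tr_rel J (size (rels L)))))) hv)) => n.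
by rewrite -(tr_val_num n (addn 1)) -form_code_app.
Qed.

End NumeralTranslation.

(** The set [C] reduces to the theorems of [A] through the computable [g], so the theorems of [A]
    can serve as the oracle; it is r.e. because [A] is, which provides the index [e]. *)
Lemma theoryB_not_interpretable A : consistent A -> re A ->
  ~ turing_le zero_jump (thm_codes A) -> ~ interpretable (theoryB A) A.
Proof.
move=> cA [eA hA] hT [J [okJ hJ]]; apply: hT.
have hg := tc_tr_atomP (sig A) J; set g := fun n : nat => _ in hg.
pose C z := thm_codes A (g z).
have hC z : C z <-> thm A (tr_form J (atomP (sig A) z)).
  split=> [[p [hp /form_code_inj <-]] //|h]; by exists (tr_form J (atomP (sig A) z)).
have S1C : S1 C.
  have h : tcomp (fun z => npair eA (g z)) by tc.
  by apply: (S1_ext _ (S1_comp S1_W h)) => z; rewrite !npE; apply: hA.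
have [e he] := S1_is_W S1C.
apply: (separator_turing hg (fun z => iff_refl (C z)) he).
  by move=> z hz; apply/hC; apply: hJ; apply: axB_thm; right; left; exists z.
move=> z hz /hC h1; apply: cA.
(* [tr_form] commutes with negation, so the two translated theorems contradict each other. *)
have h2 : thm A (tr_form J (Neg (atomP (sig A) z))).
  by apply: hJ; apply: axB_thm; right; right; exists z.
apply: (@thm_closed A [:: tr_form J (Neg (atomP (sig A) z)); tr_form J (atomP (sig A) z)]) => //.
  by move=> q [<-|[<-|]].
by apply: (ImpE (p := tr_form J (atomP (sig A) z))); apply: Hyp; [left | right; left].
Qed.

(** * An r.e. index of [B] *)

Definition sigB_code (l : nat) : nat :=
  npair (seq_code (rcons (rcons (seq_decode (nfst l)) 0) 1)) (seq_code (rcons (seq_decode (nsnd l)) 1)).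

Lemma sigB_codeE L : sigB_code (sig_code L) = sig_code (sigB L).
Proof. by rewrite /sigB_code /sig_code !npE !seq_codeK. Qed.

Lemma tc_sigB_code : tcomp sigB_code.
Proof.
have h1 : tcomp (fun x => seq_code (rcons (seq_decode x) 1)) by apply: tc_rcons; tc.
have h0 : tcomp (fun x => seq_code (rcons (seq_decode (nfst x)) 0)) by apply: tc_rcons; tc.
apply: tc_pair; last by apply: tc_rcons; tc.
by apply: (tc_ext _ (tc_comp h1 h0)) => x; rewrite seq_codeK.
Qed.

Definition atomP_code (l n : nat) : nat :=
  let f := size (seq_decode (nfst l)) in
  npair 2 (npair (size (seq_decode (nsnd l)))
    (npair (iter n (fun c => npair 1 (npair f.+1 (npair c 0).+1)) (npair 1 (npair f 0))) 0).+1).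

Lemma atomP_codeE L n : atomP_code (sig_code L) n = form_code (atomP L n).
Proof.
rewrite /atomP_code /sig_code !npE !seq_codeK.
suff -> : iter n (fun c => npair 1 (npair (size (funs L)).+1 (npair c 0).+1))
    (npair 1 (npair (size (funs L)) 0)) = term_code (num L n) by [].
by elim: n => //= n ->.
Qed.

Lemma tc_atomP_code l n : tcomp l -> tcomp n -> tcomp (fun x => atomP_code (l x) (n x)).
Proof.
move=> hl hn; have hf : tcomp (fun x => size (seq_decode (nfst (l x)))) by apply: tc_size; tc.
apply: tc_pair; first by tc.
apply: tc_pair; first by apply: tc_size; tc.
apply: tc_succ; apply: tc_pair; last by tc.
apply: (tc_iter (s := fun x c => npair 1 (npair (size (seq_decode (nfst (l x)))).+1 (npair c 0).+1))) => //.
  have h := tc_comp hf (tc_fst tc_id); by tc.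
by tc.
Qed.

Definition axB_code (l e q : nat) : Prop :=
  W e q \/ (exists z, setX z /\ q = atomP_code l z) \/
  (exists z, setY z /\ q = cneg (atomP_code l z)).

Definition thmB_code (l e n : nat) : Prop :=
  sentence_code (sigB_code l) n /\
  exists g, jud 14 (sigB_code l) g n /\ forall q, q \in seq_decode g -> axB_code l e q.

(** The signature and the index of [A] are inputs here; this uniformity is what makes the passage
    from [A] to an index of [B] effective. *)
Lemma S1_thmB : S1 (fun z => thmB_code (nfst (nfst z)) (nsnd (nfst z)) (nsnd z)).
Proof.
have hs : tcomp (fun z => sigB_code (nfst (nfst z))).
  by apply: (tc_comp tc_sigB_code); tc.
apply: S1_and; first by apply: S1_sentence; tc.
apply: S1_ex; apply: S1_and.
  have h : tcomp (fun z => sigB_code (nfst (nfst (nfst z)))) by apply: (tc_comp hs (tc_fst tc_id)).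
  by apply: (S1_comp S1_logic); tc.
apply: S1_all_in; last by tc.
apply: S1_or.
  have h : tcomp (fun z => npair (nsnd (nfst (nfst (nfst z)))) (nsnd z)) by tc.
  by apply: (S1_ext _ (S1_comp S1_W h)) => z; rewrite !npE.
apply: S1_or; apply: S1_ex; apply: S1_and.
- by apply: (S1_comp S1_kfirst); tc.
- by apply: S1_eq; [tc | apply: tc_atomP_code; tc].
- by apply: (S1_comp S1_setY); tc.
- by apply: S1_eq; [tc | rewrite /cneg; tc; apply: tc_atomP_code; tc].
Qed.

Lemma axB_codeE A e q : re_index e A ->
  axB_code (sig_code (sig A)) e q <-> exists2 p, form_code p = q & axB A p.
Proof.
move=> hA; split.
  move=> [/hA [p [hp <-]]|[[z [hz ->]]|[z [hz ->]]]].
  - by exists p => //; left.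
  - by exists (atomP (sig A) z); [rewrite atomP_codeE | right; left; exists z].
  - by exists (Neg (atomP (sig A) z)); [rewrite atomP_codeE | right; right; exists z].
move=> [p <- [hp|[[z [hz ->]]|[z [hz ->]]]]].
- by left; apply/hA; exists p.
- by right; left; exists z; rewrite atomP_codeE.
- by right; right; exists z; rewrite atomP_codeE.
Qed.

Lemma thmB_codeE A e n : re_index e A ->
  thmB_code (sig_code (sig A)) e n <-> thm_codes (theoryB A) n.
Proof.
move=> hA; rewrite /thmB_code sigB_codeE /sentence_code sig_codeK; split.
  move=> [[p <- sp] [g [hj hg]]]; exists p; split=> //; split=> //.
  have [G eG hG] : exists2 G, seq_code (map form_code G) = g & forall q, List.In q G -> axB A q.
    suff [G eG hG] : exists2 G, map form_code G = seq_decode g & forall q, List.In q G -> axB A q.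
      by exists G => //; rewrite eG seq_decodeK.
    elim: (seq_decode g) hg => [|x s IH] hg; first by exists [::].
    have [y hy|G eG hG] := IH; first by apply: hg; rewrite inE hy orbT.
    have [|q eq hq] := (axB_codeE x hA).1 (hg x _); first by rewrite inE eqxx.
    by exists (q :: G); [rewrite /= eq eG | move=> r [<-|/hG]].
  move: hj; rewrite -eG => /jud_prvP [q /form_code_inj -> hq].
  by exists G.
move=> [p [[sp [G hG hp]] <-]]; split; first by exists p.
exists (seq_code (map form_code G)); split; first by apply/jud_prvP; exists p.
move=> q; rewrite seq_codeK => hq; apply/axB_codeE => //.
suff [p' hp' e'] : exists2 p', List.In p' G & form_code p' = q by exists p' => //; apply: hG.
elim: G hq {hG hp} => //= r G IH; rewrite inE => /orP [/eqP ->|/IH [p' h1 h2]].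
  by exists r => //; left.
by exists p' => //; right.
Qed.

(** The computable ingredient of the s-m-n theorem: a given number can be hardwired into a
    program. *)
Lemma tc_const_code : tcomp (fun a => code_num (const_code a)).
Proof.
have h : tcomp (fun a => iter a (fun x => npair 6 (npair (npair 1 0) x)) (npair 0 0)).
  by apply: (tc_iter (s := fun _ x => npair 6 (npair (npair 1 0) x))); tc.
by apply: (tc_ext _ h) => a; elim: a => //= a ->.
Qed.

(** An instance of the s-m-n theorem: [k] semidecides the theorems uniformly in the presentation,
    and [prog a] is [k] with the presentation [a] fixed. *)
Theorem theoryB_effective : exists c : code, forall (A : theory) (a : nat), presents a A ->
  exists b, computes c a b /\ presents b (theoryB A).
Proof.
have [k hk] := S1_domain S1_thmB.
pose prog a := Comp k (Pair (const_code a) (Pair Fst Snd)).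
have [c hc] : tcomp (fun a => npair (sigB_code (nfst a)) (code_num (prog a))).
  apply: tc_pair; first by apply: (tc_comp tc_sigB_code); tc.
  have h := tc_const_code; by rewrite /prog /=; tc.
exists c => A a [e [he ->]]; eexists; split; first by apply/hc; reflexivity.
exists (code_num (prog (npair (sig_code (sig A)) e))); split; last by rewrite npE sigB_codeE.
move=> n; rewrite W_code_num -(thmB_codeE n he).
have := hk empty_oracle (npair (npair (sig_code (sig A)) e) n); rewrite !npE => ->.
rewrite /computes /=; split.
  move=> [y [u [[v [w [/const_codeE -> [[v' [w' [-> [-> ->]]]] ->]]]]]]].
  by rewrite npair_eta => h; exists y.
move=> [y hy]; exists y, (npair (npair (sig_code (sig A)) e) n); split=> //.
exists (npair (sig_code (sig A)) e), n; split; first exact/const_codeE.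
by split=> //; exists (nfst n), (nsnd n); rewrite npair_eta.
Qed.

(** The program is quantified before the theory, which expresses effectivity. Consistency of [A] is
    a hypothesis because an inconsistent theory satisfies [G1] vacuously and interprets every
    theory. *)
Theorem theorem4p16 :
  exists c : code,
    forall (A : theory) (a : nat),
      presents a A ->
      consistent A ->
      turing_lt (thm_codes A) zero_jump ->
      G1 A ->
      exists (b : nat) (B : theory),
        computes c a b /\
        presents b B /\
        consistent B /\
        G1 B /\
        strictly_interpretable A B.
Proof.
have [c hc] := theoryB_effective; exists c => A a pA cA [_ hT] hG.
have [b [hb pB]] := hc A a pA; exists b, (theoryB A); split=> //; split=> //.
split; first exact: theoryB_consistent.
split; first exact: theoryB_G1.
split; first exact: theoryB_interprets.
by apply: theoryB_not_interpretable => //; case: pA => e [he _]; exists e.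
Qed.
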